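(* Let $k$ be a positive integer and $I \subseteq \{1,\dots,k\}$. Let $G$ be a $(26k+24|I|)$-connected graph and let $S = \{\{s_1,t_1\},\dots,\{s_k,t_k\}\}$ where $s_1,\dots,s_k,t_1,\dots,t_k$ are $2k$ distinct vertices of $G$. If there is a nice partition $(A,B)$ of $G$ that has a parity breaking matching for $(S,I)$, then for every choice of parities $(p_i)_{i \in I}$ with $p_i \in \{\text{even},\text{odd}\}$, $G$ contains pairwise vertex-disjoint paths $P_1,\dots,P_k$ such that $P_i$ has ends $s_i$ and $t_i$ for each $i \in \{1,\dots,k\}$, and the length of $P_i$ has parity $p_i$ for each $i \in I$.
   Context: All graphs are finite and simple. A partition $(A,B)$ of $G$ is a partition of $V(G)$ into two sets $A,B$. For such a partition, $G_{A,B}$ denotes the graph $G[A] \cup G[B]$, i.e. the graph whose edges are the edges of $G$ with both ends in $A$ or both ends in $B$. An odd cycle cover of $G$ is a set $X \subseteq V(G)$ such that $G - X$ is bipartite; it is minimum if it has the smallest possible size. A partition $(A,B)$ of $G$ is nice if there is a minimum odd cycle cover $X$ of $G$ such that $A \setminus X$ and $B \setminus X$ are both independent sets of $G$ (so $(A\setminus X, B\setminus X)$ is a bipartition of $G-X$), every vertex of $X$ having more neighbours in $B\setminus X$ than in $A \setminus X$ lies in $A$, and every vertex of $X$ having more neighbours in $A\setminus X$ than in $B\setminus X$ lies in $B$. For $S = \{\{s_1,t_1\},\dots,\{s_k,t_k\}\}$ and $I \subseteq \{1,\dots,k\}$, a parity breaking matching for $(S,I)$ with respect to a partition $(A,B)$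 is a matching $M = \{m_i\}_{i \in I}$ of $G$ (indexed by $I$) with $M \subseteq E(G_{A,B})$ such that $m_i \cap \{s_j,t_j\} = \emptyset$ for all $i \in I$ and all $j \in \{1,\dots,k\}$ with $j \neq i$. *)

(* Defs.v *)
From mathcomp Require Import all_boot.
Set Implicit Arguments. Unset Strict Implicit. Unset Printing Implicit Defensive.

Section Graphs.
Variables (T : finType) (e : rel T).

Definition simple_graph : Prop := symmetric e /\ irreflexive e.

Definition del_rel (X : {set T}) : rel T :=
  [rel x y | [&& e x y, x \notin X & y \notin X]].

Definition k_connected (k : nat) : Prop :=
  k < #|T| /\
  forall X : {set T}, #|X| < k ->
    forall x y, x \notin X -> y \notin X -> connect (del_rel X) x y.

Definition independent (A : {set T}) : Prop :=
  forall x y, x \in A -> y \in A -> ~~ e x y.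

Definition odd_cycle_cover (X : {set T}) : Prop :=
  exists c : T -> bool, forall x y, x \notin X -> y \notin X -> e x y -> c x != c y.

Definition min_odd_cycle_cover (X : {set T}) : Prop :=
  odd_cycle_cover X /\ forall Y : {set T}, odd_cycle_cover Y -> #|X| <= #|Y|.

Definition nbrs_in (v : T) (Z : {set T}) : nat := #|[set y in Z | e v y]|.

Definition nice_partition (A : {set T}) : Prop :=
  let B := ~: A in
  exists X : {set T},
    [/\ min_odd_cycle_cover X,
        independent (A :\: X),
        independent (B :\: X),
        (forall v, v \in X -> nbrs_in v (A :\: X) < nbrs_in v (B :\: X) -> v \in A) &
        (forall v, v \in X -> nbrs_in v (B :\: X) < nbrs_in v (A :\: X) -> v \in B)].

Definition parity_breaking_matching (k : nat) (s t : 'I_k -> T) (I : {set 'I_k})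
    (A : {set T}) (u v : 'I_k -> T) : Prop :=
  [/\ (forall i, i \in I -> e (u i) (v i) /\ ((u i \in A) = (v i \in A))),
      (forall i j, i \in I -> j \in I -> i != j ->
         [disjoint [set u i; v i] & [set u j; v j]]) &
      (forall i j, i \in I -> i != j ->
         [disjoint [set u i; v i] & [set s j; t j]])].

Definition has_parity_breaking_matching (k : nat) (s t : 'I_k -> T) (I : {set 'I_k})
    (A : {set T}) : Prop :=
  exists u v : 'I_k -> T, parity_breaking_matching s t I A u v.

End Graphs.

(* Main.v *)
Require Import Defs.
From mathcomp Require Import all_boot.
From Stdlib Require Import Classical.
From mathcomp Require Import zify.
Set Implicit Arguments. Unset Strict Implicit. Unset Printing Implicit Defensive.

(** Put m = k + |I|, K = 13k + 12|I| and N = 2k + |I|.  In a bipartite graph H the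
    parity of a path is determined by its ends, so it suffices to link at most 2m
    roots in H and to send the i-th path, where its parity is wrong, through an
    additional piece whose parity disagrees with the bipartition of H.

    A maximum cut of G has minimum degree at least K.  A minimal subgraph H of it
    with more than K(|H| - 2m)/2 edges is 2m-connected, and every set of at most
    2m vertices of H is linked: in a minimal counterexample (after Thomas and
    Wollan) contracting edges at a vertex v of degree less than K shows that the
    closed neighbourhood D of v satisfies |D| <= K and 2 deg >= K - 1 in D, and
    then D, or else one of the two parts into which a failed linkage cuts D,
    links all its sets of at most 2m vertices; Menger's theorem leads there.

    Matchings in two copies of G, joined by the edges between the copies of each
    vertex outside H, encode disjoint paths with ends in H of the wrong parity.
    By the Tutte-Berge formula and connectivity there are N such paths, or 2N - 2
    vertices meet all odd cycles.  In the first case take 2k disjoint paths from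
    the terminals to H using as few edges as possible outside the N paths; they
    meet at most 2k of these, which leaves |I| pieces to repair parities.  In the
    second case the edges across the nice partition form a 2m-connected graph of
    large degree, again linked, and the matching provides the pieces. *)

(** * Paths and Menger's theorem *)

(** The constants come from the dense linkage step. A partial linkage on at most 6m vertices must
    leave each of its vertices a neighbour outside, so 6m <= (K-1)/2, that is K > 12m. Two pairs of
    vertices violating the Ore bounds on the two sides of a failed linkage have at most 7m more
    incidences with it than it has vertices, and each bound asks for an excess c of about 11m/4;
    hence 2K >= 25m, as 25/2 = 7 + 11/2. Since |I| <= k, the value K = 12m + k meets both demands,
    and passing to a maximum cut may halve degrees, so G needs 2K = 26k + 24|I|. The obstacle is
    that connectivity is lost in the cut, so links are found only inside a dense part H of G.
    Terminals and parity pieces have to be led into H without meeting each other, and the number of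
    pieces must allow for those spoiled on the way. If too few pieces exist, the odd cycle cover has
    fewer than 4m vertices, and a vertex off it keeps degree at least 22m + 2 across the partition.
    Niceness is needed for the vertices of the cover: it secures half of that amount for them. *)

Ltac nlia := repeat match goal with
  | H : ?P |- _ => lazymatch P with
    | is_true (leq _ _) => fail | @eq nat _ _ => fail | nat => fail
    | _ => clear H end
  end; lia.

Section Connection.
Variable T : finType.
Implicit Types (e : rel T) (C : {set T}).

Definition rin e C : rel T := [rel x y | [&& e x y, x \in C & y \in C]].

Definition jn e C x y := [&& x \in C, y \in C & connect (rin e C) x y].

Lemma jn_refl e C x : x \in C -> jn e C x x.
Proof. by move=> xC; rewrite /jn xC connect0. Qed.

Lemma jn_trans e C y x z : jn e C x y -> jn e C y z -> jn e C x z.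
Proof.
case/and3P=> xC _ xy /and3P [_ zC yz]; apply/and3P; split=> //.
exact: connect_trans xy yz.
Qed.

Lemma jn_sym e C x y : symmetric e -> jn e C x y -> jn e C y x.
Proof.
move=> se /and3P [xC yC xy].
have cs : connect_sym (rin e C).
  by apply: sym_connect_sym => a b; rewrite /rin /= se [(a \in C) && _]andbC.
by rewrite /jn yC xC cs.
Qed.

Lemma jn_edge e C x y : x \in C -> y \in C -> e x y -> jn e C x y.
Proof.
by move=> xC yC xy; rewrite /jn xC yC connect1 // /rin /= xy xC yC.
Qed.

Lemma jn_mono e e' C C' x y :
  C \subset C' -> {in C &, subrel e e'} -> jn e C x y -> jn e' C' x y.
Proof.
move=> /subsetP sC se /and3P [xC yC xy]; apply/and3P; split; [exact: sC | exact: sC|].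
apply: connect_sub xy => a b /and3P [ab aC bC].
by rewrite connect1 // /rin /= se //= !sC.
Qed.

Lemma jn_sub e C C' x y : C \subset C' -> jn e C x y -> jn e C' x y.
Proof. by move=> sC; apply: jn_mono. Qed.

Lemma path_jn e C x p :
  path e x p -> {subset x :: p <= C} -> jn e C x (last x p).
Proof.
elim: p x => [|y p IH] x /=; first by move=> _ sC; apply/jn_refl/sC/mem_head.
case/andP=> xy yp sC.
have sC' : {subset y :: p <= C} by move=> z zp; apply: sC; rewrite inE zp orbT.
apply: jn_trans (IH _ yp sC'); apply: jn_edge xy.
  exact/sC/mem_head.
exact/sC'/mem_head.
Qed.

Lemma jn_path e C x y : jn e C x y ->
  exists p, [/\ path e x p, last x p = y, uniq (x :: p) & {subset x :: p <= C}].
Proof.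
case/and3P=> xC yC /connectP [p pth ->].
case/shortenP: pth => p' pth' up' _; exists p'; split=> //.
  by apply: sub_path pth' => a b /and3P [].
move=> z; rewrite inE => /predU1P [->|] //.
elim: p' (x) pth' {up'} => [|w p' IH] x' //= /andP [/and3P [_ _ wC] pth'].
by rewrite inE => /predU1P [->|] //; apply: IH pth'.
Qed.

End Connection.

Section Menger.
Variable T : finType.
Implicit Types (e : rel T) (A B S : {set T}).

Definition separates e A B S :=
  forall x p, x \in A -> path e x p -> last x p \in B -> has (mem S) (x :: p).

Lemma first_in S x p : has (mem S) (x :: p) ->
  exists p1 p2, [/\ p = p1 ++ p2, last x p1 \in S & {in belast x p1, forall z, z \notin S}].
Proof.
elim: p x => [|y p IH] x.
  by rewrite has_seq1 => xS; exists [::], [::].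
have [xS _|xS] := boolP (x \in S); first by exists [::], (y :: p).
rewrite [has _ _]/= (negPf xS) => /IH [p1 [p2 [-> lS bS]]].
exists (y :: p1), p2; split=> // z /predU1P [->|] //; exact: bS.
Qed.

Lemma last_in S x p : has (mem S) (x :: p) ->
  exists p1 p2, [/\ p = p1 ++ p2, last x p1 \in S & {in p2, forall z, z \notin S}].
Proof.
elim: p x => [|y p IH] x.
  by rewrite has_seq1 => xS; exists [::], [::].
have [h _|/hasPn h] := boolP (has (mem S) (y :: p)).
  by have [p1 [p2 [-> lS bS]]] := IH _ h; exists (y :: p1), p2.
case/hasP=> z; rewrite inE => /predU1P [-> xS|/h /negPf /= ->] //.
by exists [::], (y :: p).
Qed.

Lemma mem_cut (x : T) p z : z \in x :: p -> exists p1 p2, p = p1 ++ p2 /\ last x p1 = z.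
Proof. by case/splitPl => p1 p2 lz; exists p1, p2. Qed.

(** Repetitions are dropped first; then the path is cut at its last vertex in [A], and the remainder
    at its first vertex in [B]. In this order the second cut cannot bring back a vertex of [A]. *)
Lemma trim_path e A B x p : x \in A -> path e x p -> last x p \in B ->
  exists x' p', [/\ {subset x' :: p' <= x :: p}, x' \in A, path e x' p',
    last x' p' \in B & [/\ uniq (x' :: p'), {in p', forall z, z \notin A}
      & {in belast x' p', forall z, z \notin B}]].
Proof.
move=> xA pth lB.
have [q [pq lq uq sq]] : exists q, [/\ path e x q, last x q = last x p,
    uniq (x :: q) & {subset x :: q <= x :: p}].
  case/shortenP: pth => q pq uq sq; exists q; split=> //.
  by move=> z; rewrite !inE => /orP [->|/sq ->]; rewrite ?orbT.
rewrite -{}lq {lB} in (lB) *.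
have [|p1 [p2 [eq lA nA]]] := @last_in A x q; first by rewrite /= xA.
rewrite {}eq cat_path last_cat -cat_cons cat_uniq in pq lB uq sq.
move: pq uq => /andP [_ pq] /and3P [_ d1 u2].
have u2' : uniq (last x p1 :: p2).
  rewrite /= u2 andbT; apply/negP => h; case/hasP: d1; exists (last x p1) => //.
  exact: mem_last.
have [|p3 [p4 [eq lB' nB]]] := @first_in B (last x p1) p2.
  by apply/hasP; exists (last (last x p1) p2) => //; apply: mem_last.
exists (last x p1), p3; move: pq u2' nA sq.
rewrite {}eq cat_path -cat_cons cat_uniq => /andP [pq _] /and3P [u3 _ _] nA sq.
split=> //; last by split=> // z zp; apply: nA; rewrite mem_cat zp.
move=> z; rewrite inE => /predU1P [->|zp]; apply: sq; rewrite mem_cat ?mem_last //.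
by rewrite mem_cat zp orbT.
Qed.

Definition path_family e A B k (x : 'I_k -> T) (p : 'I_k -> seq T) :=
  [/\ forall i, x i \in A, forall i, path e (x i) (p i),
      forall i, last (x i) (p i) \in B, forall i, uniq (x i :: p i) &
      forall i j z, z \in x i :: p i -> z \in x j :: p j -> i = j].

Lemma trim_family e A B k x p : @path_family e A B k x p ->
  exists x' p', [/\ @path_family e A B k x' p',
    forall i, {subset x' i :: p' i <= x i :: p i},
    forall i z, z \in p' i -> z \notin A &
    forall i z, z \in belast (x' i) (p' i) -> z \notin B].
Proof.
case=> xA pth lB up dj.
have /fin_all_exists [x' /fin_all_exists [p' H]] i := trim_path (xA i) (pth i) (lB i).
exists x', p'; split.
- split=> [i|i|i|i|i j z zi zj]; try by case: (H i) => ? ? ? ? [].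
  by apply: (dj i j z); [case: (H i) => + _ _ _ _| case: (H j) => + _ _ _ _]; apply.
- by move=> i; case: (H i).
- by move=> i z; case: (H i) => _ _ _ _ [_ + _]; apply.
- by move=> i z; case: (H i) => _ _ _ _ [_ _ +]; apply.
Qed.

Lemma last_mem_belast (x : T) p z : z \in x :: p -> z != last x p -> z \in belast x p.
Proof.
by rewrite lastI mem_rcons inE => /predU1P [->|//]; rewrite eqxx.
Qed.

(** Induction on the number of directed edges. If deleting the edge from [x0] to [y0] creates a
    separator [S] with fewer than [k] vertices, then [S] with either end of the edge added has
    exactly [k], and path systems from [A] to [x0 |: S] and from [y0 |: S] to [B] are glued along
    [S] and the deleted edge. *)
Theorem menger e A B k : (forall S, separates e A B S -> k <= #|S|) ->
  exists x p, @path_family e A B k x p.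
Proof.
have [n le_n] := ubnP #|[set z | e z.1 z.2]|.
elim: n e A B le_n => // n IH e A B le_n sepk.
have [/existsP [[x0 y0] /= e0]|/existsPn noe] := boolP [exists z, e z.1 z.2]; last first.
  have sAB : separates e A B (A :&: B).
    move=> x [|y p] /= xA; first by rewrite inE xA => _ ->.
    by case/andP=> exy; have /negP := noe (x, y).
  have := sepk _ sAB; rewrite cardE => le_k.
  have lk (i : 'I_k) : i < size (enum (A :&: B)) by apply: leq_trans le_k.
  exists (fun i => tnth (in_tuple (enum (A :&: B))) (Ordinal (lk i))), (fun=> [::]).
  have inAB (i : 'I_k) : tnth (in_tuple (enum (A :&: B))) (Ordinal (lk i)) \in A :&: B.
    by rewrite -mem_enum mem_tnth.
  split=> //= [i|i|i j z]; try by have := inAB i; rewrite inE => /andP [].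
  rewrite !inE => /eqP -> /eqP.
  by move/(elimT (tuple_uniqP (in_tuple _)) (enum_uniq _)) => [/val_inj].
pose e1 := [rel x y | e x y && ((x, y) != (x0, y0))].
have e1e : subrel e1 e by move=> x y /andP [].
have le_n1 : #|[set z | e1 z.1 z.2]| < n.
  apply: leq_trans (_ : #|[set z | e z.1 z.2]| <= _); last by lia.
  apply: proper_card; apply/properP; split.
    by apply/subsetP => z; rewrite !inE => /andP [].
  by exists (x0, y0); rewrite !inE /= ?eqxx ?andbF // e0.
have [[S [sS ltS]]|noS] := classic (exists S, separates e1 A B S /\ #|S| < k); last first.
  have [S sS|x [p [H1 H2 H3 H4 H5]]] := IH e1 A B le_n1.
    by rewrite leqNgt; apply/negP => lt; apply: noS; exists S.
  by exists x, p; split=> // i; apply: sub_path (H2 i).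
have path_e1 x p : path e x p -> (x0 \in belast x p -> False) -> path e1 x p.
  elim: p x => [|y p IHp] x //= /andP [exy pth]; rewrite inE => nx.
  rewrite exy IHp ?andbT //=; last by move=> h; apply: nx; rewrite h orbT.
  by apply/eqP => - [ex _]; apply: nx; rewrite ex eqxx.
have path_e1' x p : path e x p -> (y0 \in p -> False) -> path e1 x p.
  elim: p x => [|y p IHp] x //= /andP [exy pth]; rewrite inE => nx.
  rewrite exy IHp ?andbT //=; last by move=> h; apply: nx; rewrite h orbT.
  by apply/eqP => - [_ ey]; apply: nx; rewrite ey eqxx.
have sepx z : z = x0 \/ z = y0 -> separates e A B (z |: S).
  move=> zz x p xA pth lB; apply/negPn/negP => /hasPn nS.
  have {}zz : x0 \notin x :: p \/ y0 \notin x :: p.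
    case: zz => zz; [left|right]; apply/negP => /nS; rewrite /= !inE -zz eqxx //.
  have pth1 : path e1 x p.
    case: zz => nz; [apply: path_e1 pth _|apply: path_e1' pth _] => h; move: nz.
      by rewrite (mem_belast h).
    by rewrite inE h orbT.
  have /hasP [w wp wS] := sS _ _ xA pth1 lB.
  by case/negP: (nS _ wp); rewrite /= in_setU1 [w \in S]wS orbT.
have cS z : z = x0 \/ z = y0 -> z \notin S /\ #|z |: S| = k.
  move=> zz; have := sepk _ (sepx _ zz); rewrite cardsU1; case: (z \in S) => /=; lia.
have [x0S k1] := cS x0 (or_introl erefl); have [y0S k2] := cS y0 (or_intror erefl).
(* A path from [A] to [B] reaches [x0 |: S] before it can use the deleted edge, so whatever
   separates [A] from [x0 |: S] in [e1] separates [A] from [B] in [e]. *)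
have [S' sS'|x1 [p1 F1]] := IH e1 A (x0 |: S) le_n1.
  apply: sepk => x p xA pth lB.
  have [z zp zS] : exists2 z, z \in x :: p & z \in x0 |: S.
    exact/hasP/(sepx x0 (or_introl erefl)).
  have [p1 [p2 [eq lS nS]]] := first_in (sepx x0 (or_introl erefl) x p xA pth lB).
  move: pth; rewrite eq cat_path => /andP [pth _].
  have pth1 : path e1 x p1.
    by apply: path_e1 pth _ => /nS; rewrite !inE eqxx.
  have /hasP [w wp wS] := sS' _ _ xA pth1 lS.
  by apply/hasP; exists w => //; rewrite -cat_cons mem_cat wp.
have [S' sS'|x2 [p2 F2]] := IH e1 (y0 |: S) B le_n1.
  apply: sepk => x p xA pth lB.
  have [q1 [q2 [eq lS nS]]] := last_in (sepx y0 (or_intror erefl) x p xA pth lB).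
  move: pth lB; rewrite eq cat_path last_cat => /andP [_ pth] lB.
  have pth2 : path e1 (last x q1) q2.
    by apply: path_e1' pth _ => /nS; rewrite !inE eqxx.
  have /hasP [w wp wS] := sS' _ _ lS pth2 lB.
  apply/hasP; exists w => //; move: wp; rewrite inE => /predU1P [->|wp].
    by rewrite -cat_cons mem_cat mem_last.
  by rewrite -cat_cons mem_cat wp orbT.
have {x1 p1 F1} [x1 [p1 [[xA1 pt1 lS1 un1 dj1] _ _ nS1]]] := trim_family F1.
have {x2 p2 F2} [x2 [p2 [[xS2 pt2 lB2 un2 dj2] _ nS2 _]]] := trim_family F2.
have surj2 z : z \in y0 |: S -> exists j, x2 j = z.
  move=> zS; have inj : injective x2.
    by move=> i j ij; apply: (dj2 i j (x2 i)); rewrite ?mem_head // ij mem_head.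
  have : z \in [set x2 j | j in 'I_k].
    suff -> : [set x2 j | j in 'I_k] = y0 |: S by [].
    apply/eqP; rewrite eqEcard card_imset // card_ord k2 leqnn andbT.
    by apply/subsetP => w /imsetP [j _ ->].
  by case/imsetP => j _ ->; exists j.
(* Switching at [z] from the first path to the second gives a path of [e1] from [A] to [B], which
   must hit [S]; but the first path meets [S] only at its end and the second only at its start. *)
have meet12 i j z : z \in x1 i :: p1 i -> z \in x2 j :: p2 j ->
    [/\ z \in S, z = last (x1 i) (p1 i) & z = x2 j].
  move=> z1 z2.
  have lst w : w \in x1 i :: p1 i -> w \in S -> w = last (x1 i) (p1 i).
    move=> w1 wS; apply/eqP/negPn/negP => /(last_mem_belast w1) /nS1.
    by rewrite !inE wS orbT.
  have fst w : w \in x2 j :: p2 j -> w \in S -> w = x2 j.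
    move=> + wS; rewrite inE => /predU1P [//|/nS2]; by rewrite !inE wS orbT.
  suff wS : z \in S by split=> //; [exact: lst|exact: fst].
  have [q1 [q2 [eq lq]]] := mem_cut z1; have [r1 [r2 [er lr]]] := mem_cut z2.
  have pth : path e1 (x1 i) (q1 ++ r2).
    move: (pt1 i) (pt2 j); rewrite eq er !cat_path lq lr => /andP [-> _].
    by case/andP => _ ->.
  have lB : last (x1 i) (q1 ++ r2) \in B.
    by have := lB2 j; rewrite er !last_cat lq lr.
  have /hasP [w wp wS] := sS _ _ (xA1 i) pth lB.
  suff -> : z = w by [].
  move: wp; rewrite -cat_cons mem_cat => /orP [wq|wr].
    have := lst w; rewrite eq -cat_cons mem_cat wq => /(_ isT wS).
    rewrite last_cat lq; have := un1 i; rewrite eq -cat_cons cat_uniq.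
    case: (q2) => [|y q2'] // /and3P [_ h _] ew; case/hasP: h; exists w => //.
    by rewrite ew /= mem_last.
  have wr' : w \in p2 j by rewrite er mem_cat wr orbT.
  have := fst w; rewrite inE wr' orbT => /(_ isT wS) ew.
  by have := un2 j; rewrite /= -ew wr'.
(* The path that ends in [x0] crosses the deleted edge to [y0]; every other one continues at its own
   end. *)
have nxt i : exists j, x2 j = if last (x1 i) (p1 i) == x0 then y0 else last (x1 i) (p1 i).
  apply: surj2; case: eqP => [_|/eqP h]; first by rewrite !inE eqxx.
  by have := lS1 i; rewrite !inE (negPf h) /= => ->; rewrite orbT.
have {nxt} /fin_all_exists [nx nxP] := nxt.
have x1S i j : i != j -> last (x1 i) (p1 i) != last (x1 j) (p1 j).
  move=> ij; apply: contra_neq ij => ij; apply: (dj1 i j (last (x1 i) (p1 i))).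
    exact: mem_last.
  by rewrite ij mem_last.
have nxI : injective nx.
  move=> i j ij; apply/eqP/negPn/negP => /x1S; have := nxP i; rewrite ij nxP.
  have := lS1 i; have := lS1 j; rewrite !inE.
  case: eqP => [->|_] /=; case: eqP => [->|_] /=; rewrite ?eqxx //.
  - by move=> _ yS ey; rewrite -ey (negPf y0S) in yS.
  - by move=> yS _ ey; rewrite ey (negPf y0S) in yS.
  - by move=> _ _ ->; rewrite eqxx.
pose r i := if last (x1 i) (p1 i) == x0 then y0 :: p2 (nx i) else p2 (nx i).
exists x1, (fun i => p1 i ++ r i).
have rP i : [/\ path e (last (x1 i) (p1 i)) (r i), last (last (x1 i) (p1 i)) (r i) \in B,
    {subset r i <= x2 (nx i) :: p2 (nx i)}, uniq (r i) &
    forall z, z \in r i -> z \in S -> z <> last (x1 i) (p1 i)].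
  have := pt2 (nx i); have := lB2 (nx i); have := un2 (nx i); have := nxP i.
  rewrite /r; case: eqP => [ex|/eqP nex] -> un lB pt.
    rewrite ex /= lB e0 (sub_path e1e pt); split=> // z zr zS ezx.
    by rewrite ezx (negPf x0S) in zS.
  split=> // [|z zr||z zr zS ez].
  - exact: sub_path e1e _ _ pt.
  - by rewrite inE zr orbT.
  - by case/andP: un.
  - by case/andP: un; rewrite -ez zr.
have cross i j z : z \in x1 i :: p1 i -> z \in r j -> i = j /\ False.
  move=> zi zj; have [_ _ rs _ rl] := rP j.
  have [zS z1 z2] := meet12 _ _ _ zi (rs _ zj).
  suff ij : i = j by split=> //; apply: (rl z) => //; rewrite -ij.
  apply/eqP/negPn/negP => /x1S; rewrite -z1 z2 nxP.
  case: (last (x1 j) (p1 j) =P x0) => [h|]; last by rewrite eqxx.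
  by have := zS; rewrite z2 nxP h eqxx (negPf y0S).
split=> [i|i|i|i|i j z].
- by [].
- by rewrite cat_path (sub_path e1e (pt1 i)); case: (rP i).
- by rewrite last_cat; case: (rP i).
- rewrite -cat_cons cat_uniq un1; case: (rP i) => _ _ _ -> _; rewrite andbT.
  by apply/hasPn => z zr; apply/negP => zp; case: (cross i i z zp zr).
- rewrite -!cat_cons !mem_cat => /orP [zi|zi] /orP [zj|zj].
  + exact: dj1 zi zj.
  + by case: (cross i j z zi zj).
  + by case: (cross j i z zj zi).
  + apply: nxI; case: (rP i) (rP j) => _ _ si _ _ [_ _ sj _ _].
    exact: dj2 (si _ zi) (sj _ zj).
Qed.
End Menger.

Lemma ex_min (A : Type) (P : A -> Prop) (f : A -> nat) : (exists x, P x) ->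
  exists x, P x /\ forall y, P y -> f x <= f y.
Proof.
case=> x; have [n le_n] := ubnP (f x); elim: n x le_n => // n IH x le_n Px.
have [[y [Py lt]]|no] := classic (exists y, P y /\ f y < f x); first by apply: (IH y) => //; lia.
exists x; split=> // y Py; rewrite leqNgt; apply/negP => lt; apply: no; by exists y.
Qed.

Lemma ex_max (A : Type) (P : A -> Prop) (f : A -> nat) b : (exists x, P x) ->
  (forall x, P x -> f x <= b) -> exists x, P x /\ forall y, P y -> f y <= f x.
Proof.
move=> ex lb; have [x [Px mx]] := ex_min (fun x => b - f x) ex.
by exists x; split=> // y Py; have := mx y Py; have := lb x Px; have := lb y Py; lia.
Qed.

(** * Linked sets, fans, and their composition *)

Section Linkage.
Variable T : finType.
Implicit Types (e : rel T) (C V W X Y N S U : {set T}).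

(* The two ends of a pair may coincide. *)
Definition linked e V X := forall (J : finType) (s t : J -> T),
  (forall i, s i \in X) -> (forall i, t i \in X) ->
  (forall i j, i != j -> [disjoint [set s i; t i] & [set s j; t j]]) ->
  exists C : J -> {set T}, [/\ forall i, C i \subset V,
    forall i j, i != j -> [disjoint C i & C j],
    forall i, jn e (C i) (s i) (t i) &
    forall i, C i :&: X \subset [set s i; t i]].

Lemma linked_sub e V X V' X' :
  V \subset V' -> X' \subset X -> linked e V X -> linked e V' X'.
Proof.
move=> sV sX lk J s t sX' tX' dj.
have [i|i|C [h1 h2 h3 h4]] := lk J s t _ _ dj; try exact: (subsetP sX).
exists C; split=> // i; first exact: subset_trans (h1 i) sV.
by apply: subset_trans (h4 i); apply: setIS.
Qed.

Definition fan e V X Y (q : T -> T) (Q : T -> {set T}) :=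
  (forall x, x \in X -> [/\ q x \in Y, jn e (Q x) x (q x), Q x \subset V & Q x :&: Y \subset [set q x]])
  /\ {in X &, forall x x', x != x' -> [disjoint Q x & Q x']}.

Lemma jn_l e C x y : jn e C x y -> x \in C. Proof. by case/and3P. Qed.
Lemma jn_r e C x y : jn e C x y -> y \in C. Proof. by case/and3P. Qed.

Lemma disj_eq (A B : {set T}) z : [disjoint A & B] -> z \in A -> z \in B -> False.
Proof. by move=> /disjointFr h /h ->. Qed.

Lemma disjointI (A B : {set T}) : (forall z, z \in A -> z \in B -> False) -> [disjoint A & B].
Proof.
by move=> h; rewrite -setI_eq0; apply/eqP/setP => z; rewrite !inE; apply/negP => /andP [/h].
Qed.

(** Every root travels along its fan set to its image, and the images are linked inside [U]. Nothing
    collides: [Q x] enters [U] only at [q x], and a link in [U] meets [S] only in its own two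
    ends. *)
Lemma compose_linked e V X S U q Q : symmetric e -> U \subset V ->
  linked e U S -> fan e V X S q Q -> S \subset U ->
  (forall x, x \in X -> Q x :&: U \subset [set q x]) -> linked e V X.
Proof.
move=> se sU lk [fX dj] sSU QU J s t sX tX djst.
have qS x : x \in X -> q x \in S by case/fX.
have jq x : x \in X -> jn e (Q x) x (q x) by case/fX.
have same x y z : x \in X -> y \in X -> z \in Q x -> z \in Q y -> x = y.
  move=> xX yX zx zy; apply/eqP/negPn/negP => /(dj x y xX yX) d; exact: disj_eq d zx zy.
have qI x y : x \in X -> y \in X -> q x = q y -> x = y.
  move=> xX yX xy; apply: (same x y (q x)) => //; first exact: jn_r (jq x xX).
  rewrite xy; exact: jn_r (jq y yX).
have QUE x z : x \in X -> z \in Q x -> z \in U -> z = q x.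
  by move=> xX zx zU; apply/set1P/(subsetP (QU x xX)); rewrite inE zx.
have [i|i|i j ij|C [h1 h2 h3 h4]] := lk J (q \o s) (q \o t).
- exact: qS.
- exact: qS.
- apply: disjointI => z; rewrite !inE /= => zi zj.
  have [x xi xz] : exists2 x, x \in [set s i; t i] & z = q x.
    by case/orP: zi => /eqP ->; [exists (s i)|exists (t i)]; rewrite ?inE ?eqxx ?orbT.
  have [y yj yz] : exists2 y, y \in [set s j; t j] & z = q y.
    by case/orP: zj => /eqP ->; [exists (s j)|exists (t j)]; rewrite ?inE ?eqxx ?orbT.
  apply: (disj_eq (djst _ _ ij) xi); suff -> : x = y by [].
  apply: qI; [| |by rewrite -xz].
    by case/set2P: xi => ->.
  by case/set2P: yj => ->.
have CQ i x z : x \in X -> z \in C i -> z \in Q x -> x = s i \/ x = t i.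
  move=> xX zC zQ; have zx := QUE x z xX zQ (subsetP (h1 i) _ zC).
  have := subsetP (h4 i) z; rewrite !inE zC {1}zx qS //= => /(_ isT) /orP [] /eqP.
    by rewrite zx => /qI ->; auto.
  by rewrite zx => /qI ->; auto.
exists (fun i => Q (s i) :|: Q (t i) :|: C i); split.
- move=> i; rewrite !subUset (subset_trans (h1 i) sU) andbT.
  by case: (fX _ (sX i)) (fX _ (tX i)) => _ _ -> _ [_ _ -> _].
- move=> i j ij; apply: disjointI => z.
  have st x y : (x = s i \/ x = t i) -> (y = s j \/ y = t j) -> x <> y.
    move=> hx hy xy; apply: (disj_eq (djst _ _ ij) (z := x)); rewrite !inE.
      by case: hx => ->; rewrite eqxx ?orbT.
    by rewrite xy; case: hy => ->; rewrite eqxx ?orbT.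
  have hQ x y : (x = s i \/ x = t i) -> (y = s j \/ y = t j) -> z \in Q x -> z \in Q y -> False.
    move=> hx hy zx zy; apply: (st _ _ hx hy); apply: same zx zy; by [case: hx => -> | case: hy => ->].
  have hC1 x : (x = s i \/ x = t i) -> z \in Q x -> z \in C j -> False.
    move=> hx zx zC; apply: (st x x) => //; apply: CQ zC zx; by case: hx => ->.
  have hC2 x : (x = s j \/ x = t j) -> z \in Q x -> z \in C i -> False.
    move=> hx zx zC; apply: (st x x) => //; apply: CQ zC zx; by case: hx => ->.
  rewrite !inE -!orbA => /or3P [] a /or3P [] b; move: a b; try exact: (disj_eq (h2 _ _ ij));
   try (by apply: hQ; auto); try (by apply: hC1; auto); try (move=> a b; move: b a; by apply: hC2; auto).
- move=> i; apply: jn_trans (jn_sub _ (jq _ (sX i))) _; first by rewrite -setUA subsetUl.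
  apply: jn_trans (jn_sub _ (h3 i)) _; first exact: subsetUr.
  apply: jn_sym => //; apply: jn_sub (jq _ (tX i)).
  by rewrite -setUA setUCA subsetUl.
- move=> i; apply/subsetP => x; rewrite !inE => /andP [+ xX].
  have xQ : x \in Q x by apply: jn_l (jq _ xX).
  rewrite -orbA => /or3P [] h.
  + by rewrite (same _ _ _ xX (sX i) xQ h) eqxx.
  + by rewrite (same _ _ _ xX (tX i) xQ h) eqxx orbT.
  + by case: (CQ i x x xX h xQ) => ->; rewrite eqxx ?orbT.
Qed.

Definition side e V N Y := [set v in V :\: N | [exists y in Y :\: N, connect (rin e (V :\: N)) y v]].


Lemma path_setP e V x p : path (rin e V) x p -> x \in V ->
  path e x p /\ {subset x :: p <= V}.
Proof.
elim: p x => [|y p IH] x /=; first by move=> _ xV; split=> // z; rewrite inE => /eqP ->.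
case/andP=> /and3P [xy xV yV] /IH /(_ yV) [pt sV] _; split; first by rewrite xy.
by move=> z; rewrite inE => /predU1P [->|/sV].
Qed.

Lemma path_rin e V x p : path e x p -> {subset x :: p <= V} -> path (rin e V) x p.
Proof.
elim: p x => [|y p IH] x //= /andP [xy pt] sV.
have sV' : {subset y :: p <= V} by move=> z zp; apply: sV; rewrite inE zp orbT.
by rewrite /rin /= xy sV ?mem_head // sV' ?mem_head //= IH.
Qed.

Definition setp (x : T) p := [set z in x :: p].

Lemma jn_setp e x p : path e x p -> jn e (setp x p) x (last x p).
Proof. by move=> pt; apply: path_jn => // z; rewrite [z \in setp _ _]inE. Qed.

(* A family of |X| paths starting in X is indexed by its starting vertices. *)
Lemma family_fan e V X Y x p : X \subset V ->
  @path_family T (rin e V) X Y #|X| x p ->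
  (forall i z, z \in belast (x i) (p i) -> z \notin Y) ->
  exists q Q, fan e V X Y q Q.
Proof.
move=> XV [xX pt lY un dj] nY.
have [pt' sV] : (forall i, path e (x i) (p i)) /\ (forall i, {subset x i :: p i <= V}).
  by split=> i; case: (path_setP (pt i) (subsetP XV _ (xX i))).
have xI : injective x by move=> i j ij; apply: (dj i j (x i)); rewrite ?mem_head // ij mem_head.
have sur a : a \in X -> exists i, x i = a.
  move=> aX; have : a \in [set x i | i in 'I_#|X|].
    suff -> : [set x i | i in 'I_#|X|] = X by [].
    apply/eqP; rewrite eqEcard card_imset // card_ord leqnn andbT.
    by apply/subsetP => w /imsetP [j _ ->].
  by case/imsetP => i _ ->; exists i.
have /fin_all_exists [f fP] a : exists f : T * {set T}, a \in X -> exists i,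
    [/\ x i = a, f.1 = last (x i) (p i) & f.2 = setp (x i) (p i)].
  have [/sur [i ia]|aX] := boolP (a \in X); last by exists (a, set0).
  by exists (last (x i) (p i), setp (x i) (p i)) => _; exists i.
exists (fun a => (f a).1), (fun a => (f a).2); split.
  move=> a /fP [i [<- -> ->]]; split=> //.
  - exact: jn_setp.
  - by apply/subsetP => z; rewrite inE => /sV.
  apply/subsetP => z; rewrite !inE => /andP [zp zY].
  by apply/negPn/negP => /(last_mem_belast zp) /nY; rewrite zY.
move=> a b /fP [i [<- _ ->]] /fP [j [<- _ ->]] ij; apply: disjointI => z.
by rewrite !inE => zi zj; rewrite (dj i j z) ?eqxx in ij.
Qed.

(** In the second case [N] is a smallest separator. Menger then yields [#|N|] disjoint paths, each
    of which passes through [N]; their tails from the last vertex in [N] stay on the side of [Y] and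
    form the fan. *)
Lemma menger_fan e V X Y : symmetric e -> X \subset V -> Y \subset V ->
  (exists q Q, fan e V X Y q Q) \/
  exists N q Q, [/\ N \subset V, #|N| < #|X|, X :&: side e V N Y = set0 &
    fan e (side e V N Y :|: N) N Y q Q].
Proof.
move=> se XV YV; pose S_ok S := separates (rin e V) X Y S.
have [ok|nok] := classic (forall S, S_ok S -> #|X| <= #|S|).
  have [x0 [p0 F0]] := menger ok; have [x [p [F _ _ nY]]] := trim_family F0.
  left; exact: family_fan F nY.
right.
have sepI S : S_ok S -> S_ok (S :&: V).
  move=> sS y p yX pt lY; have /hasP [z zp zS] := sS y p yX pt lY.
  have [_ sV] := path_setP pt (subsetP XV _ yX).
  by apply/hasP; exists z => //; apply/setIP; split; [exact: zS|exact: sV].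
have [|N0 [sN0 minN0]] := @ex_min _ S_ok (fun S => #|S|).
  by apply: NNPP => no; apply: nok => S sS; case: no; exists S.
have [N [NV sepN minN ltN]] : exists N, [/\ N \subset V, S_ok N,
    forall S, S_ok S -> #|N| <= #|S| & #|N| < #|X|].
  have le : #|N0 :&: V| <= #|N0| by rewrite subset_leq_card // subsetIl.
  exists (N0 :&: V); split; [exact: subsetIr|exact: sepI| |].
    by move=> S /minN0; apply: leq_trans.
  rewrite ltnNge; apply/negP => h; apply: nok => S /minN0 h'; lia.
exists N.
have [x0 [p0 [xX pt lY un dj]]] := menger minN.
have [pt' sV] : (forall i, path e (x0 i) (p0 i)) /\ (forall i, {subset x0 i :: p0 i <= V}).
  by split=> i; case: (path_setP (pt i) (subsetP XV _ (xX i))).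
have H i : exists xp : T * seq T, [/\ xp.1 \in N, path (rin e V) xp.1 xp.2, last xp.1 xp.2 \in Y,
    uniq (xp.1 :: xp.2) & {subset xp.1 :: xp.2 <= x0 i :: p0 i}].
  have [p1 [p2 [eq lN nN]]] := last_in (sepN _ _ (xX i) (pt i) (lY i)).
  exists (last (x0 i) p1, p2); move: (pt i) (lY i) (un i).
  rewrite eq cat_path last_cat -cat_cons (lastI (x0 i) p1) -cats1 -catA cat_uniq.
  move=> /andP [_ pp] lp /and3P [_ _ up]; split=> //.
  by move=> z zz; rewrite mem_cat zz orbT.
have {H} /fin_all_exists [xp H] := H.
have F1 : @path_family T (rin e V) N Y #|N| (fun i => (xp i).1) (fun i => (xp i).2).
  split=> [i|i|i|i|i j z zi zj]; try by case: (H i).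
  by apply: (dj i j z); [case: (H i) => _ _ _ _; apply|case: (H j) => _ _ _ _; apply].
have [x [p [[xN ptp lp up djp] _ nN nY]]] := trim_family F1.
have {}ptp i : path e (x i) (p i) /\ {subset x i :: p i <= V}.
  by have := path_setP (ptp i) (subsetP NV _ (xN i)).
have [|q [Q F]] := @family_fan e (side e V N Y :|: N) N Y x p (subsetUr _ _) _ nY.
  split=> // i; have [pe pV] := ptp i; apply: path_rin => // z.
  rewrite inE => /predU1P [->|zp]; first by rewrite inE xN orbT.
  have zN := nN _ _ zp; have zV : z \in V by apply: pV; rewrite inE zp orbT.
  rewrite inE; apply/orP; left; rewrite inE inE zN zV /=.
  apply/existsP; exists (last (x i) (p i)).
  have zxp : z \in x i :: p i by rewrite inE zp orbT.
  have [p1 [p2 [eq lz]]] := mem_cut zxp.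
  have sp : {subset z :: p2 <= V :\: N}.
    move=> w wp; have wpi : w \in p i.
      move: wp; rewrite inE => /predU1P [-> //|wp]; by rewrite eq mem_cat wp orbT.
    by rewrite inE (nN _ _ wpi) pV // inE wpi orbT.
  have j : jn e (V :\: N) z (last z p2).
    by apply: path_jn sp; move: pe; rewrite eq cat_path lz => /andP [].
  have ll : last (x i) (p i) = last z p2 by rewrite eq last_cat lz.
  by have := jn_sym se j; rewrite inE lp ll; case/and3P; rewrite inE => /andP [-> _] _ ->.
exists q, Q; split=> //; apply/setP => a; rewrite !inE; apply/negP.
case/and3P => aX /andP [aN aV] /existsP [y /andP []]; rewrite inE => /andP [yN yY] c.
have : jn e (V :\: N) y a by rewrite /jn !inE aN yN c aV (subsetP YV).
move/(jn_sym se)/jn_path => [r [pr lr _ rV]].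
have pr' : path (rin e V) a r.
  by apply: path_rin => // z /rV; rewrite inE => /andP [].
have lr' : last a r \in Y by rewrite lr.
by have /hasP [z /rV] := sepN _ _ aX pr' lr'; rewrite inE => /andP [/negP].
Qed.

End Linkage.

(** * Linkages under an Ore-type degree condition *)

Lemma cardU_le (T : finType) (A B : {set T}) : #|A :|: B| <= #|A| + #|B|.
Proof. by rewrite -cardsUI leq_addr. Qed.

Section Assembly.
Variables (T : finType) (e : rel T).

Definition nbh (A : {set T}) v := [set w in A | e v w].

Lemma assemble (V L : {set T}) (J : finType) (s t : J -> T) (D : J -> {set T}) :
  (forall i, s i \in L) -> (forall i, t i \in L) -> L \subset V ->
  (forall i j, i != j -> [disjoint [set s i; t i] & [set s j; t j]]) ->
  (forall i, D i \subset V :\: L) -> (forall i j, i != j -> [disjoint D i & D j]) ->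
  (forall i, jn e (D i :|: [set s i; t i]) (s i) (t i)) ->
  exists C : J -> {set T}, [/\ forall i, C i \subset V,
    forall i j, i != j -> [disjoint C i & C j],
    forall i, jn e (C i) (s i) (t i) &
    forall i, C i :&: L \subset [set s i; t i]].
Proof.
move=> sL tL LV dst DV dD jD.
have stL i : [set s i; t i] \subset L by rewrite subUset !sub1set sL tL.
have DL i z : z \in D i -> z \in L -> False.
  by move=> /(subsetP (DV i)); rewrite inE => /andP [/negP].
exists (fun i => D i :|: [set s i; t i]); split=> // [i|i j ij|i].
- rewrite subUset (subset_trans (DV i) (subsetDl _ _)).
  exact: subset_trans (stL i) LV.
- apply: disjointI => z /setUP [zi|zi] /setUP [zj|zj].
  + exact: disj_eq (dD _ _ ij) zi zj.
  + by apply: DL zi _; apply: (subsetP (stL j)).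
  + by apply: DL zj _; apply: (subsetP (stL i)).
  + exact: disj_eq (dst _ _ ij) zi zj.
- by apply/subsetP => z /setIP [/setUP [zi|//] /(DL _ _ zi)].
Qed.

(** The sets are chosen one index at a time; [Z] is the union of the earlier choices, of which there
    are at most [#|U|.-1]. *)
Lemma greedy (J : finType) (U : {set J}) (F : {set T}) (P : J -> {set T} -> Prop) b :
  (forall i (Z : {set T}), i \in U -> #|Z| <= b * #|U|.-1 -> exists C : {set T},
     [/\ C \subset F :\: Z, #|C| <= b & P i C]) ->
  exists C : J -> {set T}, [/\ forall i, C i \subset F,
    forall i j, i != j -> [disjoint C i & C j],
    forall i, i \in U -> P i (C i) & forall i, i \notin U -> C i = set0].
Proof.
move=> step.
have main n : n <= #|U| -> exists (C : J -> {set T}) (W : {set J}) (Z : {set T}),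
   [/\ W \subset U, #|W| = n, #|Z| <= b * n,
   forall i, C i \subset F :&: Z &
   [/\ forall i j, i != j -> [disjoint C i & C j],
   forall i, i \in W -> P i (C i) & forall i, i \notin W -> C i = set0]].
  elim: n => [_|n IH lt_n].
    exists (fun=> set0), set0, set0; rewrite !cards0 sub0set; split=> // [i|].
      by rewrite sub0set.
    by split=> // [i j ij|i]; rewrite ?inE // disjoints_subset sub0set.
  have [C [W [Z [WU cW cZ CF [dC PC C0]]]]] := IH (ltnW lt_n).
  have [i iU iW] : exists2 i, i \in U & i \notin W.
    apply/subsetPn; apply/negP => /subset_leq_card; nlia.
  have [|C' [sC' cC' PC']] := step i Z iU; first by apply: leq_trans cZ _; rewrite leq_mul2l; nlia.
  exists (fun j => if j == i then C' else C j), (i |: W), (Z :|: C'); split.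
  - by rewrite subUset sub1set iU.
  - by rewrite cardsU1 iW cW.
  - by rewrite mulnS; apply: leq_trans (cardU_le _ _) _; rewrite addnC leq_add.
  - move=> j; case: eqP => _; apply/subsetP => z zC; rewrite !inE.
      by have := subsetP sC' _ zC; rewrite zC inE => /andP [_ ->]; rewrite orbT.
    by have := subsetP (CF j) _ zC; rewrite inE => /andP [-> ->].
  have dCC' j : [disjoint C j & C'].
    apply: disjointI => z /(subsetP (CF j)); rewrite inE => /andP [_ zZ].
    by move/(subsetP sC'); rewrite inE zZ.
  split=> [j k jk|j|j].
  - case: eqP => [ej|_]; case: eqP => [ek|_]; [|by rewrite disjoint_sym|by []|exact: dC].
    by rewrite ej ek eqxx in jk.
  - by rewrite in_setU1; case: eqP => [-> //|_] /=; apply: PC.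
  - by rewrite in_setU1; case: eqP => //= _; apply: C0.
have [C [W [Z [WU cW _ CF [dC PC C0]]]]] := main _ (leqnn _).
have WE : W = U by apply/eqP; rewrite eqEcard WU cW leqnn.
rewrite WE in PC C0; exists C; split=> // i; exact: subset_trans (CF i) (subsetIl _ _).
Qed.
End Assembly.

Lemma card_out2 (T : finType) (D B : {set T}) x y : x != y -> x \in B -> y \in B ->
  (forall z, z \in D -> [&& z \in B, z != x & z != y]) -> #|D| + 2 <= #|B|.
Proof.
move=> ne xB yB DB; have <- : #|D :|: [set x; y]| = #|D| + 2.
  rewrite cardsU disjoint_setI0 ?cards0 ?cards2 ?ne ?subn0 //.
  by apply: disjointI => z /DB /and3P [_ h1 h2]; rewrite !inE (negPf h1) (negPf h2).
apply: subset_leq_card; rewrite !subUset !sub1set xB yB !andbT.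
by apply/subsetP => z /DB /and3P [].
Qed.

Section Ore.
Variables (T : finType) (e : rel T) (A : {set T}) (m c : nat).
Hypotheses (es : symmetric e) (ei : irreflexive e).
Hypotheses (Abig : 3 * m <= #|A|) (cbig : 11 * m <= 4 * c).
Hypothesis ore : {in A &, forall p q, p != q -> #|A| + c <= #|nbh e A p| + #|nbh e A q| + 2}.
Variables (L : {set T}) (J : finType) (s t : J -> T).
Hypotheses (LA : L \subset A) (Lsmall : #|L| <= 2 * m).
Hypotheses (sL : forall i, s i \in L) (tL : forall i, t i \in L).
Hypothesis dst : forall i j, i != j -> [disjoint [set s i; t i] & [set s j; t j]].

Let bad := [set i | (s i != t i) && ~~ e (s i) (t i)].
Let CN i := [set w in A :\: L | e (s i) w && e (t i) w].
(** Distinct representatives for the sets [CN i]: a pair in [M] is linked through the single inner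
    vertex [y i]. *)
Definition connectors (M : {set J}) (y : J -> T) :=
  [/\ M \subset bad, {in M, forall i, y i \in CN i} & {in M &, injective y}].

Lemma pair_inj (g : J -> T) : (forall i, g i \in [set s i; t i]) -> injective g.
Proof.
move=> gst i j ij; apply/eqP/negPn/negP => /dst d.
by apply: disj_eq d (gst i) _; rewrite ij.
Qed.

Lemma terminals_card (M : {set J}) : M \subset bad -> 2 * #|M| <= #|L|.
Proof.
move=> Mb.
have sI : injective s by apply: pair_inj => i; rewrite !inE eqxx.
have tI : injective t by apply: pair_inj => i; rewrite !inE eqxx orbT.
have d : [disjoint s @: M & t @: M].
  apply: disjointI => z /imsetP [i iM ->] /imsetP [j jM st].
  have [ij|ij] := eqVneq i j.
    by have := subsetP Mb _ iM; rewrite inE st ij eqxx.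
  by apply: (disj_eq (dst ij) (z := s i)); rewrite !inE ?eqxx // st eqxx orbT.
have : #|s @: M :|: t @: M| <= #|L|.
  apply/subset_leq_card; rewrite subUset; apply/andP; split; apply/subsetP => z /imsetP [i _ ->] //.
by rewrite cardsU disjoint_setI0 // cards0 !card_imset //; nlia.
Qed.

Section Max.
Variables (M : {set J}) (y : J -> T).
Hypotheses (My : connectors M y).
Hypothesis maxM : forall M' y', connectors M' y' -> #|M'| <= #|M|.
Let Un := bad :\: M.
Let Fr := A :\: (L :|: y @: M).

Lemma unmatched_common i w : i \in Un -> w \in CN i -> w \in y @: M.
Proof.
rewrite inE => /andP [iM ib] wC; apply/negPn/negP => wy.
have [Mb yC yI] := My.
have : connectors (i |: M) (fun j => if j == i then w else y j).
  split; first by rewrite subUset sub1set ib.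
    by move=> j; rewrite in_setU1; case: eqP => [-> //|_ /=]; apply: yC.
  move=> j k; rewrite !in_setU1; case: eqP => [->|_]; case: eqP => [->|_] //= hj hk.
  - by move=> wk; case/negP: wy; rewrite wk; apply: imset_f.
  - by move=> wk; case/negP: wy; rewrite -wk; apply: imset_f.
  - exact: yI.
by move/maxM; rewrite cardsU1 iM; nlia.
Qed.

(* The connector of a pair in [R i] could be given to the unmatched pair [i], so
   neither pair has a free common neighbour: a free vertex misses an end of each. *)
Let R i := [set j in M | y j \in CN i].

Lemma R_common i j w : i \in Un -> j \in R i -> w \in CN j -> w \in y @: M.
Proof.
move=> iU; rewrite inE => /andP [jM yj] wC; apply/negPn/negP => wy.
have [Mb yC yI] := My; move: (iU); rewrite inE => /andP [iM ib].
have ij : i == j = false by apply: contraNF iM => /eqP ->.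
have wk k : k \in M -> w <> y k by move=> kM wk; case/negP: wy; rewrite wk; apply: imset_f.
have : connectors (i |: M) (fun k => if k == i then y j else if k == j then w else y k).
  split; first by rewrite subUset sub1set ib.
    move=> k; rewrite in_setU1; case: eqP => [-> //|_ /=].
    case: eqP => [-> //|_]; exact: yC.
  move=> k l; rewrite !in_setU1.
  have [->|ki] := eqVneq k i; have [->|li] := eqVneq l i; rewrite /= ?eqxx ?(eq_sym j) ?ij //= => hk hl.
  - have [-> /esym/(wk _ jM)|lj] // := eqVneq l j.
    by move/(yI _ _ jM hl) => jl; rewrite jl eqxx in lj.
  - have [-> /(wk _ jM)|kj] // := eqVneq k j.
    by move/(yI _ _ hk jM) => jl; rewrite jl eqxx in kj.
  - have [->|kj] := eqVneq k j; have [->|lj] := eqVneq l j; rewrite ?eqxx //.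
    + by move/(wk _ hl).
    + by move/esym/(wk _ hk).
    + exact: yI.
by move/maxM; rewrite cardsU1 iM; nlia.
Qed.

(** Neither neighbourhood contains [s i] or [t i], so their union has at most |A| - 2 vertices and
    the Ore bound leaves [c] common ones. At most |L| - 2 of these lie in [L]. *)
Lemma card_CN i : i \in bad -> c + 2 <= #|CN i| + #|L|.
Proof.
rewrite inE => /andP [ne nad]; have sA := subsetP LA _ (sL i); have tA := subsetP LA _ (tL i).
have := ore sA tA ne; rewrite -cardsUI.
have : #|nbh e A (s i) :|: nbh e A (t i)| + 2 <= #|A|.
  apply: (card_out2 ne sA tA) => z; rewrite !inE => /orP [] /andP [-> h] /=;
  by apply/andP; split; apply: contraTneq h => ->; rewrite ?ei // es.
have : #|nbh e A (s i) :&: nbh e A (t i)| + 2 <= #|CN i| + #|L|.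
  have : #|(nbh e A (s i) :&: nbh e A (t i)) :\: CN i| + 2 <= #|L|.
    apply: (card_out2 ne (sL i) (tL i)) => z; rewrite !inE => /and3P [+ /andP [zA h1] /andP [_ h2]].
    rewrite zA h1 h2 !andbT negbK => -> /=.
    by apply/andP; split; [apply: contraTneq h1|apply: contraTneq h2] => ->; rewrite ei.
  rewrite -(cardsID (CN i) (nbh e A (s i) :&: nbh e A (t i))).
  have := subset_leq_card (subsetIr (nbh e A (s i) :&: nbh e A (t i)) (CN i)); nlia.
nlia.
Qed.

(** By maximality each common neighbour of an unmatched pair already serves as a connector. *)
Lemma card_R i : i \in Un -> #|CN i| <= #|R i|.
Proof.
move=> iU; apply: leq_trans (leq_imset_card y (R i)).
apply/subset_leq_card/subsetP => w wC; have /imsetP [j jM wj] := unmatched_common iU wC.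
by apply/imsetP; exists j => //; rewrite inE jM -wj.
Qed.

Lemma free_misses i f : i \in Un -> f \in Fr ->
  exists G : {set T}, [/\ G \subset L, #|G| = #|R i|.+1 & {in G, forall g, ~~ e f g}].
Proof.
move=> iU; rewrite !inE negb_or -andbA => /and3P [fL fy fA].
have iM : i \notin M by move: iU; rewrite inE => /andP [].
pose g j := if e (s j) f then t j else s j.
exists (g @: (i |: R i)); split.
- by apply/subsetP => z /imsetP [j _ ->]; rewrite /g; case: ifP.
- rewrite card_imset; first by rewrite cardsU1 inE (negPf iM).
  by apply: pair_inj => j; rewrite /g !inE; case: ifP; rewrite eqxx ?orbT.
move=> z /imsetP [j jR ->]; rewrite es /g; case: ifP => [sj|->] //.
apply/negP => tj; case/negP: fy.
have fC : f \in CN j by rewrite !inE fL fA sj tj.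
by move: jR; rewrite in_setU1 => /predU1P [ji|jR]; [apply: (unmatched_common iU); rewrite -ji|apply: (R_common iU jR)].
Qed.

Lemma card_bounds : #|M| + #|Un| <= m /\ #|y @: M| = #|M|.
Proof.
have [Mb _ yI] := My; rewrite card_in_imset //; split=> //.
have := terminals_card (subxx bad); rewrite -(cardsID M bad) (setIidPr Mb) /Un; nlia.
Qed.

(** The link runs [s i], [q], [a], [q'], [t i], with at most three inner vertices. The decisive
    inequality is c + 2 - 2m <= |R i| <= |M|: an unmatched pair forces many matched ones, and every
    free vertex then misses many roots. *)
Lemma link_unmatched i (Z : {set T}) : i \in Un -> #|Z| <= 3 * #|Un|.-1 ->
  exists C : {set T}, [/\ C \subset Fr :\: Z, #|C| <= 3 & jn e (C :|: [set s i; t i]) (s i) (t i)].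
Proof.
move=> iU cZ; have [cM cy] := card_bounds.
have ib : i \in bad by move: (iU); rewrite inE => /andP [].
have Upos : 0 < #|Un| by apply/card_gt0P; exists i.
have cC := card_CN ib; have cR := card_R iU.
have RM : #|R i| <= #|M| by apply: subset_leq_card; apply/subsetP => j; rewrite inE => /andP [].
have cFr : #|A| <= #|Fr| + #|L| + #|M|.
  rewrite -cy -addnA -(cardsID (L :|: y @: M) A) addnC leq_add2l.
  apply: leq_trans (cardU_le _ _); exact/subset_leq_card/subsetIr.
have FA f : f \in Fr -> f \in A by rewrite inE => /andP [].
have FL f : f \in Fr -> f \notin L by rewrite !inE negb_or -andbA => /and3P [].
have degF f : f \in Fr -> #|nbh e A f| + #|R i| + 2 <= #|A|.
  move=> fF; have [G [GL cG nG]] := free_misses iU fF.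
  have : #|f |: G| = #|R i| + 2.
    by rewrite cardsU1 cG (contra (subsetP GL f)) ?FL //; nlia.
  have : #|nbh e A f :|: (f |: G)| <= #|A|.
    apply: subset_leq_card; rewrite !subUset sub1set FA // (subset_trans GL LA) !andbT.
    by apply/subsetP => z; rewrite inE => /andP [].
  rewrite cardsU disjoint_setI0 ?cards0; first nlia.
  apply: disjointI => z; rewrite !inE => /andP [_ h] /predU1P [zf|/nG]; last by rewrite h.
  by rewrite zf ei in h.
have [f fF] : exists f, f \in Fr by apply/card_gt0P; nlia.
(* Otherwise [x] has degree at most |L| + |M| + |Z| - 2, while a free [g] misses at least |R i| + 1
   vertices besides itself. The Ore bound for [x] and [g] would give 4c + 11 <= 11m. *)
have Fnb x y' : x \in L -> y' \in L -> x != y' -> ~~ e x y' -> exists2 z, z \in Fr :\: Z & e x z.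
  move=> xL yL ne nad; apply: NNPP => no.
  have xA := subsetP LA _ xL.
  have nF z : z \in Fr :\: Z -> ~~ e x z by move=> zF; apply/negP => h; apply: no; exists z.
  have dx2 : #|nbh e A x| + 2 <= #|A|.
    apply: (card_out2 ne xA (subsetP LA _ yL)) => z; rewrite !inE => /andP [-> h] /=.
    by apply/andP; split; apply: contraTneq h => ->; rewrite ?ei.
  have [g gF] : exists g, g \in Fr :\: Z.
    apply/card_gt0P; rewrite cardsD; have := subset_leq_card (subsetIr Fr Z).
    have xf : x != f by apply: contraNneq (FL _ fF) => <-.
    have := ore xA (FA _ fF) xf; have := degF _ fF; nlia.
  have gF' : g \in Fr by move: gF; rewrite inE => /andP [].
  have xg : x != g by apply: contraNneq (FL _ gF') => <-.
  have := ore xA (FA _ gF') xg; have := degF _ gF'.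
  have : #|nbh e A x| + 2 <= #|L| + #|M| + #|Z|.
    have : #|nbh e A x :\: (y @: M :|: Z)| + 2 <= #|L|.
      apply: (card_out2 ne xL yL) => z; rewrite in_setD => /andP [nz]; rewrite inE => /andP [zA h].
      have := contraL (nF z) h; move: nz; rewrite !inE zA.
      case: (z \in Z); case: (z \in L); case: (z \in y @: M) => //= _ _.
      by apply/andP; split; apply: contraTneq h => ->; rewrite ?ei.
    rewrite -cy -(cardsID (y @: M :|: Z) (nbh e A x)).
    have := subset_leq_card (subsetIr (nbh e A x) (y @: M :|: Z)).
    move: (cardU_le (y @: M) Z); nlia.
  nlia.
move: (ib); rewrite inE => /andP [ne nad].
have [q qF sq] := Fnb _ _ (sL i) (tL i) ne nad.
have [q' qF' tq'] : exists2 z, z \in Fr :\: Z & e (t i) z.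
  by apply: Fnb (tL i) (sL i) _ _; rewrite 1?eq_sym // es.
have jP a : a \in Fr :\: Z -> (e q a \/ a = q) -> (e a q' \/ a = q') -> jn e ([set q; a; q'] :|: [set s i; t i]) (s i) (t i).
  move=> aF qa aq'; set C := _ :|: _.
  have [qC aC qC' sC tC] : [/\ q \in C, a \in C, q' \in C, s i \in C & t i \in C].
    by rewrite /C !inE !eqxx !orbT.
  apply: (@jn_trans _ _ _ q); first exact: jn_edge.
  apply: (@jn_trans _ _ _ a); first by case: qa => [h|<-]; [apply: jn_edge|apply: jn_refl].
  apply: (@jn_trans _ _ _ q'); first by case: aq' => [h|<-]; [apply: jn_edge|apply: jn_refl].
  by apply: jn_edge; rewrite // es.
suff [a [aF qa aq]] : exists a, [/\ a \in Fr :\: Z, e q a \/ a = q & e a q' \/ a = q'].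
  exists [set q; a; q']; split; last exact: jP.
    by rewrite !subUset !sub1set qF aF qF'.
  by rewrite -setUA cardsU1 cards2; case: (_ \notin _); case: (_ != _).
have [qq|nqq] := eqVneq q q'; first by exists q; split; auto.
have [eqq|neq] := boolP (e q q'); first by exists q; split; auto.
have [qFr qFr'] : q \in Fr /\ q' \in Fr.
  by move: qF qF'; rewrite !in_setD => /andP [_ ->] /andP [_ ->].
have := ore (FA _ qFr) (FA _ qFr') nqq; rewrite -cardsUI.
have cU : #|nbh e A q :|: nbh e A q'| + 2 <= #|A|.
  apply: (card_out2 nqq (FA _ qFr) (FA _ qFr')) => z; rewrite !inE => /orP [] /andP [-> h] /=;
  by apply/andP; split; apply: contraTneq h => ->; rewrite ?ei // es.
have [G [GL cG nG]] := free_misses iU qFr.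
have [a aF|no] := pickP [pred a in Fr :\: Z | e q a && e a q'].
  by case/andP: aF => aF /andP [h1 h2]; exists a; split; auto.
have : #|nbh e A q :&: nbh e A q'| <= #|(L :\: G) :|: (y @: M :|: Z)|.
  apply/subset_leq_card/subsetP => z; rewrite !inE => /andP [/andP [zA h1] /andP [_ h2]].
  have := no z; rewrite /= !inE h1 es h2 zA !andbT.
  have -> /= : z \notin G by apply/negP => /nG; rewrite h1.
  by case: (z \in Z); case: (z \in L); case: (z \in y @: M) => //=.
have : #|L :\: G| = #|L| - #|R i|.+1 by rewrite cardsDS // cG.
have : #|R i|.+1 <= #|L| by rewrite -cG subset_leq_card.
(* Without a free common neighbour, the [c] or more common neighbours of [q] and [q'] all lie in
   this union, of size at most 11m - 3c - 10. This is below [c] because 11m <= 4c. *)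
move: (cardU_le (L :\: G) (y @: M :|: Z)) (cardU_le (y @: M) Z); nlia.
Qed.

End Max.

Theorem ore_linked : exists C : J -> {set T}, [/\ forall i, C i \subset A,
    forall i j, i != j -> [disjoint C i & C j],
    forall i, jn e (C i) (s i) (t i) &
    forall i, C i :&: L \subset [set s i; t i]].
Proof.
have [||[M y] [My maxM]] := @ex_max ({set J} * (J -> T)) (fun My => connectors My.1 My.2) (fun My => #|My.1|) #|J|.
- by exists (set0, s); split=> [|i|i]; rewrite ?sub0set ?inE.
- by move=> [M y] _; apply: max_card.
have {}maxM M' y' : connectors M' y' -> #|M'| <= #|M| by move=> h; apply: (maxM (M', y')).
have [Mb yC yI] := My.
have [C [CF dC PC C0]] := greedy (link_unmatched My maxM).
pose D i := if i \in M then [set y i] else C i.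
have CM i : C i \subset A :\: (L :|: y @: M) := CF i.
have yA i : i \in M -> y i \in A :\: L.
  by move/yC; rewrite inE => /andP [].
apply: (@assemble _ e A L J s t D) => // [i|i j ij|i]; rewrite /D.
- case: ifP => iM; first by rewrite sub1set yA.
  by apply: subset_trans (CM i) _; apply: setDS; apply: subsetUl.
- have yCd k l : k \in M -> [disjoint [set y k] & C l].
    move=> kM; apply: disjointI => z /set1P -> /(subsetP (CM l)).
    by rewrite !inE negb_or (imset_f _ kM) andbF.
  case: ifP => iM; case: ifP => jM; [|exact: yCd|by rewrite disjoint_sym yCd|exact: dC].
  apply: disjointI => z /set1P -> /set1P /(yI _ _ iM jM) eij.
  by rewrite eij eqxx in ij.
case: ifP => iM.
  have := yC _ iM; rewrite !inE => /andP [_ /andP [h1 h2]].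
  apply: (@jn_trans _ _ _ (y i)); apply: jn_edge; rewrite ?inE ?eqxx ?orbT //.
  by rewrite es.
have [iU|] := boolP (i \in bad :\: M); first exact: PC.
move=> iU; rewrite C0 // set0U; move: iU; rewrite in_setD iM /= inE negb_and !negbK.
case/orP => [/eqP <-|h]; first by apply: jn_refl; rewrite !inE eqxx.
by apply: jn_edge; rewrite ?inE ?eqxx ?orbT.
Qed.

End Ore.

(** * Linkages in small dense graphs *)

(** After the first hit, every later one is among the next two vertices. *)
Lemma count_window (T : eqType) (a : pred T) s w :
  (forall q1 q2 y q3, w = q1 ++ q2 ++ y :: q3 -> a (last s q1) -> a y -> size q2 <= 1) ->
  count a (s :: w) <= 3.
Proof.
move=> win; have [hh|/hasPn h] := boolP (has a (s :: w)); last first.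
  by rewrite (@eq_in_count _ _ pred0) ?count_pred0 // => z /h /negPf.
have E : forall s w, has a (s :: w) -> exists p1 p2, [/\ w = p1 ++ p2, a (last s p1) & count a (belast s p1) = 0].
  move=> s' p; elim: p s' => [|y p IH] s'; first by rewrite has_seq1 => h; exists [::], [::].
  have [h _|h] := boolP (a s'); first by exists [::], (y :: p).
  rewrite [has _ _]/= (negPf h) => /IH [p1 [p2 [-> h1 h2]]].
  by exists (y :: p1), p2; rewrite /= (negPf h) h2.
have [p1 [p2 [ew al c0]]] := E _ _ hh.
have -> : count a (s :: w) = 1 + count a p2.
  by rewrite ew -cat_cons count_cat lastI -cats1 count_cat c0 /= al.
rewrite -(cat_take_drop 2 p2) count_cat.
have -> : count a (drop 2 p2) = 0.
  apply/eqP; rewrite -leqn0 leqNgt -has_count; apply/negP => /hasP [y yd ay].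
  have [d1 [d2 ed]] : exists d1 d2, drop 2 p2 = d1 ++ y :: d2 by case/splitPr: yd => d1 d2; exists d1, d2.
  have := win p1 (take 2 p2 ++ d1) y d2; rewrite -catA -ed cat_take_drop => /(_ ew al ay).
  have : 2 < size p2 by rewrite ltnNge -subn_eq0 -size_drop ed size_cat addnS.
  by rewrite size_cat size_take => ->.
by have := count_size a (take 2 p2); have := size_takel; rewrite size_take; case: ifP; nlia.
Qed.

Lemma walk_path (T : finType) (e : rel T) x y q : path e x (rcons q y) -> x != y ->
  exists q', [/\ path e x (rcons q' y), uniq (x :: rcons q' y), {subset q' <= q} & size q' <= size q].
Proof.
move=> pt ne.
have [p [pp lp up sp]] : exists p, [/\ path e x p, last x p = y, uniq (x :: p) & {subset p <= rcons q y}].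
  by case/shortenP: pt (last_rcons x q y) => p; exists p.
case/lastP: p pp lp up sp => [|q' z0] pp lp up sp; first by rewrite /= in lp; rewrite lp eqxx in ne.
rewrite last_rcons in lp; rewrite {}lp in pp up sp; exists q'.
have sq : {subset q' <= q}.
  move=> z zq; have := sp z; rewrite !mem_rcons !inE zq orbT => /(_ isT) /predU1P [zy|//].
  by move: up; rewrite /= rcons_uniq -zy zq andbF.
split=> //; apply: uniq_leq_size sq.
by move: up; rewrite /= rcons_uniq => /and3P [].
Qed.

Ltac bool_lia := repeat match goal with |- context [nat_of_bool ?b] =>
    move: (leq_b1 b); generalize (nat_of_bool b);
    let n := fresh "n" in intros n end; intros; lia.

Section Dense.
Variables (T : finType) (e : rel T) (D : {set T}) (m K : nat).
Hypotheses (es : symmetric e) (ei : irreflexive e).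
Hypotheses (DK : #|D| <= K) (K1 : 12 * m < K) (K2 : 25 * m <= 2 * K).
Hypothesis degD : forall v, v \in D -> K <= (2 * #|nbh e D v|).+1.
Variables (L : {set T}) (J : finType) (s t : J -> T).
Hypotheses (LD : L \subset D) (Lsmall : #|L| <= 2 * m).
Hypotheses (sL : forall i, s i \in L) (tL : forall i, t i \in L) (st : forall i, s i != t i).
Hypothesis dst : forall i j, i != j -> [disjoint [set s i; t i] & [set s j; t j]].

Implicit Types (JJ : {set J}) (w : J -> seq T).

Definition valid (JJ : {set J}) (w : J -> seq T) :=
  [/\ {in JJ, forall i, path e (s i) (w i) /\ last (s i) (w i) = t i},
      {in JJ, forall i, uniq (s i :: w i)},
      {in JJ, forall i z, z \in s i :: w i -> z \in D /\ (z \in L -> z \in [set s i; t i])} &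
      {in JJ &, forall i j z, i != j -> z \in s i :: w i -> z \in s j :: w j -> False}].

Fact used_key : unit. Proof. exact tt. Qed.
(** All of [L] counts as used, so that a free vertex is never a root. *)
Definition used (JJ : {set J}) (w : J -> seq T) : {set T} :=
  locked_with used_key (L :|: [set z | [exists i in JJ, z \in s i :: w i]]).

Lemma usedP JJ w z : reflect (z \in L \/ exists2 i, i \in JJ & z \in s i :: w i) (z \in used JJ w).
Proof.
rewrite /used locked_withE in_setU [z \in [set _ | _]]inE; apply: (iffP orP) => -[h|h]; try by left.
  by right; have /existsP [i /andP [iJ iz]] := h; exists i.
by right; have [i iJ iz] := h; apply/existsP; exists i; rewrite iJ.
Qed.


Definition upd (w : J -> seq T) j q := fun i => if i == j then q else w i.

Lemma valid_upd JJ w j q : valid JJ w -> path e (s j) q -> last (s j) q = t j -> uniq (s j :: q) ->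
  (forall z, z \in s j :: q -> z \in D /\ (z \in L -> z \in [set s j; t j])) ->
  (forall i z, i \in JJ -> i != j -> z \in s i :: w i -> z \in s j :: q -> False) ->
  valid (j |: JJ) (upd w j q).
Proof.
case=> v1 v2 v3 v4 pq lq uq Dq dq; rewrite /upd; split.
- by move=> i; rewrite in_setU1; case: eqP => [-> //|_ /= iJ]; apply: v1.
- by move=> i; rewrite in_setU1; case: eqP => [-> //|_ /= iJ]; apply: v2.
- by move=> i; rewrite in_setU1; case: eqP => [-> //|_ /= iJ]; apply: v3.
move=> i k; rewrite !in_setU1.
have [->|ij] := eqVneq i j; have [->|kj] := eqVneq k j; rewrite /= => iJ kJ z ik.
- by move: ik; rewrite ?eqxx.
- by move=> h1 h2; apply: dq h2 h1.
- exact: dq.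
- exact: v4.
Qed.

Lemma valid_full w : valid setT w ->
  exists C : J -> {set T}, [/\ forall i, C i \subset D,
    forall i j, i != j -> [disjoint C i & C j],
    forall i, jn e (C i) (s i) (t i) &
    forall i, C i :&: L \subset [set s i; t i]].
Proof.
case=> v1 v2 v3 v4; exists (fun i => setp (s i) (w i)); split=> [i|i j ij|i|i].
- by apply/subsetP => z; rewrite inE => zw; case: (v3 i _ z zw); rewrite ?inE.
- by apply: disjointI => z; rewrite !inE -!in_cons; apply: v4; rewrite ?inE.
- by have [|pt <-] := v1 i; rewrite ?inE //; apply: jn_setp.
- apply/subsetP => z; rewrite in_setI inE => /andP [zw zL].
  by case: (v3 i _ z zw); rewrite ?in_setT // => _; apply.
Qed.

Lemma card_terminals (M : {set J}) : #|s @: M :|: t @: M| = 2 * #|M|.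
Proof.
have inj (g : J -> T) : (forall i, g i \in [set s i; t i]) -> injective g.
  move=> gst i j ij; apply/eqP/negPn/negP => /dst d.
  by apply: disj_eq d (gst i) _; rewrite ij.
rewrite cardsU disjoint_setI0 ?cards0 ?subn0.
  rewrite !card_imset; [nlia| |]; by apply: inj => i; rewrite !inE eqxx ?orbT.
apply: disjointI => z /imsetP [i iM ->] /imsetP [j jM ij].
have [eij|nij] := eqVneq i j; first by have := st i; rewrite ij eij eqxx.
by apply: (disj_eq (dst nij) (z := s i)); rewrite !inE ?eqxx // ij eqxx orbT.
Qed.

Lemma pair_eq i j z : z \in [set s i; t i] -> z \in [set s j; t j] -> i = j.
Proof.
by move=> zi zj; apply/eqP/negPn/negP => /dst d; apply: disj_eq d zi zj.
Qed.

(** Bookkeeping for rerouting one path: [R] is released and [N] is newly occupied. Disjointness of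
    the paths ensures that no other path needs [R]. *)
Lemma used_upd JJ w (i : J) (q : seq T) (R N : {set T}) : valid JJ w -> i \in JJ ->
  R \subset setp (s i) (w i) :\: L -> {subset s i :: q <= N :|: (used JJ w :\: R)} ->
  used JJ (upd w i q) \subset N :|: (used JJ w :\: R).
Proof.
case=> v1 v2 v3 v4 iJ Rsub qsub; apply/subsetP => z /usedP [zL|[j jJ]].
  have zU : z \in used JJ w by apply/usedP; left.
  rewrite in_setU in_setD zU andbT; apply/orP; right; apply/negP => /(subsetP Rsub).
  by rewrite in_setD zL.
rewrite /upd; case: (eqVneq j i) => [->|ji] zj; first exact: qsub.
have zU : z \in used JJ w by apply/usedP; right; exists j.
rewrite in_setU in_setD zU andbT; apply/orP; right; apply/negP => /(subsetP Rsub).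
by rewrite in_setD inE => /andP [_ zi]; apply: v4 jJ iJ _ ji zj zi.
Qed.

Lemma card_upd JJ w (R N U' : {set T}) : R \subset used JJ w ->
  U' \subset N :|: (used JJ w :\: R) -> #|U'| + #|R| <= #|used JJ w| + #|N|.
Proof.
move=> RU /subset_leq_card le; rewrite -(cardsID R (used JJ w)) (setIidPr RU).
have := cardU_le N (used JJ w :\: R); nlia.
Qed.

(** * An optimal partial linkage and the free vertices around it *)

Section Optimum.
Variables (JJ : {set J}) (w : J -> seq T) (i0 : J).
Hypotheses (val : valid JJ w) (i0J : i0 \notin JJ).
Notation U := (used JJ w).
Hypothesis U6 : #|U| <= 6 * m.
Hypothesis maxJ : forall JJ' w', valid JJ' w' -> #|used JJ' w'| <= 6 * m -> #|JJ'| <= #|JJ|.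
Hypothesis minU : forall w', valid JJ w' -> #|used JJ w'| <= 6 * m -> #|U| <= #|used JJ w'|.
Hypothesis nofull : forall w', ~ valid setT w'.

Let F := D :\: U.
Let sg := s i0.
Let ta := t i0.
Let Lr := L :\: (s @: JJ :|: t @: JJ).

Let UD : U \subset D.
Proof.
apply/subsetP => z /usedP [/(subsetP LD) //|[i iJ zi]].
by case: val => _ _ v3 _; case: (v3 i iJ z zi).
Qed.

Let FD f : f \in F -> f \in D. Proof. by rewrite inE => /andP []. Qed.
Let FU f : f \in F -> f \notin U. Proof. by rewrite inE => /andP []. Qed.
Let FL f : f \in F -> f \notin L.
Proof. by move/FU; apply: contra => fL; apply/usedP; left. Qed.

Let cardF : #|F| + #|U| = #|D|.
Proof. by rewrite cardsDS // subnK // subset_leq_card. Qed.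

Let JJm : 2 * #|JJ|.+1 <= #|L|.
Proof.
have <- : #|i0 |: JJ| = #|JJ|.+1 by rewrite cardsU1 i0J.
rewrite -card_terminals; apply: subset_leq_card; rewrite subUset.
by apply/andP; split; apply/subsetP => z /imsetP [i _ ->].
Qed.

Let card_Lr : #|Lr| + 2 * #|JJ| = #|L|.
Proof.
rewrite -card_terminals cardsDS ?subnK ?subset_leq_card // subUset;
by apply/andP; split; apply/subsetP => z /imsetP [i _ ->].
Qed.

Let stLr x : x \in [set sg; ta] -> x \in Lr.
Proof.
move=> xst; have xL : x \in L by case/set2P: xst => ->; [apply: sL|apply: tL].
rewrite inE xL andbT; apply/negP => /setUP h.
have [i iJ xi] : exists2 i, i \in JJ & x \in [set s i; t i].
  by case: h => /imsetP [i iJ ->]; exists i; rewrite ?inE ?eqxx ?orbT.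
by case/negP: i0J; rewrite (pair_eq xst xi).
Qed.

(** [U] splits into the linking paths and the roots [Lr] of pairs not yet linked. Kept general in
    [a] to give both the size of [U] and the number of neighbours in it. *)
Lemma sum_used (a : pred T) : #|[set z in U | a z]| =
  \sum_(i in JJ) count a (s i :: w i) + #|[set z in Lr | a z]|.
Proof.
have [v1 v2 v3 v4] := val.
pose P i := if i \in JJ then [set z in s i :: w i] else set0.
have UE : U = (\bigcup_i P i) :|: Lr.
  apply/setP => z; rewrite in_setU; apply/usedP/orP => [[zL|[i iJ zi]]|[|zL]].
  - have [zt|zt] := boolP (z \in s @: JJ :|: t @: JJ); last by right; rewrite inE zt.
    left; apply/bigcupP; case/setUP: zt => /imsetP [i iJ ->]; exists i => //;
    rewrite /P iJ inE ?mem_head //.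
    by have [_ <-] := v1 _ iJ; rewrite mem_last.
  - by left; apply/bigcupP; exists i => //; rewrite /P iJ inE.
  - case/bigcupP => i _; rewrite /P; case: ifP => [iJ|]; rewrite inE // => zi.
    by right; exists i.
  - by left; move: zL; rewrite inE => /andP [].
have dP i j : i != j -> [disjoint P i & P j].
  move=> ij; apply: disjointI => z; rewrite /P; case: ifP => [iJ|]; case: ifP => [jJ|]; rewrite ?inE //.
  by rewrite -!in_cons; apply: v4.
have dL : [disjoint \bigcup_i P i & Lr].
  apply: disjointI => z /bigcupP [i _]; rewrite /P; case: ifP => [iJ|]; rewrite inE // => zi.
  rewrite inE => /andP [/negP h zL]; apply: h; have [_ /(_ zL)] := v3 _ iJ _ zi.
  by rewrite in_setU; case/set2P => ->; rewrite imset_f ?orbT.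
have sumE (B : {set T}) : #|[set z in B | a z]| = \sum_(z in B) a z.
  by rewrite -sum1_card big_mkcond [RHS]big_mkcond; apply: eq_bigr => z _; rewrite inE; case: (z \in B); case: (a z).
rewrite !sumE UE (eq_bigl [in [predU (\bigcup_i P i) & Lr]]) => [|z]; last first.
  by rewrite in_setU /in_mem /=.
rewrite bigU //; congr (_ + _); rewrite partition_disjoint_bigcup //= [RHS]big_mkcond; apply: eq_bigr => i _.
rewrite /P; case: ifP => iJ; last by rewrite big_set0.
rewrite (eq_bigl (mem (s i :: w i))) => [|z]; last by rewrite inE.
rewrite -big_uniq ?v2 // -[RHS]/(count a (s i :: w i)) -sum1_count [RHS]big_mkcond.
by apply: eq_bigr => z _; case: (a z).
Qed.

Let cardU : #|U| = \sum_(i in JJ) (size (w i)).+1 + #|Lr|.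
Proof.
have := sum_used predT; under eq_bigr => i _ do rewrite count_predT.
by rewrite (_ : [set z in U | _] = U) 1?(_ : [set z in Lr | _] = Lr) //; apply/setP => z; rewrite inE andbT.
Qed.

Let dU f := #|nbh e U f|.
Let dF f := #|nbh e F f|.

Let dUE f : dU f = \sum_(i in JJ) count (e f) (s i :: w i) + #|nbh e Lr f|.
Proof. exact: sum_used. Qed.

Let dUF f : #|nbh e D f| = dU f + dF f.
Proof.
rewrite -(cardsID U) /dU /dF; congr (_ + _); apply: eq_card => z; rewrite !inE.
  by have := subsetP UD z; case: (z \in U) => [/(_ isT) ->|_]; rewrite ?andbT ?andbF.
by rewrite andbA.
Qed.

Let degF f : f \in D -> K <= (2 * (dU f + dF f)).+1.
Proof. by rewrite -dUF; apply: degD. Qed.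

(** A detour through [f] would replace two or more inner vertices by one, against the minimality of
    [U]. *)
Let path_window f i q1 q2 y q3 : f \in F -> i \in JJ -> w i = q1 ++ q2 ++ y :: q3 ->
  e f (last (s i) q1) -> e f y -> size q2 <= 1.
Proof.
move=> fF iJ ew ex ey; have [v1 v2 v3 v4] := val.
rewrite leqNgt; apply/negP => sz.
pose w' := upd w i (q1 ++ f :: y :: q3).
have [pt lt] := v1 _ iJ; have un := v2 _ iJ.
have sub z : z \in s i :: q1 ++ f :: y :: q3 -> z = f \/ z \in s i :: w i.
  by rewrite ew !inE !mem_cat !inE => /or4P [->|->|/eqP|/orP [->|->]]; rewrite ?orbT; auto.
have fw : f \notin s i :: w i by apply/negP => h; case/negP: (FU fF); apply/usedP; right; exists i.
have vw' : valid (i |: JJ) w'.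
  apply: valid_upd => //.
  - by move: pt; rewrite ew !cat_path /= => /andP [-> /andP [_ /andP [_ ->]]]; rewrite es ex ey.
  - by rewrite -lt ew !last_cat.
  - rewrite -cat_cons -[f :: _]cat1s uniq_catCA cat1s cons_uniq; apply/andP; split.
      apply/negP => h; case/negP: fw; rewrite ew -cat_cons !mem_cat; move: h.
      by rewrite mem_cat => /orP [->|->]; rewrite ?orbT.
    apply: subseq_uniq un; rewrite ew -cat_cons; apply: cat_subseq => //; exact: suffix_subseq.
  - move=> z /sub [->|/(v3 _ iJ) //]; split; [exact: FD|by move/negPf: (FL fF) => ->].
  - move=> j z jJ ji zj /sub [zf|zi]; last exact: v4 jJ iJ _ ji zj zi.
    by case/negP: (FU fF); apply/usedP; right; exists j; rewrite -?zf.
have iJE : i |: JJ = JJ by apply/setUidPr; rewrite sub1set.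
rewrite iJE in vw'.
have ltU : #|used JJ w'| < #|U|.
  have uq2 : uniq q2 by move: un; rewrite ew /= !cat_uniq => /and5P [_ _ _ ->].
  have inw z : z \in q2 -> z \in s i :: w i by rewrite ew inE !mem_cat => ->; rewrite !orbT.
  have dq z : z \in q2 -> z \in s i :: q1 ++ y :: q3 -> False.
    have : uniq (q2 ++ (s i :: q1) ++ y :: q3) by rewrite uniq_catCA cat_cons -ew.
    by rewrite cat_uniq => /and3P [_ /hasPn h _] zq /h; rewrite /= zq.
  pose R := [set z in q2]; have inU z : z \in s i :: w i -> z \in U by move=> zi; apply/usedP; right; exists i.
  have := @card_upd JJ w R [set f] (used JJ w').
  have -> : #|R| = size q2 by rewrite cardsE (card_uniqP uq2).
  rewrite cards1.
  suff [h1 h2] : R \subset U /\ used JJ w' \subset f |: (U :\: R) by move/(_ h1 h2); nlia.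
  split; first by apply/subsetP => z; rewrite inE => /inw /inU.
  apply: used_upd => //.
    apply/subsetP => z; rewrite inE => zq; rewrite in_setD [_ \in setp _ _]inE inw // andbT.
    apply/negP => zL; have [_ /(_ zL)] := v3 _ iJ _ (inw _ zq); case/set2P => zz; apply: (dq z) => //.
      by rewrite zz mem_head.
    by rewrite zz -lt ew !last_cat /= inE mem_cat mem_last !orbT.
  move=> z zq; have [zf|zf] := eqVneq z f; first by rewrite zf !inE eqxx.
  rewrite in_setU in_setD; apply/orP; right; apply/andP; split; last by have [/eqP|/inU] := sub z zq; rewrite ?(negPf zf).
  rewrite inE; apply/negP => /dq; apply; move: zq.
  by rewrite !inE !mem_cat !inE (negPf zf).
by have := leq_trans ltU (minU vw' (leq_trans (ltnW ltU) U6)); rewrite ltnn.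
Qed.

Let path_count3 f i : f \in F -> i \in JJ -> count (e f) (s i :: w i) <= 3.
Proof.
by move=> fF iJ; apply: count_window => q1 q2 y q3 ew; apply: path_window ew.
Qed.

Let dU_le f : f \in F -> dU f <= #|L| + #|JJ|.
Proof.
move=> fF; rewrite dUE.
have : \sum_(i in JJ) count (e f) (s i :: w i) <= \sum_(i in JJ) 3.
  by apply: leq_sum => i; apply: path_count3.
rewrite sum_nat_const; have : #|nbh e Lr f| <= #|Lr|.
  by apply/subset_leq_card/subsetP => z; rewrite inE => /andP [].
move: card_Lr; nlia.
Qed.

Let N f := f |: nbh e F f.

Let cardN f : #|N f| = (dF f).+1.
Proof. by rewrite cardsU1 inE ei andbF. Qed.

Let NF f : f \in F -> N f \subset F.
Proof. by move=> fF; rewrite subUset sub1set fF; apply/subsetP => z; rewrite inE => /andP []. Qed.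

Let NE f z : z \in N f -> f = z \/ e f z.
Proof. by rewrite in_setU1 inE => /predU1P [->|/andP [_ ->]]; auto. Qed.

(** Both closed neighbourhoods fit into [F], which has at most K - |U| vertices, while [f] and [g]
    each have degree at least (K-1)/2 in [D]. The difference must be neighbours in [U]. *)
Let disjN f g : f \in F -> g \in F -> [disjoint N f & N g] -> #|U| < dU f + dU g.
Proof.
move=> fF gF d; have := degF (FD fF); have := degF (FD gF).
have : #|N f :|: N g| <= #|F| by apply: subset_leq_card; rewrite subUset !NF.
rewrite cardsU disjoint_setI0 // cards0 !cardN; move: cardF DK; nlia.
Qed.

(** A vertex of [U] has at most 6m - 1 neighbours in [U] and, since K > 12m, degree at least 6m.
    This fixes the cap 6m on partial linkages. *)
Let F_neighbour x : x \in U -> exists2 f, f \in F & e x f.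
Proof.
move=> xU; have : 0 < dF x.
  have : dU x < #|U|.
    apply: proper_card; apply/properP; split; first by apply/subsetP => z; rewrite inE => /andP [].
    by exists x; rewrite // inE ei andbF.
  have := degF (subsetP UD _ xU); move: K1 U6; nlia.
by case/card_gt0P => f; rewrite inE => /andP [fF xf]; exists f.
Qed.

(** With loops allowed, a walk can be written with a fixed list of vertices even if some of them
    coincide. *)
Let er := [rel x y | (x == y) || e x y].

Let walk_short x y q : path er x (rcons q y) -> x != y ->
  exists q', [/\ path e x (rcons q' y), uniq (x :: rcons q' y), {subset q' <= q} & size q' <= size q].
Proof.
move=> pt xy; have [q' [pq uq sq szq]] := walk_path pt xy; exists q'; split=> //.
elim: (rcons q' y) (x) pq uq => [|b p IH] a //= /andP [ab pb] /andP [nb ub].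
rewrite IH // andbT; case/orP: ab => // /eqP ab; by rewrite ab mem_head in nb.
Qed.

Let extend w' q : valid JJ w' -> path er sg (rcons q ta) -> {subset q <= D :\: used JJ w'} ->
  #|used JJ w'| + size q <= 6 * m \/ i0 |: JJ = setT -> False.
Proof.
move=> vw' /walk_short -/(_ (st i0)) [q' [pq uq sq szq]] qD bnd.
have {}qD z : z \in q' -> z \in D /\ z \notin used JJ w'.
  by move/sq/qD; rewrite inE => /andP [].
have qL z : z \in q' -> z \in L -> False.
  by case/qD => _ /negP h zL; apply: h; apply/usedP; left.
have vw : valid (i0 |: JJ) (upd w' i0 (rcons q' ta)).
  apply: valid_upd => //.
  - by rewrite last_rcons.
  - move=> z; rewrite inE mem_rcons inE; case/or3P => [/eqP ->|/eqP ->|zq].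
    + by split; [apply: (subsetP LD); apply: sL|rewrite !inE eqxx].
    + by split; [apply: (subsetP LD); apply: tL|rewrite !inE eqxx orbT].
    + by split; [case: (qD z zq)|move/(qL z zq)].
  - move=> i z iJ ii zi; case: vw' => _ _ v3 _; have [_ zL] := v3 i iJ z zi.
    have st0 : z \in [set s i0; t i0] -> False.
      move=> z0; have zL' : z \in L by case/set2P: z0 => ->.
      by case/negP: ii; rewrite (pair_eq (zL zL') z0).
    rewrite inE mem_rcons inE; case/or3P => [/eqP zz|/eqP zz|zq].
    + by apply: st0; rewrite zz !inE eqxx.
    + by apply: st0; rewrite zz !inE eqxx orbT.
    + by case: (qD z zq) => _ /negP; apply; apply/usedP; right; exists i.
case: bnd => [bnd|full]; last by rewrite full in vw; apply: nofull vw.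
have : #|used (i0 |: JJ) (upd w' i0 (rcons q' ta))| <= #|used JJ w'| + size q'.
  apply: leq_trans (_ : #|used JJ w' :|: [set z in q']| <= _); last first.
    apply: leq_trans (cardU_le _ _) _; rewrite leq_add2l cardsE; exact: card_size.
  apply/subset_leq_card/subsetP => z /usedP [zL|[j]].
    by rewrite in_setU; apply/orP; left; apply/usedP; left.
  rewrite in_setU1 /upd; case: (eqVneq j i0) => [-> _|ji /= jJ zj]; last first.
    by rewrite in_setU; apply/orP; left; apply/usedP; right; exists j.
  rewrite inE mem_rcons inE in_setU; case/or3P => [/eqP ->|/eqP ->|zq].
  - by apply/orP; left; apply/usedP; left; apply: sL.
  - by apply/orP; left; apply/usedP; left; apply: tL.
  - by rewrite inE zq orbT.
move=> h; have /maxJ := leq_trans h (leq_trans (leq_add (leqnn _) szq) bnd).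
by rewrite cardsU1 i0J => /(_ vw); rewrite ltnn.
Qed.

Let inU_path i z : i \in JJ -> z \in s i :: w i -> z \in U.
Proof. by move=> iJ zi; apply/usedP; right; exists i. Qed.

Let stU x : x \in [set sg; ta] -> x \in U.
Proof. by case/set2P => ->; apply/usedP; left; [apply: sL|apply: tL]. Qed.

Let er_N a b : b \in N a -> er a b && er b a.
Proof. by case/NE => [->|ab]; rewrite /= ?eqxx // [e b a]es ab !orbT. Qed.

(** If all closed neighbourhoods met, any two used vertices could be joined through three free ones.
    Minimality would leave at most five vertices on each path, so |U| <= |L| + 3|JJ|, and the pair
    [i0] could be linked with three more vertices within the cap. *)
Let far_pair : exists f g, [/\ f \in F, g \in F & [disjoint N f & N g]].
Proof.
apply: NNPP => no.
have meet f g : f \in F -> g \in F -> exists2 z, z \in N f & z \in N g.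
  move=> fF gF; apply: NNPP => no'; apply: no; exists f, g; split=> //.
  by apply: disjointI => z zf zg; apply: no'; exists z.
have short x y : x \in U -> y \in U ->
    exists q, [/\ path er x (rcons q y), {subset q <= F} & size q <= 3].
  move=> xU yU; have [f fF xf] := F_neighbour xU; have [g gF yg] := F_neighbour yU.
  have [z zf zg] := meet f g fF gF; exists [:: f; z; g]; split=> //.
    have /andP [h1 _] := er_N zf; have /andP [_ h2] := er_N zg.
    by rewrite /= in h1 h2 *; rewrite h1 h2 xf [e g y]es yg !orbT.
  move=> u; rewrite 3!in_cons in_nil orbF => /or3P [] /eqP -> //; exact: (subsetP (NF fF) _ zf).
have [v1 v2 v3 v4] := val.
have size4 i : i \in JJ -> size (w i) <= 4.
  move=> iJ; rewrite leqNgt; apply/negP => sz.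
  have [_ lt] := v1 i iJ.
  have sU : s i \in U by apply: (inU_path iJ); rewrite mem_head.
  have tU : t i \in U by apply: (inU_path iJ); rewrite -lt mem_last.
  have [q0 [pq0 qF0 sq0]] := short _ _ sU tU.
  have [q [pq uq sq szq]] := walk_short pq0 (st i).
  have {}sq z : z \in q -> z \in F by move/sq/qF0.
  pose R := setp (s i) (w i) :\: L; pose w' := upd w i (rcons q (t i)).
  have qin z : z \in s i :: rcons q (t i) -> z \in [set s i; t i] \/ z \in q.
    rewrite inE mem_rcons inE => /or3P [/eqP ->|/eqP ->|->]; auto; left; by rewrite !inE eqxx ?orbT.
  have vw' : valid (i |: JJ) w'.
    apply: valid_upd => //; first by rewrite last_rcons.
    - move=> z /qin [zst|/sq zF]; last by split; [apply: FD|move=> zL; case/negP: (FL zF)].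
      by split=> //; case/set2P: zst => ->; apply: (subsetP LD).
    - move=> j z jJ ji zj /qin [zst|/sq /FU /negP]; last by apply; apply: inU_path zj.
      apply: (v4 j i jJ iJ z ji zj); case/set2P: zst => ->; rewrite ?mem_head //.
      by rewrite -lt mem_last.
  have iJE : i |: JJ = JJ by apply/setUidPr; rewrite sub1set.
  rewrite iJE in vw'.
  have RU : R \subset U by apply/subsetP => z; rewrite !inE => /andP [_ zi]; apply: inU_path zi.
  have := @card_upd JJ w R [set z in q] (used JJ w') RU.
  have cR : size (w i) <= #|R| + 1.
    have : (size (w i)).+1 = #|setp (s i) (w i)| by rewrite cardsE (card_uniqP (v2 i iJ)).
    rewrite -(cardsID L).
    have : #|setp (s i) (w i) :&: L| <= #|[set s i; t i]|.
      by apply/subset_leq_card/subsetP => z; rewrite !inE => /andP [zi zL]; have [_ /(_ zL)] := v3 i iJ z zi; rewrite !inE.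
    rewrite cards2 st /R; nlia.
  have cN : #|[set z in q]| <= 3.
    rewrite cardsE; apply: leq_trans (card_size _) _; exact: leq_trans szq sq0.
  have sub : used JJ w' \subset [set z in q] :|: (U :\: R).
    apply: used_upd => // z /qin [zst|zq]; last by rewrite !inE zq.
    have zL : z \in L by case/set2P: zst => ->.
    by rewrite in_setU in_setD in_setD zL /=; apply/orP; right; apply/usedP; left.
  move/(_ sub) => le; have ltU : #|used JJ w'| < #|U| by move: le cN cR sz; nlia.
  by have := leq_trans ltU (minU vw' (leq_trans (ltnW ltU) U6)); rewrite ltnn.
have cU : #|U| <= #|JJ| * 5 + #|Lr|.
  by rewrite cardU leq_add2r -sum_nat_const; apply: leq_sum => i /size4.
have [q [pq qF sq]] : exists q, [/\ path er sg (rcons q ta), {subset q <= F} & size q <= 3].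
  by apply: short; apply: stU; rewrite !inE eqxx ?orbT.
apply: (extend val pq qF); left; move: card_Lr JJm; nlia.
Qed.

Let U_small1 : #|U| < 2 * (#|L| + #|JJ|).
Proof.
have [f [g [fF gF d]]] := far_pair.
by have := disjN fF gF d; have := dU_le fF; have := dU_le gF; nlia.
Qed.

Let not_both f : f \in F -> e f sg -> e f ta -> False.
Proof.
move=> fF fs ft; apply: (@extend w [:: f] val).
- by rewrite /= es fs ft !orbT.
- by move=> z; rewrite inE => /eqP ->.
- left; move: U_small1 JJm; rewrite /=; nlia.
Qed.

Let nbhLr f : f \in F -> #|nbh e Lr f| < #|Lr|.
Proof.
move=> fF; apply: proper_card; apply/properP; split; first by apply/subsetP => z; rewrite inE => /andP [].
have [fs|fs] := boolP (e f sg); [exists ta|exists sg]; try (by apply: stLr; rewrite !inE eqxx ?orbT).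
  by rewrite inE; apply/negP => /andP [_]; apply: not_both.
by rewrite inE (negPf fs) andbF.
Qed.

Let dU_le2 f : f \in F -> dU f < #|L| + #|JJ|.
Proof.
move=> fF; rewrite dUE.
have : \sum_(i in JJ) count (e f) (s i :: w i) <= \sum_(i in JJ) 3.
  by apply: leq_sum => i; apply: path_count3.
rewrite sum_nat_const; have := nbhLr fF; move: card_Lr; nlia.
Qed.

Let U_small : #|U| + 3 <= 2 * (#|L| + #|JJ|).
Proof.
have [f [g [fF gF d]]] := far_pair.
by have := disjN fF gF d; have := dU_le2 fF; have := dU_le2 gF; nlia.
Qed.

(** If a pair other than [i0] is also unlinked, then 2|JJ| + 4 <= |L|, and [U_small] gives |U| + 7
    <= 2|L| + 2|JJ| + 4 <= 3|L| <= 6m. If not, the walk completes the linkage and the cap does not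
    matter. *)
Let bridge w' q : valid JJ w' -> #|used JJ w'| <= #|U| -> path er sg (rcons q ta) ->
  {subset q <= D :\: used JJ w'} -> size q <= 7 -> False.
Proof.
move=> vw' cU pq qD sq; apply: (extend vw' pq qD).
have [full|nfull] := eqVneq (i0 |: JJ) setT; [by right|left].
have : #|JJ| + 2 <= #|J|.
  have : #|i0 |: JJ| < #|J| by rewrite -cardsT proper_card // properT.
  by rewrite cardsU1 i0J; nlia.
have : 2 * #|J| <= #|L|.
  rewrite -cardsT -card_terminals; apply: subset_leq_card; rewrite subUset.
  by apply/andP; split; apply/subsetP => z /imsetP [i _ ->].
move: U_small; nlia.
Qed.

(* A path contributes at most three neighbours of each vertex, and the ends [sg]
   and [ta] of the missing pair are never both adjacent to the same vertex. *)
Let three_sum f p g : f \in F -> p \in F -> g \in F -> dU f + dU p + dU g + 5 <= #|U| + 6 * m.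
Proof.
move=> fF pF gF; rewrite !dUE cardU.
have : \sum_(i in JJ) count (e f) (s i :: w i) + \sum_(i in JJ) count (e p) (s i :: w i) +
   \sum_(i in JJ) count (e g) (s i :: w i) <= \sum_(i in JJ) (size (w i)).+1 + #|JJ| * 6.
  rewrite -sum_nat_const -!big_split /=; apply: leq_sum => i iJ.
  have := count_size (e f) (s i :: w i); have := count_size (e p) (s i :: w i).
  have := count_size (e g) (s i :: w i).
  have := path_count3 fF iJ; have := path_count3 pF iJ; have := path_count3 gF iJ.
  rewrite /=; nlia.
have := nbhLr fF; have := nbhLr pF; have := nbhLr gF; move: card_Lr JJm; nlia.
Qed.

(** [N g] and the union of the other two are disjoint subsets of [F]. As [three_sum] limits the
    neighbours in [U], there is no room unless [N f] and [N p] overlap; two common vertices are kept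
    so that one of them can be avoided later. *)
Let common2 f p g : f \in F -> p \in F -> g \in F -> [disjoint N g & N f] -> [disjoint N g & N p] ->
  1 < #|N f :&: N p|.
Proof.
move=> fF pF gF df dp; have := three_sum fF pF gF.
have : #|N g :|: (N f :|: N p)| <= #|F| by apply: subset_leq_card; rewrite subUset NF // subUset !NF.
have d : [disjoint N g & N f :|: N p].
  by apply: disjointI => z zg /setUP [zf|zf]; [apply: disj_eq df zg zf|apply: disj_eq dp zg zf].
rewrite cardsU disjoint_setI0 // cards0; have := cardsUI (N f) (N p); rewrite !cardN.
have := degF (FD fF); have := degF (FD pF); have := degF (FD gF); move: cardF; nlia.
Qed.

Let other (S : {set T}) r : 1 < #|S| -> exists2 x, x \in S & x != r.
Proof.
move=> cS; have : 0 < #|S :\ r| by move: cS; rewrite (cardsD1 r S); case: (r \in S); nlia.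
by case/card_gt0P => x; rewrite in_setD1 => /andP [xr xS]; exists x.
Qed.

Let near x : x \in U -> 1 < dF x.
Proof.
move=> xU; have : dU x < #|U|.
  apply: proper_card; apply/properP; split; first by apply/subsetP => z; rewrite inE => /andP [].
  by exists x; rewrite // inE ei andbF.
have := degF (subsetP UD _ xU); move: K1 U_small JJm; nlia.
Qed.

Let er_refl a b : er a b -> er b a.
Proof. by rewrite /= eq_sym es. Qed.

Let er_e a b : e a b -> er a b.
Proof. by rewrite /= => ->; rewrite orbT. Qed.

Let er_N' a b : b \in N a -> er a b. Proof. by case/er_N/andP. Qed.

Ltac er_steps := repeat (apply/andP; split); try exact: isT;
  first [apply: er_e; assumption | apply: er_N'; assumption
        | apply: er_refl; apply: er_N'; assumption | apply: er_refl; apply: er_e; assumption].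

Let far0 f g : f \in F -> g \in F -> e sg f -> e ta g -> [disjoint N f & N g].
Proof.
move=> fF gF sf tg; apply: disjointI => z zf zg; apply: (@bridge w [:: f; z; g] val) => //.
  by er_steps.
apply/allP; rewrite /= fF gF (subsetP (NF fF)) //.
Qed.

Let f0 := odflt sg [pick f in F | e sg f].
Let g0 := odflt sg [pick f in F | e ta f].

Let f0P : f0 \in F /\ e sg f0.
Proof.
rewrite /f0; case: pickP => [f /andP []|no] //.
have [|f fF sf] := @F_neighbour sg; first by apply: stU; rewrite !inE eqxx.
by have := no f; rewrite fF sf.
Qed.

Let g0P : g0 \in F /\ e ta g0.
Proof.
rewrite /g0; case: pickP => [f /andP []|no] //.
have [|f fF sf] := @F_neighbour ta; first by apply: stU; rewrite !inE eqxx orbT.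
by have := no f; rewrite fF sf.
Qed.

(** The free vertices near [sg]. Short bridges will show that the rest of [F] is near [ta] and that
    no edge joins the two parts. *)
Let A := [set r in F | ~~ [disjoint N r & N f0]].
Let B := F :\: A.

Let AF r : r \in A -> r \in F. Proof. by rewrite [r \in A]inE => /andP []. Qed.
Let BF r : r \in B -> r \in F. Proof. by rewrite [r \in B]inE => /andP []. Qed.

Let A_near r : r \in A -> exists2 z, z \in N r & z \in N f0.
Proof.
rewrite [r \in A]inE => /andP [_ nd]; apply: NNPP => no; case/negP: nd.
by apply: disjointI => z zr zf; apply: no; exists z.
Qed.

Let A_far r : r \in A -> [disjoint N r & N g0].
Proof.
move=> rA; apply: disjointI => z' zr' zg; have [z zr zf] := A_near rA; have rF := AF rA.
have [[fF sf] [gF tg]] := (f0P, g0P).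
apply: (@bridge w [:: f0; z; r; z'; g0] val) => //.
  by er_steps.
by apply/allP; rewrite /= fF gF rF (subsetP (NF fF) _ zf) (subsetP (NF gF) _ zg).
Qed.

Let B_far r : r \in B -> [disjoint N r & N f0].
Proof.
rewrite in_setD => /andP [nA rF]; apply/negPn/negP => nd.
by case/negP: nA; rewrite [r \in A]inE nd andbT.
Qed.

Let B_near r : r \in B -> exists2 z, z \in N r & z \in N g0.
Proof.
move=> rB; have [[fF sf] [gF tg]] := (f0P, g0P).
have : 1 < #|N r :&: N g0|.
  by apply: (common2 (BF rB) gF fF); [rewrite disjoint_sym B_far|apply: far0].
by case/(@other _ r) => z; rewrite in_setI => /andP [zr zg] _; exists z.
Qed.

Let noAB r r' : r \in A -> r' \in B -> ~~ e r r'.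
Proof.
move=> rA rB; apply/negP => rr; have [z zr zf] := A_near rA; have rF := AF rA.
have [z' zr' zg] := B_near rB; have rF' := BF rB.
have [[fF sf] [gF tg]] := (f0P, g0P).
apply: (@bridge w [:: f0; z; r; r'; z'; g0] val) => //.
  by er_steps.
by apply/allP; rewrite /= fF gF rF rF' (subsetP (NF fF) _ zf) (subsetP (NF gF) _ zg).
Qed.

(* Replacing [b] by [r] on the [i]-th path frees [b] to bridge the two sides. *)
Let exchange i q1 b c q2 r p q : i \in JJ -> w i = q1 ++ b :: c :: q2 -> r \in F ->
  p \in A -> q \in B -> p != r -> q != r ->
  e r (last (s i) q1) -> e r c -> e p b -> e q b -> False.
Proof.
move=> iJ ew rF pA qB pr qr ra rc pb qb; have [v1 v2 v3 v4] := val.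
have [pt lt] := v1 i iJ; have un := v2 i iJ.
have [[fF sf] [gF tg]] := (f0P, g0P).
pose w' := upd w i (q1 ++ r :: c :: q2).
have bi : b \in s i :: w i by rewrite ew inE mem_cat mem_head !orbT.
have un' : uniq (b :: (s i :: q1) ++ c :: q2).
  by rewrite -cat1s uniq_catCA cat1s cat_cons -ew.
have rw : r \notin s i :: w i by apply/negP => h; case/negP: (FU rF); apply: inU_path h.
have bL : b \notin L.
  apply/negP => /(proj2 (v3 i iJ b bi)); move: un'; rewrite cons_uniq => /andP [nb _].
  case/set2P => bb; case/negP: nb; first by rewrite bb mem_head.
  by rewrite bb -lt ew last_cat /= -cat_cons mem_cat mem_last orbT.
have sub z : z \in s i :: q1 ++ r :: c :: q2 -> z = r \/ (z \in s i :: w i) && (z != b).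
  move=> zq; have : z = r \/ z \in (s i :: q1) ++ c :: q2.
    move: zq; rewrite -cat_cons !mem_cat !inE => /orP [->|/or3P [/eqP|->|->]]; rewrite ?orbT; auto.
  case=> [|zz]; [by left|right]; apply/andP; split.
    by move: zz; rewrite ew -cat_cons !mem_cat !inE => /orP [->|/orP [->|->]]; rewrite ?orbT.
  by apply: contraTneq zz => ->; move: un'; rewrite cons_uniq => /andP [].
have vw' : valid (i |: JJ) w'.
  apply: valid_upd => //.
  - move: pt; rewrite ew !cat_path /= => /andP [-> /and3P [_ _ ->]].
    by rewrite es ra rc.
  - by rewrite -lt ew !last_cat.
  - rewrite -cat_cons -[r :: _]cat1s uniq_catCA cat1s cons_uniq; apply/andP; split.
      apply/negP => h; case/negP: rw; move: h; rewrite ew -cat_cons !mem_cat !inE.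
      by case/orP => [->|/orP [->|->]]; rewrite ?orbT.
    by move: un'; rewrite cons_uniq => /andP [].
  - move=> z /sub [->|/andP [/(v3 i iJ) //]]; split; [exact: FD|by move/negPf: (FL rF) => ->].
  - move=> j z jJ ji zj /sub [zr|/andP [zi _]]; last exact: v4 jJ iJ _ ji zj zi.
    by case/negP: (FU rF); rewrite -zr; apply: inU_path zj.
have iJE : i |: JJ = JJ by apply/setUidPr; rewrite sub1set.
rewrite iJE in vw'.
have sub' : used JJ w' \subset [set r] :|: (U :\: [set b]).
  apply: used_upd => //.
    by rewrite sub1set in_setD bL inE.
  move=> z /sub [->|/andP [zi zb]]; first by rewrite in_setU in_set1 eqxx.
  by rewrite in_setU in_setD !in_set1 zb (inU_path iJ zi) orbT.
have bU : b \in U by apply: inU_path bi.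
have cU : #|used JJ w'| <= #|U|.
  have := card_upd _ sub'; rewrite !cards1 sub1set leq_add2r; exact.
have inF z : z \in F -> z != r -> z \in D :\: used JJ w'.
  move=> zF zr; rewrite in_setD (FD zF) andbT; apply/negP => /(subsetP sub').
  by rewrite in_setU in_set1 (negPf zr) in_setD (negPf (FU zF)) andbF.
have bD : b \in D :\: used JJ w'.
  rewrite in_setD (subsetP UD) // andbT; apply/negP => /(subsetP sub').
  rewrite in_setU in_setD !in_set1 eqxx orbF => /eqP br.
  by case/negP: (FU rF); rewrite -br.
(* The new bridge must avoid [r], which now lies on the [i]-th path; having two candidates at each
   of these choices makes this possible. *)
have [f' f'S f'r] := @other _ r (near (stU (set21 sg ta))).
have [g' g'S g'r] := @other _ r (near (stU (set22 sg ta))).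
have [f'F sf'] : f' \in F /\ e sg f' by move: f'S; rewrite [_ \in nbh _ _ _]inE => /andP [].
have [g'F tg'] : g' \in F /\ e ta g' by move: g'S; rewrite [_ \in nbh _ _ _]inE => /andP [].
have pF := AF pA; have qF := BF qB.
have [x] : exists2 x, x \in N f' :&: N p & x != r.
  by apply: other; apply: (common2 f'F pF gF); rewrite disjoint_sym; [apply: far0|apply: A_far].
rewrite in_setI => /andP [xf xp] xr.
have [y] : exists2 y, y \in N q :&: N g' & y != r.
  by apply: other; apply: (common2 qF g'F fF); [rewrite disjoint_sym; apply: B_far|apply: far0].
rewrite in_setI => /andP [yq yg] yr.
have bq : e b q by rewrite es.
apply: (@bridge w' [:: f'; x; p; b; q; y; g'] vw' cU) => //; first by er_steps.
by apply/allP; rewrite /= bD !inF //; [apply: (subsetP (NF g'F))|apply: (subsetP (NF f'F))].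
Qed.

Let exchangeN i q1 b c q2 r p q : i \in JJ -> w i = q1 ++ b :: c :: q2 -> r \in F ->
  p \in A -> q \in B -> p != r -> q != r ->
  e r (last (s i) q1) + e r c + e p b + e q b <= 3.
Proof.
move=> iJ ew rF pA qB pr qr; have := exchange iJ ew rF pA qB pr qr.
case: (e r _) => //; case: (e r c) => //; case: (e p b) => //; case: (e q b) => //.
by move=> /(_ isT isT isT isT).
Qed.

(** With five or more vertices the bound three per vertex is enough, and with one or two vertices
    counting all incidences is. For three vertices two exchanges save two of the twelve incidences;
    for four vertices [path_window] is used as well. *)
Let four_count i p p' q q' : i \in JJ -> p \in A -> p' \in A -> p != p' -> q \in B -> q' \in B -> q != q' ->
  count (e p) (s i :: w i) + count (e p') (s i :: w i) + (count (e q) (s i :: w i) + count (e q') (s i :: w i))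
   <= (size (w i)).+1 + 7.
Proof.
move=> iJ pA pA' pp qB qB' qq.
have [[pF pF'] [qF qF']] := ((AF pA, AF pA'), (BF qB, BF qB')).
have AB x y : x \in A -> y \in B -> x != y.
  by move=> xA yB; apply: contraTneq yB => <-; rewrite in_setD xA.
have BA x y : x \in B -> y \in A -> x != y by rewrite eq_sym => xB yA; apply: AB.
have c3 f : f \in F -> _ := fun fF => path_count3 fF iJ.
have [h1 h2 h3 h4] : [/\ count (e p) (s i :: w i) <= 3, count (e p') (s i :: w i) <= 3,
  count (e q) (s i :: w i) <= 3 & count (e q') (s i :: w i) <= 3] by split; apply: c3.
have pp' : p' != p by rewrite eq_sym.
have qq' : q' != q by rewrite eq_sym.
case ew : (w i) => [|b w1].
  have cs f := count_size (e f) [:: s i].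
  by move: (cs p) (cs p') (cs q) (cs q'); clear; rewrite [size _]/=; nlia.
case: w1 ew => [|c w1] ew.
  have cs f := count_size (e f) [:: s i; b].
  by move: (cs p) (cs p') (cs q) (cs q'); clear; rewrite ![size _]/=; nlia.
case: w1 ew => [|d w1] ew.
  have := exchangeN (q1 := [::]) iJ ew pF pA' qB pp' (BA _ _ qB pA).
  have := exchangeN (q1 := [::]) iJ ew pF' pA qB' pp (BA _ _ qB' pA').
  rewrite /= !addn0; clear; bool_lia.
case: w1 ew => [|x w1] ew; last first.
  have : 3 < size (w i) by rewrite ew.
  by rewrite -ew; move: h1 h2 h3 h4; clear; nlia.
have := exchangeN (q1 := [::]) iJ ew pF pA' qB pp' (BA _ _ qB pA).
have := exchangeN (q1 := [:: b]) iJ ew pF pA' qB pp' (BA _ _ qB pA).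
have win f : f \in F -> e f (s i) + e f d <= 1.
  move=> fF; case es1 : (e f (s i)) => //; case ed : (e f d) => //.
  by have := path_window (q1 := [::]) (q2 := [:: b; c]) fF iJ ew; rewrite /= es1 ed => /(_ isT isT).
move: (win _ pF) (win _ pF') (win _ qF).
move: h1 h2 h3 h4; rewrite ew /= !addn0; clear; bool_lia.
Qed.

(** If [A] and [B] both fail, the two violating pairs have at most |F| + 2c - 6 neighbours in [F],
    counted with multiplicity, and at most |U| + 7m - 5 in [U], while their degrees sum to at least
    2K - 2. Thus K + 9 <= 7m + 2c, which contradicts 25m <= 2K because 4c <= 11m + 3. *)
Lemma optimum_ore : exists (A0 : {set T}) c, [/\ A0 \subset D, 3 * m <= #|A0|, 11 * m <= 4 * c &
  {in A0 &, forall p q, p != q -> #|A0| + c <= #|nbh e A0 p| + #|nbh e A0 q| + 2}].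
Proof.
have [c /andP [c1 c2]] : exists c, 11 * m <= 4 * c <= 11 * m + 3.
  by exists ((11 * m + 3) %/ 4); clear; lia.
have [[fF sf] [gF tg]] := (f0P, g0P).
have FsubD : F \subset D by exact: subsetDl.
have AsF : A \subset F by apply/subsetP => z; apply: AF.
have BsF : B \subset F by exact: subsetDl.
have big (X : {set T}) f : N f \subset X -> f \in F -> 3 * m <= #|X|.
  move=> /subset_leq_card + fF'; rewrite cardN; have := degF (FD fF'); have := dU_le2 fF'.
  by move: JJm K1 Lsmall; nlia.
have nA f : f \in A -> nbh e A f = nbh e F f.
  move=> fA; apply/setP => z; rewrite ![z \in nbh _ _ _]inE; case fz : (e f z); rewrite ?andbF // !andbT.
  apply/idP/idP; first exact: AF.
  move=> zF; apply/negPn/negP => zA; have zB : z \in B by rewrite in_setD zA.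
  by have := noAB fA zB; rewrite fz.
have nB f : f \in B -> nbh e B f = nbh e F f.
  move=> fB; apply/setP => z; rewrite ![z \in nbh _ _ _]inE; case fz : (e f z); rewrite ?andbF // !andbT.
  apply/idP/idP; first exact: BF.
  move=> zF; rewrite in_setD zF andbT; apply/negP => zA.
  by have := noAB zA fB; rewrite es fz.
have [oA|noA] := classic {in A &, forall p q, p != q -> #|A| + c <= #|nbh e A p| + #|nbh e A q| + 2}.
  exists A, c; split=> //; first exact: subset_trans AsF FsubD.
  apply: (big _ f0) => //; apply/subsetP => z zf; rewrite [z \in A]inE (subsetP (NF fF)) //=.
  by apply/negP => d; apply: (disj_eq d (z := z)) zf; rewrite in_setU1 eqxx.
have [oB|noB] := classic {in B &, forall p q, p != q -> #|B| + c <= #|nbh e B p| + #|nbh e B q| + 2}.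
  exists B, c; split=> //; first exact: subset_trans BsF FsubD.
  apply: (big _ g0) => //; apply/subsetP => z zf; rewrite in_setD (subsetP (NF gF)) // andbT.
  apply/negP => /A_far d; apply: (disj_eq d (z := z)) zf; by rewrite in_setU1 eqxx.
have [p [p' [pA pA' pp ltA]]] : exists p p', [/\ p \in A, p' \in A, p != p' &
    dF p + dF p' + 2 < #|A| + c].
  apply: NNPP => no; apply: noA => p p' pA pA' pp; rewrite leqNgt !nA //; apply/negP => h.
  by apply: no; exists p, p'.
have [q [q' [qB qB' qq ltB]]] : exists p p', [/\ p \in B, p' \in B, p != p' &
    dF p + dF p' + 2 < #|B| + c].
  apply: NNPP => no; apply: noB => q q' qB qB' qq; rewrite leqNgt !nB //; apply/negP => h.
  by apply: no; exists q, q'.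
have [[pF pF'] [qF qF']] := ((AF pA, AF pA'), (BF qB, BF qB')).
have cAB : #|A| + #|B| = #|F| by rewrite -(cardsID A F) (setIidPr AsF).
have : dU p + dU p' + (dU q + dU q') + 5 <= #|U| + 7 * m.
  rewrite !dUE cardU.
  have : \sum_(i in JJ) count (e p) (s i :: w i) + \sum_(i in JJ) count (e p') (s i :: w i) +
   (\sum_(i in JJ) count (e q) (s i :: w i) + \sum_(i in JJ) count (e q') (s i :: w i)) <=
    \sum_(i in JJ) (size (w i)).+1 + #|JJ| * 7.
    by rewrite -sum_nat_const -!big_split /=; apply: leq_sum => i iJ; apply: four_count.
  have := nbhLr pF; have := nbhLr pF'; have := nbhLr qF; have := nbhLr qF'.
  move: card_Lr JJm Lsmall; nlia.
have := degF (FD pF); have := degF (FD pF'); have := degF (FD qF); have := degF (FD qF').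
move: cardF; nlia.
Qed.

End Optimum.

(* A partial linkage with as many paths, then as few vertices, as possible is
   analysed in section [Optimum]. *)
Lemma linked_or_ore :
  (exists C : J -> {set T}, [/\ forall i, C i \subset D,
    forall i j, i != j -> [disjoint C i & C j],
    forall i, jn e (C i) (s i) (t i) &
    forall i, C i :&: L \subset [set s i; t i]]) \/
  exists (A0 : {set T}) c, [/\ A0 \subset D, 3 * m <= #|A0|, 11 * m <= 4 * c &
  {in A0 &, forall p q, p != q -> #|A0| + c <= #|nbh e A0 p| + #|nbh e A0 q| + 2}].
Proof.
have [[w vw]|nof] := classic (exists w, valid setT w); first by left; apply: valid_full vw.
right; pose ok (x : {set J} * (J -> seq T)) := valid x.1 x.2 /\ #|used x.1 x.2| <= 6 * m.
have ok0 : ok (set0, fun=> [::]).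
  split; first by split=> i; rewrite inE.
  apply: leq_trans (_ : #|L| <= _); last by move: Lsmall; nlia.
  by apply/subset_leq_card/subsetP => z /usedP [//|[i]]; rewrite inE.
have [|x _|x [[vx ux] mx]] := @ex_max _ ok (fun x => #|x.1|) #|J|; [by eexists; exact: ok0|exact: max_card|].
have [|y [[oy ey] my]] := @ex_min _ (fun y => ok y /\ #|y.1| = #|x.1|) (fun y => #|used y.1 y.2|).
  by exists x.
have [i0 i0J] : exists i0, i0 \notin y.1.
  apply: NNPP => no; apply: nof; exists y.2; case: oy => vy _.
  suff <- : y.1 = setT by [].
  by apply/setP => i; rewrite inE; apply/negPn/negP => ni; apply: no; exists i.
case: oy => vy uy; apply: (@optimum_ore y.1 y.2 i0 vy i0J uy).
- by move=> J' w' v' u'; rewrite ey; apply: (mx (J', w')).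
- by move=> w' v' u'; apply: (my (y.1, w')).
- by move=> w' v'; apply: nof; exists w'.
Qed.

End Dense.

Theorem dense_linked (T : finType) (e : rel T) (D : {set T}) (m K : nat) :
  symmetric e -> irreflexive e -> #|D| <= K -> 12 * m < K -> 25 * m <= 2 * K ->
  (forall v, v \in D -> K <= (2 * #|nbh e D v|).+1) -> D != set0 ->
  exists Tg : {set T}, [/\ Tg \subset D, 2 * m <= #|Tg| &
    forall L : {set T}, L \subset Tg -> #|L| <= 2 * m -> linked e Tg L].
Proof.
move=> es ei DK K1 K2 degD /set0Pn [v0 v0D].
have [all|no] := classic (forall L : {set T}, L \subset D -> #|L| <= 2 * m -> linked e D L).
  exists D; split=> //; have := degD _ v0D.
  have : #|nbh e D v0| <= #|D| by apply/subset_leq_card/subsetP => z; rewrite inE => /andP [].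
  nlia.
have [L LD [cL nL]] : exists2 L : {set T}, L \subset D & #|L| <= 2 * m /\ ~ linked e D L.
  by apply: NNPP => no'; apply: no => L LD cL; apply: NNPP => nL; apply: no'; exists L.
have [A [c [AD cA cc ore]]] : exists (A : {set T}) c, [/\ A \subset D, 3 * m <= #|A|, 11 * m <= 4 * c &
  {in A &, forall p q, p != q -> #|A| + c <= #|nbh e A p| + #|nbh e A q| + 2}].
  apply: NNPP => noA; apply: nL => J s t sL tL dst.
  (* The analysis of partial linkages requires distinct ends. A pair with equal ends is linked by
     its single vertex and put back afterwards. *)
  pose J' := {i : J | s i != t i}.
  have [] := @linked_or_ore T e D m K es ei DK K1 K2 degD L J' (s \o val) (t \o val) LD cL.
  - by move=> i; apply: sL.
  - by move=> i; apply: tL.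
  - by move=> [i]. 
  - by move=> i j ij; apply: dst.
  - case=> C [C1 C2 C3 C4].
    pose D' i := if insub i is Some i' then C i' :\: L else set0.
    apply: (@assemble _ e D L J s t D') => // [i|i j ij|i]; rewrite /D'.
    + by case: insubP => [i' _ _|_]; rewrite ?sub0set // setSD.
    + case: insubP => [i' _ vi|_]; case: insubP => [j' _ vj|_]; rewrite ?disjoints_subset ?sub0set //.
        rewrite -disjoints_subset; apply: disjointI => z; rewrite !inE => /andP [_ zi] /andP [_ zj].
        apply: (disj_eq (C2 i' j' _) zi zj); apply: contraNneq ij => ij'.
        by rewrite -vi -vj ij'.
      by rewrite setC0 subsetT.
    + case: insubP => [i' _ vi|]; last by rewrite negbK => /eqP ->; apply: jn_refl; rewrite !inE eqxx orbT.
      have := C3 i'; rewrite /= vi; apply: jn_sub; apply/subsetP => z zC.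
      rewrite in_setU in_setD zC andbT; case: (boolP (z \in L)) => //= zL.
      by rewrite -vi; apply: (subsetP (C4 i')); rewrite inE zC.
  - by move=> h; case: noA.
exists A; split=> // [|L' L'A cL' J s t sL tL dst]; first by nlia.
exact: (ore_linked es ei cA cc ore L'A cL' sL tL dst).
Qed.

(** * Massed graphs are linked *)

Section Rho.
Variable T : finType.
Implicit Types (e : rel T) (V W X N S : {set T}).

(** Each edge occurs in both orientations. With W = V \ X the edges inside the root set carry no
    weight, so they can be added freely. *)
Definition touch e V W : {set T * T} :=
  [set p | [&& p.1 \in V, p.2 \in V, e p.1 p.2 & (p.1 \in W) || (p.2 \in W)]].
Definition rho e V W := #|touch e V W|.
Definition nb e V W := [set z in V :\: W | [exists w in W, e w z]].

Lemma nbP e V W z : reflect [/\ z \in V, z \notin W & exists2 w, w \in W & e w z] (z \in nb e V W).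
Proof.
rewrite inE in_setD; apply: (iffP andP) => [[/andP [zW zV] /existsP [w /andP [wW wz]]]|[zV zW [w wW wz]]].
  by split=> //; exists w.
by rewrite zW zV; split=> //; apply/existsP; exists w; rewrite wW.
Qed.

Lemma touchP e V W x y : reflect [/\ x \in V, y \in V, e x y & x \in W \/ y \in W] ((x, y) \in touch e V W).
Proof. by rewrite inE /=; apply: (iffP and4P) => -[h1 h2 h3 /orP h4]; split. Qed.

Lemma rho_le e V W : symmetric e -> rho e V W <= #|W| * #|W| + 2 * #|W| * #|nb e V W|.
Proof.
move=> es; have sub : touch e V W \subset setX W W :|: (setX W (nb e V W) :|: setX (nb e V W) W).
  apply/subsetP => -[x y] /touchP [xV yV xy h]; rewrite !in_setU !in_setX.
  case xW : (x \in W); case yW : (y \in W) => //=; rewrite ?andbF ?andbT ?orbF ?orFb.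
  - by apply/nbP; rewrite yW; split=> //; exists x.
  - by apply/nbP; rewrite xW; split=> //; exists y; rewrite // es.
  - by rewrite xW yW in h; case: h.
apply: leq_trans (subset_leq_card sub) _; apply: leq_trans (cardU_le _ _) _.
rewrite cardsX -mulnA mul2n -addnn leq_add2l; apply: leq_trans (cardU_le _ _) _.
by rewrite !cardsX [#|nb e V W| * _]mulnC.
Qed.

Lemma local_eq e V V' W : symmetric e -> V' \subset V -> W \subset V' -> nb e V W \subset V' ->
  nb e V' W = nb e V W /\ rho e V' W = rho e V W.
Proof.
move=> es V'V WV' nbV'; split.
  apply/setP => z; apply/nbP/nbP => -[zV zW [w wW wz]]; split=> //; try by exists w.
    exact: (subsetP V'V).
  by apply: (subsetP nbV'); apply/nbP; split=> //; exists w.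
apply: eq_card => -[x y]; apply/touchP/touchP => -[xV yV xy h]; split=> //; try exact: (subsetP V'V).
  case xW : (x \in W); first exact: (subsetP WV').
  case: h => [|yW]; first by rewrite xW.
  by apply: (subsetP nbV'); apply/nbP; rewrite xW; split=> //; exists y; rewrite // es.
case yW : (y \in W); first exact: (subsetP WV').
case: h => [xW|]; last by rewrite yW.
by apply: (subsetP nbV'); apply/nbP; rewrite yW; split=> //; exists x.
Qed.

Lemma nb_sub e V W : nb e V W \subset V.
Proof. by apply/subsetP => z /nbP []. Qed.

Variables (m K : nat).
Hypotheses (m0 : 0 < m) (K1 : 12 * m < K).

(* Ordered pairs are counted.  The slack 2m^2 pays for the edges that a bipartite
   graph may have inside a set of 2m roots. *)
Definition heavy e V W := m <= #|W| /\ K * #|W| < rho e V W + (2 * m * m + 2).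
(** A variant of the massed pairs of Thomas and Wollan: the part outside the roots is heavy, and
    fewer than |X| vertices never cut off a heavy set. *)
Definition massed e V X := [/\ X \subset V, #|X| <= 2 * m, heavy e V (V :\: X) &
  forall W, W \subset V :\: X -> heavy e V W -> #|X| <= #|nb e V W|].

(** A set of at most 2m vertices with so small a boundary touches at most 6m|W| pairs. As m <= |W|,
    the slack adds at most 2m|W| + 2, and the total stays below K|W|. *)
Lemma heavy_big e V W : symmetric e -> heavy e V W -> #|nb e V W| <= 2 * m -> 2 * m < #|W|.
Proof.
move=> es [mW KW] nbW; rewrite ltnNge; apply/negP => W2.
have := rho_le V W es; have : 2 * #|W| * #|nb e V W| <= 2 * #|W| * (2 * m) by rewrite leq_mul2l nbW orbT.
have : #|W| * #|W| <= #|W| * (2 * m) by rewrite leq_mul2l W2 orbT.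
have : #|W| * (12 * m + 1) <= K * #|W| by rewrite mulnC leq_mul2r; apply/orP; right; nlia.
have : m * m <= #|W| * m by rewrite leq_mul2r mW orbT.
have : m <= m * m by rewrite leq_pmulr.
move: KW m0; rewrite mulnDr !mulnA !(mulnC _ 12) !(mulnC _ 2) -!mulnA; clear; nlia.
Qed.

(** Sets with fewer than [m] vertices are never heavy by definition; for them the first bound
    follows from [rho_le], since they touch at most 5m|W| pairs. *)
Lemma light e V W : symmetric e -> ~ heavy e V W -> #|nb e V W| <= 2 * m ->
  rho e V W <= K * #|W| /\ (m <= #|W| -> rho e V W + (2 * m * m + 2) <= K * #|W|).
Proof.
move=> es nh nbW; have [mW|mW] := leqP m #|W|.
  have : rho e V W + (2 * m * m + 2) <= K * #|W| by rewrite leqNgt; apply/negP => h; apply: nh.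
  by split=> //; apply: leq_trans _ H; rewrite leq_addr.
split=> [|]; last by nlia.
have := rho_le V W es; have : 2 * #|W| * #|nb e V W| <= 2 * #|W| * (2 * m) by rewrite leq_mul2l nbW orbT.
have : #|W| * #|W| <= #|W| * m by rewrite leq_mul2l (ltnW mW) orbT.
have : #|W| * (12 * m) <= K * #|W| by rewrite mulnC leq_mul2r; apply/orP; right; nlia.
rewrite !mulnA !(mulnC _ 12) !(mulnC _ 2) -!mulnA; clear; nlia.
Qed.

(** A subset of [W] has the same boundary and weight in the smaller graph as in [V], so minimality
    of the boundary of [W] is exactly the separation condition. *)
Lemma min_massed e V W : symmetric e -> W \subset V -> heavy e V W -> #|nb e V W| <= 2 * m ->
  (forall W', W' \subset W -> heavy e V W' -> #|nb e V W| <= #|nb e V W'|) ->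
  massed e (W :|: nb e V W) (nb e V W).
Proof.
move=> es WV hW cN mn; set N := nb e V W.
have dWN z : z \in W -> z \in N -> False by move=> zW /nbP []; rewrite zW.
have V'V : W :|: N \subset V by rewrite subUset WV nb_sub.
have WE : (W :|: N) :\: N = W.
  apply/setP => z; rewrite in_setD in_setU; case zN : (z \in N); last by rewrite orbF.
  by apply/esym/negP => zW; apply: dWN zW zN.
have loc W' : W' \subset W -> nb e (W :|: N) W' = nb e V W' /\ rho e (W :|: N) W' = rho e V W'.
  move=> W'W; apply: local_eq => //; first exact: subset_trans W'W (subsetUl _ _).
  apply/subsetP => z /nbP [zV zW' [w wW wz]]; rewrite in_setU; case zW : (z \in W) => //=.
  by apply/nbP; rewrite zW; split=> //; exists w; rewrite // (subsetP W'W).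
split=> //; first exact: subsetUr.
  by rewrite WE /heavy; have [_ ->] := loc W (subxx _).
move=> W'; rewrite WE => W'W; rewrite /heavy; have [-> ->] := loc W' W'W; exact: mn.
Qed.

End Rho.

(** * Contraction, completing a separator, and lifting linkages back *)

Section Surgery.
Variable T : finType.
Implicit Types (e : rel T) (C V W X N S : {set T}).

(** The type of vertices does not change: [u] inherits the neighbours of [v], and [v] is to be left
    out of the vertex set by the user. *)
Definition contract e v u : rel T :=
  [rel x y | [|| e x y, [&& x == u, y != u & e v y] | [&& y == u, x != u & e v x]]].

Definition clique e S : rel T := [rel x y | e x y || [&& x != y, x \in S & y \in S]].

Lemma clique_sym e S : symmetric e -> symmetric (clique e S).
Proof. by move=> es x y; rewrite /clique /= es eq_sym [(y \in S) && _]andbC. Qed.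

Lemma clique_irr e S : irreflexive e -> irreflexive (clique e S).
Proof. by move=> ei x; rewrite /clique /= ei eqxx. Qed.

Lemma contract_sym e v u : symmetric e -> symmetric (contract e v u).
Proof. by move=> es x y; rewrite /contract /= es [X in _ || X]orbC. Qed.

Lemma contract_irr e v u : irreflexive e -> irreflexive (contract e v u).
Proof. by move=> ei x; rewrite /contract /= ei /=; case: (x == u). Qed.

Lemma jn_homo e' e C C' (x y : T) : C \subset C' -> {in C &, forall a b, e' a b -> jn e C' a b} ->
  jn e' C x y -> jn e C' x y.
Proof.
move=> CC' ed /jn_path [p [pt <- _ pC]]; elim: p x pt pC => [|z p IH] x /=.
  by move=> _ pC; apply/jn_refl/(subsetP CC')/pC/mem_head.
case/andP=> xz pt pC; have zC : z \in C by apply: pC; rewrite !inE eqxx orbT.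
apply: jn_trans (IH z pt _); first by apply: ed => //; apply: pC; rewrite mem_head.
by move=> w wp; apply: pC; rewrite inE wp orbT.
Qed.

Lemma contract_lift e V X v u : symmetric e -> u \in V -> e v u -> v \notin X -> v \notin V ->
  linked (contract e v u) V X -> linked e (v |: V) X.
Proof.
move=> es uV vu vX vV lk J s t sX tX dst.
have [C [h1 h2 h3 h4]] := lk J s t sX tX dst.
exists (fun i => if u \in C i then v |: C i else C i); split=> [i|i j ij|i|i].
- by case: ifP => _; [apply: setUS|apply: subset_trans (h1 i) (subsetUr _ _)].
- have vC k : v \notin C k by apply: contra vV; apply: (subsetP (h1 k)).
  apply: disjointI => z; case: ifP => ui; case: ifP => uj; rewrite ?in_setU1.
  + by case: (disj_eq (h2 _ _ ij) ui uj).
  + by case/predU1P => [->|zi zj]; [rewrite (negPf (vC j))|exact: disj_eq (h2 _ _ ij) zi zj].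
  + by move=> zi /predU1P [zv|zj]; [rewrite zv (negPf (vC i)) in zi|exact: disj_eq (h2 _ _ ij) zi zj].
  + exact: disj_eq (h2 _ _ ij).
- apply: jn_homo (h3 i); first by case: ifP => _ //; apply: subsetUr.
  move=> a b aC bC /= h.
  have sC : C i \subset (if u \in C i then v |: C i else C i) by case: ifP => _ //; apply: subsetUr.
  case/or3P: h => [ab|/and3P [/eqP ea _ vb]|/and3P [/eqP eb _ va]].
  + by apply: jn_edge => //; apply: (subsetP sC).
  + rewrite ea in aC *; rewrite aC; apply: (@jn_trans _ _ _ v); apply: jn_edge; rewrite ?in_setU1 ?eqxx ?aC ?bC ?orbT //.
    by rewrite es.
  + rewrite eb in bC *; rewrite bC; apply: (@jn_trans _ _ _ v); apply: jn_edge; rewrite ?in_setU1 ?eqxx ?aC ?bC ?orbT //.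
    by rewrite es.
apply: subset_trans (h4 i); apply/subsetP => z /setIP [zC zX]; rewrite inE zX andbT.
by move: zC; case: ifP => // _; case/setU1P => // zv; rewrite zv (negPf vX) in zX.
Qed.

(** Everything between the first and the last vertex in [S] is replaced by one jump inside [S];
    before and after it only edges of [e] occur. *)
Lemma jn_clique e S C x y : symmetric e -> jn (clique e S) C x y ->
  jn e C x y \/ exists a b, [/\ a \in S, b \in S, jn e C x a & jn e C b y].
Proof.
move=> es /jn_path [p [pt lp _ pC]].
have step q z : path (clique e S) z q -> (forall w, w \in belast z q -> w \notin S) -> path e z q.
  elim: q z => [|w q IH] z //= /andP [zw pq] nS; apply/andP; split.
    case/orP: zw => // /and3P [_ zS _]; by have := nS z (mem_head _ _); rewrite zS.
  by apply: IH => // u uq; apply: nS; rewrite inE uq orbT.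
have step' q z : path (clique e S) z q -> (forall w, w \in q -> w \notin S) -> path e z q.
  elim: q z => [|w q IH] z //= /andP [zw pq] nS; apply/andP; split.
    case/orP: zw => // /and3P [_ _ wS]; by have := nS w (mem_head _ _); rewrite wS.
  by apply: IH => // u uq; apply: nS; rewrite inE uq orbT.
have [hS|/hasPn nS] := boolP (has (mem S) (x :: p)); last first.
  by left; rewrite -lp; apply: path_jn pC; apply: step' pt _ => w wp; apply: nS; rewrite inE wp orbT.
right; have [p1 [p2 [e1 l1 n1]]] := first_in hS; have [q1 [q2 [e2 l2 n2]]] := last_in hS.
exists (last x p1), (last x q1); split=> //.
  move: pt; rewrite e1 cat_path => /andP [pt _]; apply: path_jn; first exact: step.
  by move=> z zp; apply: pC; rewrite e1 -cat_cons mem_cat zp.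
move: pt lp; rewrite e2 cat_path last_cat => /andP [_ pt] <-; apply: path_jn; first exact: step'.
move=> z; rewrite inE => /predU1P [->|zp]; apply: pC; rewrite e2 -cat_cons mem_cat ?mem_last //.
by rewrite zp orbT.
Qed.

(** Each link needs at most one jump. The jumps pose a linkage problem for [S] inside [W :|: S], and
    its solution meets [V] only in the ends of the jumps. *)
Lemma replace_linked e V W S X : symmetric e -> S \subset V -> [disjoint W & V] -> X \subset V ->
  linked e (W :|: S) S -> linked (clique e S) V X -> linked e (W :|: V) X.
Proof.
move=> es SV dWV XV lkS lkX J s t sX tX dst.
have [C [h1 h2 h3 h4]] := lkX J s t sX tX dst.
pose g i := jn e (C i) (s i) (t i).
have /fin_all_exists [ab abP] i : exists ab : T * T, ~~ g i ->
   [/\ ab.1 \in S, ab.2 \in S, jn e (C i) (s i) ab.1 & jn e (C i) ab.2 (t i)].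
  have [gi|gi] := boolP (g i); first by exists (s i, s i).
  case: (jn_clique es (h3 i)) => [h|[a [b [aS bS ja jb]]]]; first by rewrite /g h in gi.
  by exists (a, b).
pose J' := {i : J | ~~ g i}.
have [||x y xy|C' [k1 k2 k3 k4]] := lkS J' (fun i => (ab (val i)).1) (fun i => (ab (val i)).2).
- by move=> i; case: (abP _ (valP i)).
- by move=> i; case: (abP _ (valP i)).
- have [_ _ xa xb] := abP _ (valP x); have [_ _ ya yb] := abP _ (valP y).
  apply: disjointI => z; have nxy : val x != val y by rewrite (inj_eq val_inj).
  move=> zx zy; apply: (disj_eq (h2 _ _ nxy) (z := z)).
    by case/set2P: zx => ->; [exact: jn_r xa|exact: jn_l xb].
  by case/set2P: zy => ->; [exact: jn_r ya|exact: jn_l yb].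
pose D i := if insub i is Some i' then C' i' else set0 : {set T}.
have DE i z : z \in D i -> exists i' : J', val i' = i /\ z \in C' i'.
  by rewrite /D; case: insubP => [i' _ vi zi|]; [exists i'|rewrite inE].
have DS i z : z \in D i -> z \in V -> z \in C i.
  case/DE => i' [<- zC'] zV; have [aS bS ja jb] := abP _ (valP i').
  have zS : z \in S.
    by have /(subsetP (k1 i')) := zC'; rewrite in_setU => /orP [zW|//]; case: (disj_eq dWV zW zV).
  have : z \in C' i' :&: S by rewrite inE zC'.
  by move/(subsetP (k4 i')); case/set2P => ->; [exact: jn_r ja|exact: jn_l jb].
exists (fun i => C i :|: D i); split=> [i|i j ij|i|i].
- rewrite subUset (subset_trans (h1 i) (subsetUr _ _)); apply/subsetP => z /DE [i' [_ /(subsetP (k1 i'))]].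
  by apply: (subsetP (setUS _ SV)).
- have CV k z : z \in C k -> z \in V by apply: (subsetP (h1 k)).
  apply: disjointI => z /setUP [zi|zi] /setUP [zj|zj].
  + exact: disj_eq (h2 _ _ ij) zi zj.
  + exact: disj_eq (h2 _ _ ij) zi (DS _ _ zj (CV _ _ zi)).
  + exact: disj_eq (h2 _ _ ij) (DS _ _ zi (CV _ _ zj)) zj.
  + have [i' [vi zi']] := DE _ _ zi; have [j' [vj zj']] := DE _ _ zj.
    by apply: disj_eq (k2 i' j' _) zi' zj'; apply: contraNneq ij => ij; rewrite -vi -vj ij.
- have [gi|gi] := boolP (g i); first by apply: jn_sub gi; apply: subsetUl.
  have [aS bS ja jb] := abP _ gi.
  apply: (jn_trans (jn_sub (subsetUl _ _) ja)); apply: jn_trans (jn_sub (subsetUl _ _) jb).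
  apply: jn_sub (subsetUr _ _) _; rewrite /D insubT; exact: (k3 (Sub i gi)).
- apply: subset_trans (h4 i); apply/subsetP => z /setIP [/setUP [zC|zD] zX].
    by rewrite inE zC.
  by rewrite inE zX andbT; apply: DS zD (subsetP XV _ zX).
Qed.

End Surgery.

Lemma fan_mono (T : finType) (e : rel T) (V V' X Y : {set T}) q Q :
  V \subset V' -> fan e V X Y q Q -> fan e V' X Y q Q.
Proof.
move=> VV' [h1 h2]; split=> // x xX; case: (h1 x xX) => a b c d; split=> //.
exact: subset_trans c VV'.
Qed.

(** * The minimal counterexample for massed pairs *)

Section Minimal.
Variables (T : finType) (m K : nat).
Hypotheses (m0 : 0 < m) (K1 : 12 * m < K) (K2 : 25 * m <= 2 * K).
Variables (e : rel T) (V X : {set T}).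
Hypotheses (es : symmetric e) (ei : irreflexive e) (mas : massed m K e V X).
Hypothesis nolink : ~ linked e V X.
(* Edges between roots that do not form a pair to be linked can be added, since a
   linking set meets [X] only in its two ends. *)
Hypothesis almost_clique : forall x, x \in X ->
  exists y0, forall y, y \in X -> y != x -> y != y0 -> e x y.
Hypothesis IHV : forall (e' : rel T) (V' X' : {set T}), symmetric e' -> irreflexive e' -> #|V'| < #|V| ->
  massed m K e' V' X' -> linked e' V' X'.
Hypothesis IHr : forall e' : rel T, symmetric e' -> irreflexive e' ->
  rho e' V (V :\: X) < rho e V (V :\: X) -> massed m K e' V X -> linked e' V X.

Let XV : X \subset V. Proof. by case: mas. Qed.
Let X2 : #|X| <= 2 * m. Proof. by case: mas. Qed.
Let M1 : heavy m K e V (V :\: X). Proof. by case: mas. Qed.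
Let M2 (W : {set T}) : W \subset V :\: X -> heavy m K e V W -> #|X| <= #|nb e V W|.
Proof. by case: mas => _ _ _ h; apply: h. Qed.

(** The rigid separations of Thomas and Wollan: [W] lies behind [S] and can do the work of a clique
    on [S]. *)
Definition rigid (W S : {set T}) := [/\ W != set0, W \subset V :\: X, [disjoint W & S], S \subset V &
  [/\ nb e V W \subset S, #|S| <= #|X| & linked e (W :|: S) S]].

Let big_rest : 2 * m < #|V :\: X|.
Proof.
apply: (heavy_big m0 K1 es M1); apply: leq_trans X2; apply: subset_leq_card.
by apply/subsetP => z /nbP [zV + _]; rewrite in_setD zV andbT negbK.
Qed.

Let touch_split (W : {set T}) : W \subset V :\: X ->
  rho e V (V :\: X) <= rho e (V :\: W) ((V :\: W) :\: X) + rho e V W.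
Proof.
move=> WVX; apply: leq_trans (cardU_le _ _); apply: subset_leq_card.
apply/subsetP => -[x y] /touchP [xV yV xy h]; rewrite in_setU.
case xW : (x \in W); first by apply/orP; right; apply/touchP; rewrite xW; split; auto.
case yW : (y \in W); first by apply/orP; right; apply/touchP; rewrite yW; split; auto.
apply/orP; left; apply/touchP; rewrite !in_setD xW yW xV yV; split=> //.
by move: h; rewrite !in_setD xV yV.
Qed.

(** If disjoint paths lead from [X] to [S], the linkage behind [S] solves the problem. If not, a
    smaller separator [N] cuts off a set [D] around [S], and [W :|: D] behind [N] is a larger rigid
    pair. *)
Let rigid_full W S : rigid W S -> #|S| = #|X| ->
  (forall W' S', rigid W' S' -> #|W'| <= #|W|) -> False.
Proof.
move=> [W0 WV dWS SV [nbS cS lk]] eS mx.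
have WV' : W \subset V by apply: subset_trans WV (subsetDl _ _).
have WX z : z \in W -> z \in X -> False by move/(subsetP WV); rewrite in_setD => /andP [/negP].
have XVW : X \subset V :\: W.
  apply/subsetP => x xX; rewrite in_setD (subsetP XV) // andbT; apply/negP => xW; exact: WX xW xX.
have SVW : S \subset V :\: W.
  apply/subsetP => x xS; rewrite in_setD (subsetP SV) // andbT; apply/negP => xW; exact: disj_eq dWS xW xS.
have QU (Y V' : {set T}) q Q : V' \subset V :\: W -> fan e V' Y S q Q ->
    forall x, x \in Y -> Q x :&: (W :|: S) \subset [set q x].
  move=> V'W [fP _] x xY; have [_ _ QV QS] := fP x xY; apply: subset_trans QS.
  apply/subsetP => z; rewrite !inE => /andP [zQ /orP [zW|zS]]; last by rewrite zQ.
  by have := subsetP V'W _ (subsetP QV _ zQ); rewrite in_setD zW.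
case: (menger_fan es XVW SVW) => [[q [Q F]]|[N [q [Q [NV ltN sX F]]]]].
  apply: nolink; apply: (compose_linked es _ lk (fan_mono (subsetDl _ _) F)).
  - by rewrite subUset WV'.
  - exact: subsetUr.
  - exact: QU F.
set D := side e (V :\: W) N S in sX F.
have DP z : z \in D -> z \in V :\: W /\ z \notin N.
  by rewrite inE in_setD => /andP [/andP [-> ->] _].
have SD z : z \in S -> z \notin N -> z \in D.
  move=> zS zN; rewrite inE in_setD zN (subsetP SVW) //=; apply/existsP; exists z.
  by rewrite in_setD zN zS connect0.
have Dstep z w : z \in D -> w \in V :\: W -> w \notin N -> e z w -> w \in D.
  rewrite inE => /andP [zVN /existsP [y /andP [yS yz]]] wV wN zw.
  have wVN : w \in (V :\: W) :\: N by rewrite in_setD wN.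
  rewrite inE wVN /=; apply/existsP; exists y; rewrite yS; apply: connect_trans yz (connect1 _).
  by rewrite /rin /= zw zVN wVN.
have SDN : S \subset D :|: N.
  apply/subsetP => z zS; rewrite in_setU; case zN : (z \in N); first by rewrite orbT.
  by rewrite SD // zN.
have [s0 s0S s0N] : exists2 s0, s0 \in S & s0 \notin N.
  by apply/subsetPn; apply/negP => /subset_leq_card; rewrite eS; move: ltN; nlia.
have DVX : D \subset V :\: X.
  apply/subsetP => z zD; have [zV _] := DP z zD; rewrite in_setD; apply/andP; split.
    by apply/negP => zX; move/setP/(_ z): sX; rewrite in_setI in_set0 zX zD.
  by move: zV; rewrite in_setD => /andP [].
have dWD : [disjoint W & D].
  by apply: disjointI => z zW /DP []; rewrite in_setD zW.
have : rigid (W :|: D) N.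
  split.
  - by apply/set0Pn; have [w wW] := set0Pn _ W0; exists w; rewrite in_setU wW.
  - by rewrite subUset WV.
  - apply: disjointI => z /setUP [zW|/DP [_ /negP //]] /(subsetP NV).
    by rewrite in_setD zW.
  - exact: subset_trans NV (subsetDl _ _).
  split; [|exact: ltnW|].
    apply/subsetP => z /nbP [zV]; rewrite in_setU negb_or => /andP [zW zD] [w wWD wz].
    apply/negPn/negP => zN; case/negP: zD.
    have zVW : z \in V :\: W by rewrite in_setD zW.
    case/setUP: wWD => [wW|wD]; last exact: Dstep wz.
    by apply: SD => //; apply: (subsetP nbS); apply/nbP; split=> //; exists w.
  have sub : D :|: N \subset (W :|: D) :|: N by rewrite -setUA subsetUr.
  apply: (compose_linked es _ lk (fan_mono sub F)).
  - by rewrite subUset -setUA subsetUl (subset_trans SDN) // setUA.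
  - exact: subsetUr.
  - apply: QU F; rewrite subUset NV andbT; apply/subsetP => z /DP [] //.
move/mx; rewrite cardsU disjoint_setI0 // cards0.
have : 0 < #|D| by apply/card_gt0P; exists s0; apply: SD.
nlia.
Qed.

(* In a largest rigid pair, either [S] is joined to [X] by disjoint paths, or
   deleting [W] and completing [S] gives a smaller massed graph. *)
Lemma no_rigid W S : ~ rigid W S.
Proof.
move=> rig0.
have [|x _|[W1 S1] [/= rig mx0]] := @ex_max _ (fun WS => rigid WS.1 WS.2) (fun WS => #|WS.1|) #|T|.
- by exists (W, S).
- exact: max_card.
have {mx0} mx W' S' : rigid W' S' -> #|W'| <= #|W1| by move=> h; apply: (mx0 (W', S')).
move: W1 S1 rig mx {W S rig0} => W S rig mx.
have [W0 WV dWS SV [nbS cS lk]] := rig.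
have [eS|ltS] : #|S| = #|X| \/ #|S| < #|X| by move: cS; nlia.
  exact: rigid_full rig eS mx.
have WV' : W \subset V by apply: subset_trans WV (subsetDl _ _).
have WX z : z \in W -> z \in X -> False by move/(subsetP WV); rewrite in_setD => /andP [/negP].
pose V' := V :\: W; pose e' := clique e S.
have V'V : V' \subset V by apply: subsetDl.
have es' : symmetric e' := clique_sym S es.
have ei' : irreflexive e' := clique_irr S ei.
have ee' : subrel e e' by move=> x y xy; rewrite /e' /clique /= xy.
have XV' : X \subset V'.
  apply/subsetP => x xX; rewrite in_setD (subsetP XV) // andbT; apply/negP => xW; exact: WX xW xX.
have SV' : S \subset V'.
  apply/subsetP => x xS; rewrite in_setD (subsetP SV) // andbT; apply/negP => xW; exact: disj_eq dWS xW xS.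
have ltV : #|V'| < #|V|.
  by rewrite cardsDS // ltn_subrL !card_gt0 W0 /=; apply/set0Pn; have [w wW] := set0Pn _ W0; exists w; apply: (subsetP WV').
have dWV' : [disjoint W & V'] by apply: disjointI => z zW; rewrite in_setD zW.
have WUV : W :|: V' = V.
  by apply/setP => z; rewrite in_setU in_setD; case zW : (z \in W) => //=; rewrite (subsetP WV').
have nbS2 : #|nb e V W| <= 2 * m.
  by apply: leq_trans (subset_leq_card nbS) _; apply: leq_trans cS X2.
have nhW : ~ heavy m K e V W.
  by move=> hW; have := leq_trans (M2 WV hW) (subset_leq_card nbS); rewrite leqNgt ltS.
have [lt1 lt2] := light m0 K1 es nhW nbS2.
have cVW : #|V :\: X| = #|V' :\: X| + #|W|.
  rewrite -(cardsID W (V :\: X)) (setIidPr WV) addnC; congr (_ + _).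
  by apply: eq_card => z; rewrite /V' !in_setD andbCA.
have rhoe' (U : {set T}) : rho e V' U <= rho e' V' U.
  by apply/subset_leq_card/subsetP => -[x y] /touchP [h1 h2 /ee' h3 h4]; apply/touchP.
(* [W] is not heavy, so deleting it costs at most K|W| pairs, and even leaves room for the slack if
   m <= |W|. In that case a remainder of fewer than [m] vertices would make [V :\: X] too light. *)
have H1 : heavy m K e' V' (V' :\: X).
  have [mV KV] := M1; have sp := touch_split WV; rewrite -/V' in sp; have re := rhoe' (V' :\: X).
  have nbX : #|nb e' V' (V' :\: X)| <= 2 * m.
    apply: leq_trans X2; apply: subset_leq_card.
    by apply/subsetP => z /nbP [zV + _]; rewrite in_setD zV andbT negbK.
  have [mW|mW] := leqP m #|W|.
    split; last by move: (lt2 mW) KV sp re; rewrite cVW mulnDr; nlia.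
    rewrite leqNgt; apply/negP => lm.
    have nh : ~ heavy m K e' V' (V' :\: X) by case; rewrite leqNgt lm.
    have [l1 _] := light m0 K1 es' nh nbX.
    move: (lt2 mW) KV sp re l1; rewrite cVW mulnDr; nlia.
  split; first by move: big_rest; rewrite cVW; nlia.
  by move: KV sp re lt1; rewrite cVW mulnDr; nlia.
have [M2'|] := classic (forall W' : {set T}, W' \subset V' :\: X -> heavy m K e' V' W' -> #|X| <= #|nb e' V' W'|).
  have ms : massed m K e' V' X by split.
  have lk' := IHV es' ei' ltV ms.
  by apply: nolink; rewrite -WUV; apply: replace_linked lk lk'.
move=> nM2.
have [|W1 [[W1V h1 n1] mn1]] := @ex_min {set T} (fun W' => [/\ W' \subset V' :\: X, heavy m K e' V' W' & #|nb e' V' W'| < #|X|]) (fun W' => #|nb e' V' W'|).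
  apply: NNPP => no; apply: nM2 => W' WV1 h1; rewrite leqNgt; apply/negP => lt; apply: no; by exists W'.
have W1V' : W1 \subset V' by apply: subset_trans W1V (subsetDl _ _).
set N := nb e' V' W1.
have W1VX : W1 \subset V :\: X by apply: subset_trans W1V (setSD _ V'V).
have nbe' z w : z \in W -> w \in V' -> e z w -> w \in S.
  move=> zW wV' zw; apply: (subsetP nbS); apply/nbP; move: wV'; rewrite in_setD => /andP [-> ->].
  by split=> //; exists z.
(* If a vertex of the clique [S] lies in [W1], all others are in [W1] or its boundary. If none does,
   the added edges contribute nothing to [W1], which would be heavy in [e] with a boundary smaller
   than [X]. *)
have SWN : S \subset W1 :|: N.
  apply/subsetP => z zS; rewrite in_setU; case zW : (z \in W1) => //=.
  have [/existsP [y /andP [yS yW]]|/existsPn no] := boolP [exists y, (y \in S) && (y \in W1)].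
    apply/nbP; rewrite zW; split=> //; first exact: (subsetP SV').
    exists y; rewrite // /e' /clique /= yS zS andbT; apply/orP; right; rewrite andbT.
    by apply: contraTneq yW => ->; rewrite zW.
  have {}no y : y \in W1 -> y \in S -> False by move=> yW yS; have := no y; rewrite yS yW.
  have nbE : nb e V W1 \subset N.
    apply/subsetP => u /nbP [uV uW [w wW wu]]; apply/nbP; split=> //; last by exists w; rewrite ?ee'.
    rewrite in_setD uV andbT; apply/negP => uWW; apply: (no w wW).
    by apply: (nbe' u) => //; [apply: (subsetP W1V')|rewrite es].
  have hV : heavy m K e V W1.
    case: h1 => h1 h2; split=> //; apply: leq_trans h2 _; rewrite leq_add2r.
    apply/subset_leq_card/subsetP => -[x y] /touchP [xV yV xy h].
    apply/touchP; split=> //; try exact: (subsetP V'V).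
    case/orP: xy => // /and3P [_ xS yS]; case: h => h; by case: (no _ h).
  have := leq_trans (M2 W1VX hV) (subset_leq_card nbE); rewrite leqNgt n1 //.
have W10 : W1 != set0.
  by apply/eqP => w0; case: h1; rewrite w0 cards0 => + _; move: m0; nlia.
have n12 : #|N| <= 2 * m by apply: leq_trans (ltnW n1) X2.
have mW1 : massed m K e' (W1 :|: N) N.
  apply: min_massed => // W' W'W hW'; rewrite leqNgt; apply/negP => lt.
  have h : [/\ W' \subset V' :\: X, heavy m K e' V' W' & #|nb e' V' W'| < #|X|].
    by split=> //; [exact: subset_trans W'W W1V|exact: ltn_trans lt n1].
  by have := leq_trans lt (mn1 W' h); rewrite ltnn.
have WNV : W1 :|: N \subset V' by rewrite subUset W1V' nb_sub.
have lk1 : linked e' (W1 :|: N) N.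
  by apply: IHV mW1 => //; apply: leq_ltn_trans ltV; apply: subset_leq_card.
have : rigid (W :|: W1) N.
  split.
  - by apply/set0Pn; have [w wW] := set0Pn _ W0; exists w; rewrite in_setU wW.
  - by rewrite subUset WV.
  - apply: disjointI => z /setUP [zW|zW] zN; last by move: zN => /nbP []; rewrite zW.
    by have := subsetP (nb_sub _ _ _) _ zN; rewrite in_setD zW.
  - exact: subset_trans (nb_sub _ _ _) V'V.
  split; [|exact: ltnW|].
    apply/subsetP => z /nbP [zV]; rewrite in_setU negb_or => /andP [zW zW1] [w wWW wz].
    have zV' : z \in V' by rewrite in_setD zW.
    case/setUP: wWW => [wW|wW1].
      by have := subsetP SWN _ (nbe' _ _ wW zV' wz); rewrite in_setU (negPf zW1).
    by apply/nbP; split=> //; exists w; rewrite ?ee'.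
  rewrite -setUA; apply: (replace_linked es SWN _ (subsetUr _ _) lk lk1).
  apply: disjointI => z zW /(subsetP WNV); by rewrite in_setD zW.
move/mx; rewrite cardsU disjoint_setI0 ?cards0.
  have : 0 < #|W1| by rewrite card_gt0.
  nlia.
by apply: disjointI => z zW /(subsetP W1V'); rewrite in_setD zW.
Qed.

Let IHmin (e' : rel T) (V' W : {set T}) : symmetric e' -> irreflexive e' -> V' \subset V -> W \subset V' :\: X ->
  heavy m K e' V' W -> #|nb e' V' W| <= #|X| ->
  (forall W' : {set T}, W' \subset W -> heavy m K e' V' W' -> #|nb e' V' W| <= #|nb e' V' W'|) ->
  #|W :|: nb e' V' W| < #|V| -> linked e' (W :|: nb e' V' W) (nb e' V' W).
Proof.
move=> es' ei' V'V WV hW cN mn lt; apply: IHV => //; apply: min_massed => //.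
  exact: subset_trans WV (subsetDl _ _).
exact: leq_trans cN X2.
Qed.

Let heavy0 (e' : rel T) (V' W : {set T}) : heavy m K e' V' W -> W != set0.
Proof. by move=> h; apply/eqP => w0; case: h; rewrite w0 cards0 => + _; move: m0; nlia. Qed.

Let VX_V : V :\: X \subset V. Proof. exact: subsetDl. Qed.

(** If [W] and its boundary did not fill [V], they would form a smaller massed graph, linked by
    induction, and so a rigid pair. Hence they contain [X], and [X] is disjoint from [W]. *)
Lemma tight_spans (W : {set T}) : W \subset V :\: X -> heavy m K e V W -> #|nb e V W| = #|X| ->
  nb e V W = X.
Proof.
move=> WV hW cN; have WV' := subset_trans WV VX_V.
have nbV := nb_sub e V W.
have lt : V \subset W :|: nb e V W.
  apply: contraT => nsub; case: (@no_rigid W (nb e V W)); split=> //.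
  - exact: heavy0 hW.
  - by apply: disjointI => z zW /nbP []; rewrite zW.
  split=> //; first by rewrite cN.
  apply: IHmin => //; first by rewrite cN.
    by move=> W' W'W hW'; rewrite cN; apply: M2 hW'; apply: subset_trans WV.
  apply: proper_card; apply/properP; split; first by rewrite subUset WV'.
  by have [z zV zn] := subsetPn nsub; exists z.
apply/esym/eqP; rewrite eqEcard cN leqnn andbT; apply/subsetP => x xX.
have := subsetP lt _ (subsetP XV _ xX); rewrite in_setU => /orP [xW|//].
by have := subsetP WV _ xW; rewrite in_setD xX.
Qed.

(** Otherwise one edge, worth two ordered pairs, could be deleted. A boundary falling below |X| by
    this would have been [X] itself by [tight_spans], but the deleted edge has no end in [X]. *)
Let sparse : (exists x y, [/\ x \in V :\: X, y \in V :\: X & e x y]) ->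
  rho e V (V :\: X) + (2 * m * m + 2) <= K * #|V :\: X| + 2.
Proof.
case=> a [b [aV bV ab]]; rewrite leqNgt; apply/negP => lt.
pose e' := [rel x y | e x y && ~~ ((x == a) && (y == b) || (x == b) && (y == a))].
have ee' : subrel e' e by move=> x y /andP [].
have es' : symmetric e'.
  by move=> x y; rewrite /e' /= es; congr (_ && ~~ _); rewrite orbC [X in X || _]andbC [X in _ || X]andbC.
have ei' : irreflexive e' by move=> x; rewrite /e' /= ei.
have rle W : rho e' V W <= rho e V W.
  by apply/subset_leq_card/subsetP => -[x y] /touchP [h1 h2 /ee' h3 h4]; apply/touchP.
have aV' := subsetP VX_V _ aV; have bV' := subsetP VX_V _ bV.
have ab' : a != b by apply: contraTneq ab => ->; rewrite ei.
have rlt : rho e V (V :\: X) = rho e' V (V :\: X) + 2.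
  have <- : #|[set (a, b); (b, a)]| = 2 by rewrite cards2; case: eqP => // -[eab]; rewrite eab eqxx in ab'.
  rewrite /rho -(cardsID [set (a, b); (b, a)] (touch e V (V :\: X))) addnC; congr (_ + _).
    apply: eq_card => -[x y]; rewrite in_setD !inE /= !xpair_eqE.
    by case: (e x y); rewrite ?andbF ?andbT //=; case: (_ || _); rewrite ?andbF.
  congr #|pred_of_set _|; apply/setIidPr; rewrite subUset !sub1set; apply/andP; split; apply/touchP; split; auto.
  by rewrite es.
have ms : massed m K e' V X.
  split=> //; first by case: M1 => h1 h2; split=> //; move: lt; rewrite rlt; nlia.
  move=> W WV [h1 h2]; have hW : heavy m K e V W.
    by split=> //; apply: leq_trans h2 _; rewrite leq_add2r.
  have e'P w z : e w z -> e' w z \/ (w = a /\ z = b) \/ (w = b /\ z = a).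
    move=> wz; rewrite /e' /= wz /=; case: (w =P a) => wa; case: (z =P b) => zb;
    case: (w =P b) => wb; case: (z =P a) => za; first [by left | by right; auto].
  rewrite leqNgt; apply/negP => ltN.
  have le1 : #|nb e V W| <= #|nb e' V W| + 1.
    pose c := if a \in W then b else a.
    apply: leq_trans (_ : #|c |: nb e' V W| <= _); last by rewrite cardsU1; case: (_ \notin _); nlia.
    apply/subset_leq_card/subsetP => z /nbP [zV zW [w wW wz]]; rewrite in_setU1.
    have [h|[[wa zb]|[wb za]]] := e'P _ _ wz.
    - by apply/orP; right; apply/nbP; split=> //; exists w.
    - by rewrite zb /c -wa wW eqxx.
    - by rewrite za /c; move: zW; rewrite za => /negPf ->; rewrite eqxx.
  have nbX : nb e V W = X.
    by apply: tight_spans => //; apply/eqP; rewrite eqn_leq (M2 WV hW) andbT; move: le1 ltN; nlia.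
  move: ltN; rewrite ltnNge => /negP; apply; rewrite -nbX; apply: subset_leq_card.
  apply/subsetP => z zn; have zX : z \in X by rewrite -nbX.
  have [zV zW [w wW wz]] := nbP _ _ _ _ zn.
  apply/nbP; split=> //; exists w => //.
  have [//|[[_ zb]|[_ za]]] := e'P _ _ wz.
    by move: bV; rewrite in_setD -zb zX.
  by move: aV; rewrite in_setD -za zX.
apply: nolink; have lk : linked e' V X by apply: IHr => //; rewrite rlt; nlia.
move=> J s t sX tX dst; have [C [h1 h2 h3 h4]] := lk J s t sX tX dst.
by exists C; split=> // i; apply: jn_mono (h3 i) => // x y _ _ /ee'.
Qed.

Let edge_inside : exists x y, [/\ x \in V :\: X, y \in V :\: X & e x y].
Proof.
apply: NNPP => no; have [mV KV] := M1.
have : rho e V (V :\: X) <= 2 * (#|V :\: X| * #|X|).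
  apply: leq_trans (_ : #|setX (V :\: X) X :|: setX X (V :\: X)| <= _).
    apply/subset_leq_card/subsetP => -[x y] /touchP [xV yV xy h].
    rewrite in_setU !in_setX !in_setD xV yV !andbT.
    case xX : (x \in X); case yX : (y \in X) => //=.
      by move: h; rewrite !in_setD xX yX; case.
    by case: no; exists x, y; rewrite !in_setD xV yV xX yX.
  by apply: leq_trans (cardU_le _ _) _; rewrite !cardsX [#|X| * _]mulnC; nlia.
have : #|V :\: X| * #|X| <= 2 * (#|V :\: X| * m).
  by rewrite mulnCA leq_mul2l X2 orbT.
have : 12 * (#|V :\: X| * m) + #|V :\: X| <= K * #|V :\: X|.
  by rewrite mulnCA addnC -mulnS mulnC leq_mul2r K1 orbT.
have : m * m <= #|V :\: X| * m by rewrite leq_mul2r mV orbT.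
move: KV big_rest m0; rewrite -!mulnA; clear; nlia.
Qed.

Let rho_small : rho e V (V :\: X) + (2 * m * m + 2) <= K * #|V :\: X| + 2.
Proof. exact: sparse edge_inside. Qed.

(** The degrees outside [X] sum to at most [rho], and the slack 2m^2 keeps this strictly below K|V \
    X|. *)
Let low_degree : exists2 v, v \in V :\: X & #|nbh e V v| < K.
Proof.
apply: NNPP => no; have big v : v \in V :\: X -> K <= #|nbh e V v|.
  by move=> vV; rewrite leqNgt; apply/negP => lt; apply: no; exists v.
have : \sum_(v in V :\: X) K <= \sum_(v in V :\: X) #|nbh e V v| by apply: leq_sum.
rewrite sum_nat_const.
have : \sum_(v in V :\: X) #|nbh e V v| <= rho e V (V :\: X).
  under eq_bigr => v _ do rewrite -sum1_card.
  rewrite pair_big_dep /= sum1dep_card; apply/subset_leq_card/subsetP => -[x y].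
  rewrite inE /= => /andP [xV]; rewrite inE => /andP [yV xy].
  by apply/touchP; split; auto; apply: (subsetP VX_V).
have : 0 < m * m by rewrite muln_gt0 m0.
move: rho_small; rewrite -!mulnA; nlia.
Qed.

Section Contraction.
Variable v : T.
Hypothesis vVX : v \in V :\: X.
Let V' := V :\ v.

Let vV : v \in V. Proof. exact: (subsetP VX_V). Qed.
Let vX : v \notin X. Proof. by move: vVX; rewrite in_setD => /andP []. Qed.
Let V'V : V' \subset V. Proof. exact: subsetDl. Qed.
Let ltV' : #|V'| < #|V|. Proof. by rewrite (cardsD1 v V) vV. Qed.
Let vV' : v \notin V'. Proof. by rewrite in_setD1 eqxx. Qed.
Let XV' : X \subset V'.
Proof.
apply/subsetP => x xX; rewrite in_setD1 (subsetP XV) // andbT.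
by apply: contraNneq vX => <-.
Qed.
Let V'VX : V' :\: X \subset V :\: X. Proof. exact: setSD. Qed.
Let cV' : #|V :\: X| = #|V' :\: X|.+1.
Proof.
rewrite (cardsD1 v) vVX add1n; congr _.+1; apply: eq_card => z.
by rewrite !in_setD andbCA.
Qed.

Lemma not_isolated : exists u, u \in nbh e V v.
Proof.
apply: NNPP => no; have iso z : z \in V -> e v z -> False.
  by move=> zV vz; apply: no; exists z; rewrite inE zV.
have loc (W : {set T}) : W \subset V' -> nb e V' W = nb e V W /\ rho e V' W = rho e V W.
  move=> WV; apply: local_eq => //; apply/subsetP => z /nbP [zV zW [w wW wz]].
  rewrite in_setD1 zV andbT; apply/eqP => zv; apply: (iso w); last by rewrite es -zv.
  exact: (subsetP V'V _ (subsetP WV _ wW)).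
have ms : massed m K e V' X.
  split=> //.
    have [h1 h2] := M1; split; first by move: big_rest; rewrite cV'; nlia.
    apply: leq_ltn_trans (_ : K * #|V :\: X| < _); first by rewrite leq_mul2l cV' leqnSn orbT.
    apply: leq_trans h2 _; rewrite leq_add2r; apply/subset_leq_card/subsetP => -[x y].
    case/touchP=> xV yV xy h; apply/touchP.
    have xv : x != v by apply: contraPneq xy => -> vy; apply: iso vy.
    have yv : y != v by apply: contraPneq xy => ->; rewrite es => vx; apply: iso vx.
    rewrite !in_setD !in_set1 xv yv xV yV; split=> //.
    by move: h; rewrite !in_setD xV yV.
  move=> W WV; have [e1 e2] := loc W (subset_trans WV (subsetDl _ _)).
  by rewrite /heavy e1 e2; apply: M2; apply: subset_trans WV V'VX.
by apply: nolink; apply: linked_sub V'V (subxx X) _; apply: IHV.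
Qed.

Section Target.
Variable u : T.
Hypotheses (uV : u \in V) (vu : e v u).
Let ec := contract e v u.

Let uV' : u \in V'.
Proof. by rewrite in_setD1 uV andbT; apply: contraTneq vu => ->; rewrite ei. Qed.

Let eec : subrel e ec. Proof. by move=> x y xy; rewrite /ec /contract /= xy. Qed.

Let ecP x y : ec x y -> [\/ e x y, [/\ x = u, y != u & e v y] | [/\ y = u, x != u & e v x]].
Proof.
case/or3P => [xy|/and3P [/eqP h1 h2 h3]|/and3P [/eqP h1 h2 h3]];
by [apply: Or31|apply: Or32|apply: Or33].
Qed.

(** A pair created at [u] is traced back to a pair at [v]. As its other end lies in [W], the old
    pair still touches [W]. *)
Let rho_outside (W : {set T}) : W \subset V' -> u \notin W -> rho ec V' W <= rho e V W.
Proof.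
move=> WV uW.
pose f (p : T * T) := if e p.1 p.2 then p else if p.1 == u then (v, p.2) else (p.1, v).
have inV z : z \in V' -> z != v by rewrite in_setD1 => /andP [].
have fI : {in touch ec V' W &, injective f}.
  move=> [x y] [x' y'] /touchP [/inV xv /inV yv xy h] /touchP [/inV xv' /inV yv' xy' h'].
  rewrite /f /=; case exy : (e x y); case exy' : (e x' y') => //.
  - by case: eqP => _ -[e1 e2]; move: xv yv; rewrite ?e1 ?e2 eqxx.
  - by case: eqP => _ -[e1 e2]; move: xv' yv'; rewrite -?e1 -?e2 eqxx.
  case: (x =P u) => [->|xu]; case: (x' =P u) => [->|xu'].
  - by move=> [->].
  - by move=> [e1 _]; move: xv'; rewrite -e1 eqxx.
  - by move=> [e1 _]; move: xv; rewrite e1 eqxx.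
  - move=> [->]; case: (ecP xy) => [|[]|[-> _ _]] //; first by rewrite exy.
    by case: (ecP xy') => [|[]|[-> _ _]] //; rewrite exy'.
rewrite /rho -(card_in_imset fI); apply/subset_leq_card/subsetP => p /imsetP [[x y] /touchP [xV yV xy h] ->].
rewrite /f /=; case exy : (e x y).
  by apply/touchP; split=> //; apply: (subsetP V'V).
case: (ecP xy) => [|[xu yu vy]|[yu xu vx]]; first by rewrite exy.
  rewrite xu eqxx; apply/touchP; split=> //; first exact: (subsetP V'V).
  by right; case: h => //; rewrite xu (negPf uW).
rewrite (negPf xu); apply/touchP; rewrite es; split=> //; first exact: (subsetP V'V).
by left; case: h => //; rewrite yu (negPf uW).
Qed.

(** Take a violating set of smallest boundary. If it contains [u], then adding [v] gives a rigid
    pair. If not, its boundary in [e] is larger by at most the vertex [v], so it is [X] by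
    [tight_spans], and [v] is not in [X]. *)
Let contract_barrier (W : {set T}) : W \subset V' :\: X -> heavy m K ec V' W -> #|X| <= #|nb ec V' W|.
Proof.
move=> WV0 h0; rewrite leqNgt; apply/negP => n0.
have [|{WV0 h0 n0}W [[WV hW nW] mn]] := @ex_min {set T}
   (fun W' => [/\ W' \subset V' :\: X, heavy m K ec V' W' & #|nb ec V' W'| < #|X|]) (fun W' => #|nb ec V' W'|).
  by exists W.
have WV' : W \subset V' := subset_trans WV (subsetDl _ _).
have WVX : W \subset V :\: X := subset_trans WV V'VX.
set N := nb ec V' W in nW mn.
have NV' : N \subset V' := nb_sub _ _ _.
have nbW z w : z \in V' -> z \notin W -> w \in W -> ec w z -> z \in N.
  by move=> h1 h2 h3 h4; apply/nbP; split=> //; exists w.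
case uW : (u \in W).
  have lk : linked ec (W :|: N) N.
    apply: (IHmin (contract_sym v u es) (contract_irr v u ei) V'V WV hW (ltnW nW)).
      move=> W' W'W hW'; rewrite leqNgt; apply/negP => lt.
      have h : [/\ W' \subset V' :\: X, heavy m K ec V' W' & #|nb ec V' W'| < #|X|].
        by split=> //; [exact: subset_trans W'W WV|exact: ltn_trans lt nW].
      by have := leq_trans lt (mn W' h); rewrite ltnn.
    by apply: leq_ltn_trans ltV'; apply: subset_leq_card; rewrite subUset WV' NV'.
  apply: (@no_rigid (v |: W) N); split.
  - by apply/set0Pn; exists v; rewrite in_setU1 eqxx.
  - by rewrite subUset sub1set vVX.
  - apply: disjointI => z /setU1P [->|zW] zN; last by case/nbP: zN; rewrite zW.
    by have := subsetP NV' _ zN; rewrite (negPf vV').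
  - exact: subset_trans NV' V'V.
  split; [|exact: ltnW|].
    apply/subsetP => z /nbP [zV]; rewrite in_setU1 negb_or => /andP [zv zW] [w wW wz].
    have zV' : z \in V' by rewrite in_setD1 zv.
    case/setU1P: wW wz => [-> vz|wW wz]; last by apply: nbW wW _ => //; apply: eec.
    apply: (nbW _ u) => //; rewrite /ec /contract /= vz eqxx (_ : z != u) ?orbT //.
    by apply: contraNneq zW => ->.
  rewrite -setUA; apply: contract_lift lk => //.
  - by rewrite in_setU uW.
  - by apply: contra vV'; apply: (subsetP NV').
  - by rewrite in_setU negb_or; apply/andP; split; apply: contra vV'; [apply: (subsetP WV')|apply: (subsetP NV')].
have hV : heavy m K e V W.
  case: hW => h1 h2; split=> //; apply: leq_trans h2 _; rewrite leq_add2r.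
  by apply: rho_outside; rewrite ?uW.
have nbs z : z \in nb e V W -> z != v -> z \in N.
  case/nbP => zV zW [w wW wz] zv; apply: nbW wW _ => //; [by rewrite in_setD1 zv|exact: eec].
have le1 : #|nb e V W| <= #|N| + 1.
  apply: leq_trans (_ : #|v |: N| <= _); last by rewrite cardsU1; case: (_ \notin _); nlia.
  apply/subset_leq_card/subsetP => z zn; rewrite in_setU1; case: eqP => //= /eqP; exact: nbs.
have nbX : nb e V W = X.
  by apply: tight_spans => //; apply/eqP; rewrite eqn_leq (M2 WVX hV) andbT; move: le1 nW; nlia.
move: nW; rewrite ltnNge => /negP; apply; rewrite -nbX; apply/subset_leq_card/subsetP => z zn.
by apply: nbs => //; apply: contraNneq vX => <-; rewrite -nbX.
Qed.

(** [t0] counts the neighbours of [v] whose pair with [u] gains no weight in the contraction: those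
    adjacent to [u], and roots if [u] is a root. The contracted graph is not heavy, so at least K
    pairs are lost. By [almost_clique] at most one vertex counted is not adjacent to [u], and [v]
    makes up for it. *)
Lemma contract_degree : exists t0, [/\ K <= 2 * t0 + 1, t0 < #|nbh e V v| &
  t0 <= #|nbh e (v |: nbh e V v) u|].
Proof.
have nlk : ~ linked ec V' X.
  move=> lk; apply: nolink; rewrite -(setD1K vV); exact: contract_lift lk.
have nh : ~ heavy m K ec V' (V' :\: X).
  move=> h; apply: nlk; apply: (IHV (contract_sym v u es) (contract_irr v u ei) ltV').
  by split=> //; apply: contract_barrier.
have {nh} rho' : rho ec V' (V' :\: X) + (2 * m * m + 2) <= K * #|V' :\: X|.
  rewrite leqNgt; apply/negP => h; apply: nh; split=> //.
  by move: big_rest; rewrite cV'; nlia.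
pose Nv := nbh e V v; pose Tt := [set z in Nv | (z != u) && (e u z || (u \in X) && (z \in X))].
have NvP z : z \in Nv -> z \in V' /\ e v z.
  rewrite inE => /andP [zV vz]; rewrite in_setD1 zV andbT; split=> //.
  by apply: contraTneq vz => ->; rewrite ei.
have uNv : u \in Nv by rewrite inE uV.
have TNv : u |: Tt \subset Nv.
  by rewrite subUset sub1set uNv; apply/subsetP => z; rewrite inE => /andP [].
have uT : u \notin Tt by rewrite inE eqxx andbF.
pose R := Nv :\: (u |: Tt).
have cR : #|Nv| = #|Tt|.+1 + #|R|.
  by rewrite -(cardsID (u |: Tt)) (setIidPr TNv) cardsU1 uT.
pose P0 := touch e V (V :\: X) :\: (setX [set v] Nv :|: setX Nv [set v]).
have RP z : z \in R -> [/\ z \in V', e v z, z != u, ~~ e u z & ~~ ((u \in X) && (z \in X))].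
  rewrite in_setD in_setU1 negb_or => /andP [/andP [zu zT] zN]; have [zV vz] := NvP _ zN.
  by move: zT; rewrite inE zN zu /= negb_or => /andP [].
have c1 : rho e V (V :\: X) <= #|P0| + 2 * #|Nv|.
  rewrite /rho -(cardsID (setX [set v] Nv :|: setX Nv [set v])) addnC leq_add2l.
  apply: leq_trans (subset_leq_card (subsetIr _ _)) _; apply: leq_trans (cardU_le _ _) _.
  by rewrite !cardsX cards1; nlia.
have P0V x y : (x, y) \in P0 -> [/\ x \in V', y \in V', e x y & x \in V' :\: X \/ y \in V' :\: X].
  rewrite [_ \in P0]in_setD in_setU !in_setX ![(_ \in [set v])]in_set1 negb_or => /andP [/andP [n1 n2] /touchP [xV yV xy h]].
  have xv : x != v by apply: contraNneq n1 => xv; rewrite xv eqxx inE yV -xv xy.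
  have yv : y != v by apply: contraNneq n2 => yv; rewrite yv eqxx inE xV -yv es xy.
  rewrite !in_setD !in_set1 xv yv xV yV; split=> //.
  by move: h; rewrite !in_setD xV yV.
have c2 : #|P0| + 2 * #|R| <= rho ec V' (V' :\: X).
  have -> : 2 * #|R| = #|setX [set u] R :|: setX R [set u]|.
    rewrite cardsU disjoint_setI0 ?cards0 ?cardsX ?cards1; first by nlia.
    apply: disjointI => -[x y]; rewrite !in_setX !in_set1 => /andP [/eqP -> _] /andP [/RP [_ _]].
    by rewrite eqxx.
  have <- : #|P0 :|: (setX [set u] R :|: setX R [set u])| = #|P0| + #|setX [set u] R :|: setX R [set u]|.
    rewrite cardsU disjoint_setI0 ?cards0 ?subn0 //.
    apply: disjointI => -[x y] /P0V [_ _ xy _]; rewrite in_setU !in_setX !in_set1.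
    case/orP => /andP [].
      by move=> /eqP xu /RP [_ _ _ + _]; rewrite -xu xy.
    by move=> /RP [_ _ _ + _] /eqP yu; rewrite -yu es xy.
  have inR z : z \in R -> u \in V' :\: X \/ z \in V' :\: X.
    by case/RP => zV _ _ _; rewrite ![_ \in V' :\: X]in_setD zV uV' !andbT; case: (u \in X); case: (z \in X); auto.
  apply/subset_leq_card/subsetP => -[x y]; rewrite in_setU => /orP [/P0V [h1 h2 h3 h4]|].
    by apply/touchP; split=> //; apply: eec.
  rewrite in_setU !in_setX !in_set1; case/orP => /andP [].
    move=> /eqP -> yR; have [yV vy yu _ _] := RP _ yR; apply/touchP; split=> //; last exact: inR.
    by rewrite /ec /contract /= eqxx yu vy orbT.
  move=> xR /eqP ->; have [xV vx xu _ _] := RP _ xR; apply/touchP; split=> //; last by case: (inR _ xR); auto.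
  by rewrite /ec /contract /= eqxx xu vx !orbT.
exists #|Tt|; split.
- by case: M1 => _; move: c1 c2 rho' cR; rewrite cV' mulnS -/Nv; nlia.
- by rewrite -/Nv cR; nlia.
have [y0 y0P] : exists y0, forall z, z \in Tt -> ~~ e u z -> z = y0.
  case uX : (u \in X); last first.
    by exists u => z; rewrite inE uX /= orbF => /and3P [_ _ ->].
  have [y0 h] := almost_clique uX; exists y0 => z; rewrite inE uX /= => /and3P [_ zu /orP [->//|zX]] nz.
  by apply/eqP; apply: contraNT nz => zy; apply: h.
have : #|Tt :&: [set z | e u z]| + 1 <= #|nbh e (v |: Nv) u|.
  rewrite addn1 -[(_).+1]/(1 + _) -(_ : #|v |: (Tt :&: [set z | e u z])| = 1 + #|Tt :&: [set z | e u z]|).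
    apply/subset_leq_card/subsetP => z; rewrite in_setU1 in_setI [z \in [set _ | _]]inE => /predU1P [->|/andP [zT uz]].
      by rewrite inE in_setU1 eqxx es vu.
    by rewrite inE uz andbT in_setU1 (subsetP TNv) ?orbT // in_setU1 zT orbT.
  rewrite cardsU1 in_setI; case: (boolP (v \in Tt)) => // vT.
  have vN : v \in Nv by apply: (subsetP TNv); rewrite in_setU1 vT orbT.
  by case: (NvP _ vN); rewrite (negPf vV').
have : #|Tt :\: [set z | e u z]| <= 1.
  rewrite -(cards1 y0); apply/subset_leq_card/subsetP => z; rewrite in_setD in_set1.
  by rewrite inE => /andP [nz zT]; apply/eqP/y0P.
by rewrite -(cardsID [set z | e u z] Tt) -/Nv; nlia.
Qed.

End Target.
End Contraction.

Theorem minimal_absurd : False.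
Proof.
have [v vVX dv] := low_degree.
have vV := subsetP VX_V _ vVX.
have [u0 u0N] := not_isolated vVX.
have nP u : u \in nbh e V v -> u \in V /\ e v u by rewrite inE => /andP [].
pose D := v |: nbh e V v.
have vn : v \notin nbh e V v by rewrite inE ei andbF.
have DV : D \subset V by rewrite subUset sub1set vV; apply/subsetP => z /nP [].
have cD : #|D| <= K by rewrite cardsU1 vn.
have degD w : w \in D -> K <= (2 * #|nbh e D w|).+1.
  case/setU1P => [->|/nP [wV vw]]; last first.
    have [t0 [h1 _ h3]] := contract_degree vVX wV vw.
    by move: h1 h3; rewrite -/D; nlia.
  have [u0V vu0] := nP _ u0N; have [t0 [h1 h2 _]] := contract_degree vVX u0V vu0.
  have : #|nbh e V v| <= #|nbh e D v|.
    by apply/subset_leq_card/subsetP => z zN; rewrite inE in_setU1 zN orbT; case: (nP _ zN).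
  move: h1 h2; nlia.
have D0 : D != set0 by apply/set0Pn; exists v; rewrite in_setU1 eqxx.
have [Tg [TD cT lkT]] := dense_linked es ei cD K1 K2 degD D0.
have TV := subset_trans TD DV.
have comp (Y V1 : {set T}) q Q : Tg \subset V1 -> #|Y| <= 2 * m -> fan e V1 Y Tg q Q -> linked e V1 Y.
  move=> TV1 cY [fP fd].
  have sT : q @: Y \subset Tg by apply/subsetP => z /imsetP [x xY ->]; case: (fP x xY).
  have lk : linked e Tg (q @: Y) by apply: lkT sT _; apply: leq_trans (leq_imset_card _ _) cY.
  apply: (@compose_linked _ e V1 Y (q @: Y) Tg q Q es TV1 lk _ sT).
    split=> // x xY; have [h1 h2 h3 h4] := fP x xY; split=> //; first exact: imset_f.
    by apply: subset_trans h4; apply: setIS.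
  by move=> x xY; case: (fP x xY).
case: (menger_fan es XV TV) => [[q [Q F]]|[N [q [Q [NV ltN sX F]]]]].
  by apply: nolink; apply: comp F.
set S := side e V N Tg in sX F.
have SP z : z \in S -> z \in V /\ z \notin N.
  by rewrite inE in_setD => /andP [/andP [-> ->] _].
have ST z : z \in Tg -> z \notin N -> z \in S.
  move=> zT zN; rewrite inE in_setD zN (subsetP TV) //=; apply/existsP; exists z.
  by rewrite in_setD zN zT connect0.
have [s0 s0S s0N] : exists2 s0, s0 \in Tg & s0 \notin N.
  by apply/subsetPn; apply/negP => /subset_leq_card; move: ltN cT X2; nlia.
apply: (@no_rigid S N); split=> //.
- by apply/set0Pn; exists s0; apply: ST.
- apply/subsetP => z zS; have [zV _] := SP _ zS; rewrite in_setD zV andbT; apply/negP => zX.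
  by move/setP/(_ z): sX; rewrite in_setI in_set0 zX zS.
- by apply: disjointI => z /SP [_ /negP].
split; [|exact: ltnW|].
  apply/subsetP => z /nbP [zV zS [w wS wz]]; apply/negPn/negP => zN; case/negP: zS.
  move: wS; rewrite inE => /andP [wVN /existsP [y /andP [yT yw]]].
  have zVN : z \in V :\: N by rewrite in_setD zN.
  rewrite inE zVN /=; apply/existsP; exists y; rewrite yT; apply: connect_trans yw (connect1 _).
  by rewrite /rin /= wz zVN wVN.
apply: comp F; last by apply: leq_trans (ltnW ltN) X2.
by apply/subsetP => z zT; rewrite in_setU; case zN : (z \in N); rewrite ?orbT // ST // zN.
Qed.

End Minimal.

Theorem massed_linked (T : finType) (m K : nat) : 0 < m -> 12 * m < K -> 25 * m <= 2 * K ->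
  forall (e : rel T) (V X : {set T}), symmetric e -> irreflexive e ->
  massed m K e V X -> linked e V X.
Proof.
move=> m0 K1 K2 e V X.
(* Lexicographic induction on the number of vertices and the weight, which is at most
   [#|{: T * T}|]. *)
have [n le_n] := ubnP (#|V| * #|{: T * T}|.+1 + rho e V (V :\: X)).
elim: n e V X le_n => // n IH e V X le_n es ei ms J s t sX tX dst; apply: NNPP => fail.
pose inst x y := [exists i, (x == s i) && (y == t i) || (x == t i) && (y == s i)].
have instS x y : inst x y = inst y x.
  by apply: eq_existsb => i; rewrite orbC [X in X || _]andbC [X in _ || X]andbC.
pose e' := [rel x y | e x y || [&& x != y, x \in X, y \in X & ~~ inst x y]].
have es' : symmetric e'.
  by move=> x y; rewrite /e' /= es eq_sym instS; case: (x \in X); case: (y \in X).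
have ei' : irreflexive e' by move=> x; rewrite /e' /= ei eqxx.
have eE (W : {set T}) x y : W \subset V :\: X -> x \in W \/ y \in W -> e' x y = e x y.
  move=> WV h; rewrite /e' /=; have WX z : z \in W -> z \in X = false.
    by move/(subsetP WV); rewrite in_setD => /andP [/negPf].
  by case: h => /WX ->; rewrite ?andbF ?orbF.
have rhoE (W : {set T}) : W \subset V :\: X -> rho e' V W = rho e V W.
  move=> WV; apply: eq_card => -[x y]; apply/touchP/touchP => -[h1 h2 h3 h4]; split=> //.
    exact: etrans (esym (eE W x y WV h4)) h3.
  exact: etrans (eE W x y WV h4) h3.
have nbE (W : {set T}) : W \subset V :\: X -> nb e' V W = nb e V W.
  move=> WV; apply/setP => z; apply/nbP/nbP => -[h1 h2 [w wW wz]]; split=> //; exists w => //.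
    exact: etrans (esym (eE W w z WV (or_introl wW))) wz.
  exact: etrans (eE W w z WV (or_introl wW)) wz.
have ms' : massed m K e' V X.
  case: ms => h1 h2 h3 h4; split=> //; first by rewrite /heavy rhoE.
  by move=> W WV; rewrite /heavy rhoE // nbE //; apply: h4.
have pw i x : x \in [set s i; t i] -> forall y, inst x y -> [set x; y] = [set s i; t i].
  move=> xi y /existsP [j h].
  have xj : x \in [set s j; t j] by rewrite !inE; case/orP: h => /andP [-> _]; rewrite ?orbT.
  have ij : i = j by apply/eqP/negPn/negP => /dst d; apply: disj_eq d xi xj.
  by rewrite ij; case/orP: h => /andP [/eqP -> /eqP ->] //; rewrite setUC.
apply: (@minimal_absurd T m K m0 K1 K2 e' V X es' ei' ms').
- move=> lk; apply: fail; have [C [h1 h2 h3 h4]] := lk J s t sX tX dst.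
  exists C; split=> // i; apply: jn_homo (h3 i) => // a b aC bC ab; apply: jn_edge => //.
  case/orP: ab => // /and4P [ab aX bX /negP []].
  have aS : a \in [set s i; t i] by apply: (subsetP (h4 i)); rewrite inE aC.
  have bS : b \in [set s i; t i] by apply: (subsetP (h4 i)); rewrite inE bC.
  apply/existsP; exists i; move: ab.
  case/set2P: aS => ->; case/set2P: bS => ->; rewrite ?eqxx ?orbT //.
- move=> x xX; have [/existsP [i xi]|/existsPn no] := boolP [exists i, x \in [set s i; t i]]; last first.
    exists x => y yX yx _; rewrite /e' /= eq_sym yx xX yX /=; apply/orP; right.
    apply/existsPn => i; have := no i; rewrite !inE negb_or => /andP [/negPf -> /negPf ->] //.
  exists (if x == s i then t i else s i) => y yX yx yo; rewrite /e' /= eq_sym yx xX yX /=.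
  apply/orP; right; apply/negP => /(pw i x xi) E.
  have : y \in [set s i; t i] by rewrite -E !inE eqxx orbT.
  move: xi yo yx; rewrite !inE; case: eqP => [-> _|_ /= /eqP ->].
    by move=> /negPf -> /negPf ->.
  by move=> /negPf -> /negPf ->.
- move=> e2 V2 X2 es2 ei2 ltV ms2; apply: IH ms2 => //; move: le_n; rewrite ltnS; apply: leq_trans.
  apply: leq_trans (leq_addr _ _).
  apply: leq_trans (_ : #|V2|.+1 * #|{: T * T}|.+1 <= _); last by rewrite leq_mul2r ltV orbT.
  by rewrite mulSn addnC ltn_add2r ltnS max_card.
- move=> e2 es2 ei2; rewrite rhoE // => lt ms2; apply: IH ms2 => //.
  by move: le_n; rewrite ltnS; apply: leq_trans; rewrite ltn_add2l.
Qed.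

(** * A dense linked bipartite subgraph *)

Section Bipartite.
Variables (T : finType) (e : rel T).
Hypotheses (es : symmetric e) (ei : irreflexive e).
Implicit Types (c : T -> bool) (V W X : {set T}).

Definition cut c : rel T := [rel x y | e x y && (c x != c y)].

Lemma cut_sym c : symmetric (cut c).
Proof. by move=> x y; rewrite /cut /= es eq_sym. Qed.

Lemma cut_irr c : irreflexive (cut c).
Proof. by move=> x; rewrite /cut /= ei. Qed.

Lemma rho_del (e0 : rel T) V v : symmetric e0 -> irreflexive e0 -> v \in V ->
  rho e0 V V = rho e0 (V :\ v) (V :\ v) + 2 * #|nbh e0 V v|.
Proof.
move=> s0 i0 vV; pose S := setX [set v] (nbh e0 V v) :|: setX (nbh e0 V v) [set v].
have cS : #|S| = 2 * #|nbh e0 V v|.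
  rewrite cardsU disjoint_setI0 ?cards0 ?cardsX ?cards1; first by nlia.
  apply: disjointI => -[x y]; rewrite !in_setX !in_set1 => /andP [/eqP -> _] /andP [].
  by rewrite inE i0 andbF.
have SE x y : ((x, y) \in S) = [&& x \in V, y \in V, e0 x y & (x == v) || (y == v)].
  rewrite in_setU !in_setX !in_set1 ![_ \in nbh _ _ _]inE.
  case: (x =P v) => [->|_]; case: (y =P v) => [->|_]; rewrite ?vV ?i0 ?andbF ?andbT ?orbF //=.
  by rewrite s0.
rewrite /rho -cS -(cardsID S (touch e0 V V)) addnC; congr (_ + _).
  apply: eq_card => -[x y]; rewrite in_setD SE; apply/andP/touchP => [[n1 /touchP [xV yV xy _]]|].
    move: n1; rewrite xV yV xy /= negb_or => /andP [xv yv].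
    by rewrite !in_setD1 xv yv xV yV; split; auto.
  rewrite !in_setD1 => -[/andP [xv xV] /andP [yv yV] xy _]; split.
    by rewrite (negPf xv) (negPf yv) !andbF.
  by apply/touchP; split; auto.
apply: eq_card => -[x y]; rewrite in_setI SE; apply/andP/and4P => [[_ /and4P]//|[h1 h2 h3 h4]].
by split; [apply/touchP; split; auto|rewrite h1 h2 h3].
Qed.

Lemma max_cut : exists c, forall v, #|nbh e setT v| <= 2 * #|nbh (cut c) setT v|.
Proof.
have [||c [_ mx]] := @ex_max (T -> bool) (fun _ => True) (fun c => rho (cut c) setT setT) #|{: T * T}|.
- by exists (fun=> true).
- by move=> c _; apply: max_card.
exists c => v; pose c' x := if x == v then ~~ c v else c x.
have := mx c' I.
rewrite (rho_del (cut_sym c) (cut_irr c) (in_setT v)) (rho_del (cut_sym c') (cut_irr c') (in_setT v)).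
have -> : rho (cut c') (setT :\ v) (setT :\ v) = rho (cut c) (setT :\ v) (setT :\ v).
  have E x y : x \in setT :\ v -> y \in setT :\ v -> cut c' x y = cut c x y.
    by rewrite !in_setD1 /cut /= /c' => /andP [/negPf -> _] /andP [/negPf -> _].
  by apply: eq_card => -[x y]; apply/touchP/touchP => -[xv yv h1 h2]; split=> //; move: h1; rewrite E.
rewrite leq_add2l leq_mul2l /= => le.
have : #|nbh e setT v| = #|nbh (cut c) setT v| + #|nbh (cut c') setT v|.
  rewrite -(cardsID (nbh (cut c) setT v)); congr (_ + _); apply: eq_card => z;
  rewrite !inE /cut /= /c' ?eqxx.
    by case: (e v z); case: (c v); case: (c z).
  case: (z =P v) => [->|_]; first by rewrite ei ?andbF.
  by case: (e v z); case: (c v); case: (c z).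
by move: le; nlia.
Qed.

(** For |X| = 2m this allows 2m^2 ordered pairs inside [X], the slack in [heavy]. *)
Lemma bipartite_rho c X : 2 * rho (cut c) X X <= #|X| * #|X|.
Proof.
pose A := X :&: [set x | c x]; pose B := X :\: [set x | c x].
have : rho (cut c) X X <= #|setX A B :|: setX B A|.
  apply/subset_leq_card/subsetP => -[x y] /touchP [xX yX /andP [_ cxy] _].
  by rewrite in_setU !in_setX !inE xX yX !andbT /=; case: (c x) cxy; case: (c y).
have := cardU_le (setX A B) (setX B A); rewrite !cardsX -(cardsID [set x | c x] X) -/A -/B.
have := (nat_AGM2 #|A| #|B|).1; rewrite -mulnn; rewrite (mulnC #|B|); nlia.
Qed.

Variables (m K : nat).
Hypotheses (m0 : 0 < m) (K1 : 12 * m < K) (K2 : 25 * m <= 2 * K).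
Hypotheses (deg : forall v, 2 * K <= #|nbh e setT v|) (T0 : 0 < #|T|).

Theorem dense_bipartite : exists c V, 6 * m < #|V| /\
  forall X, X \subset V -> #|X| <= 2 * m -> linked (cut c) V X.
Proof.
have [c degc] := max_cut; pose e0 := cut c.
have s0 : symmetric e0 := cut_sym c; have i0 : irreflexive e0 := cut_irr c.
(* The inequality alone would hold trivially below 2m vertices. With exactly 3m vertices a bipartite
   graph has too few edges for it, so a smallest [V] exceeds 3m and stays admissible in size when
   one vertex is deleted. *)
pose P V := 3 * m <= #|V| /\ K * #|V| < rho e0 V V + K * (2 * m).
have [|V [[V3 KV] mn]] := @ex_min {set T} P (fun V => #|V|).
  exists setT; split.
    have /card_gt0P [v _] := T0; have := deg v; have := max_card (nbh e setT v).
    rewrite cardsT; move: K1; nlia.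
  have : K * #|[set: T]| <= rho e0 setT setT.
    rewrite mulnC -sum_nat_const.
    apply: leq_trans (_ : \sum_(v in [set: T]) #|nbh e0 setT v| <= _).
      by apply: leq_sum => v _; have := deg v; have := degc v; rewrite -/e0; nlia.
    under eq_bigr => v _ do rewrite -sum1_card.
    rewrite pair_big_dep /= sum1dep_card; apply/subset_leq_card/subsetP => -[x y].
    by rewrite inE /= => /andP [xV]; rewrite inE => /andP [yV xy]; apply/touchP; split; auto.
  have : 0 < K * (2 * m) by rewrite !muln_gt0 m0 /= (leq_trans _ K1).
  nlia.
have mnP W : #|W| < #|V| -> 3 * m <= #|W| -> rho e0 W W + K * (2 * m) <= K * #|W|.
  move=> lt W3; rewrite leqNgt; apply/negP => h.
  by have := mn W (conj W3 h); rewrite leqNgt lt.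
have V3' : 3 * m < #|V|.
  rewrite ltnNge; apply/negP => le; have eV : #|V| = 3 * m by apply/eqP; rewrite eqn_leq le.
  have := bipartite_rho c V; move: KV; rewrite -/e0 eV.
  have : 12 * m * m <= K * m by rewrite leq_mul2r (ltnW K1) orbT.
  have : 0 < m * m by rewrite muln_gt0 m0.
  rewrite -mulnA (mulnCA K 3) (mulnCA K 2) mulnACA; clear; nlia.
have degV v : v \in V -> K < 2 * #|nbh e0 V v|.
  move=> vV; have cV := cardsD1 v V; rewrite vV in cV.
  have := @mnP (V :\ v); rewrite cV ltnS leqnn => /(_ isT).
  have -> : 3 * m <= #|V :\ v| by move: V3'; rewrite cV; nlia.
  move=> /(_ isT); move: KV; rewrite (rho_del s0 i0 vV) cV mulnDr; nlia.
(* The two sides of the separation overlap in [S], have at least 3m vertices by [degV], and share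
   out all edges. Minimality on both sides, with |S| < 2m, contradicts the inequality for [V]. *)
have conn (W S : {set T}) : W != set0 -> W \subset V -> [disjoint W & S] -> S \subset V -> #|S| < 2 * m ->
    nb e0 V W \subset S -> ~~ (V \subset W :|: S) -> False.
  move=> /set0Pn [w wW] WV dWS SV cS nbS /subsetPn [r rV rn].
  have rW : r \notin W by apply: contra rn => h; rewrite in_setU h.
  have rS : r \notin S by apply: contra rn => h; rewrite in_setU h orbT.
  have big (U : {set T}) x : x \in V -> (forall z, z \in V -> e0 x z -> z \in U) -> 3 * m <= #|U|.
    move=> xV h; have : nbh e0 V x \subset U by apply/subsetP => z; rewrite inE => /andP [/h].
    by move/subset_leq_card; have := degV x xV; move: K1; nlia.
  pose A := W :|: S; pose B := V :\: W.
  have A3 : 3 * m <= #|A|.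
    apply: (big _ w); first exact: (subsetP WV).
    move=> z zV wz; rewrite in_setU; case zW : (z \in W) => //=; apply: (subsetP nbS).
    by apply/nbP; rewrite zW; split=> //; exists w.
  have B3 : 3 * m <= #|B|.
    apply: (big _ r) => // z zV rz; rewrite in_setD zV andbT; apply/negP => zW.
    case/negP: rS; apply: (subsetP nbS); apply/nbP; split=> //; exists z; by rewrite // s0.
  have AV : A \subset V by rewrite subUset WV.
  have ltA : #|A| < #|V|.
    by apply: proper_card; apply/properP; split=> //; exists r; rewrite // in_setU negb_or rW.
  have ltB : #|B| < #|V|.
    apply: proper_card; apply/properP; split; first exact: subsetDl.
    by exists w; rewrite ?(subsetP WV) // in_setD wW.
  have sum : #|A| + #|B| = #|V| + #|S|.
    rewrite cardsU disjoint_setI0 // cards0 subn0 cardsD (setIidPr WV).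
    have := subset_leq_card WV; nlia.
  have rs : rho e0 V V <= rho e0 A A + rho e0 B B.
    apply: leq_trans (cardU_le _ _); apply/subset_leq_card/subsetP => -[x y] /touchP [xV yV xy _].
    have nbS' z z' : z \in W -> z' \in V -> e0 z z' -> z' \in A.
      move=> zW zV zz; rewrite in_setU; case zW' : (z' \in W) => //=; apply: (subsetP nbS).
      by apply/nbP; rewrite zW'; split=> //; exists z.
    rewrite in_setU; case xW : (x \in W); last case yW : (y \in W).
    - apply/orP; left; have yA := nbS' _ _ xW yV xy.
      by apply/touchP; rewrite yA in_setU xW; split; auto.
    - apply/orP; left; have xA : x \in A by apply: (nbS' y) => //; rewrite s0.
      by apply/touchP; rewrite xA in_setU yW; split; auto.
    - by apply/orP; right; apply/touchP; rewrite !in_setD xW yW xV yV; split; auto.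
  have := mnP _ ltA A3; have := mnP _ ltB B3; move: KV rs.
  have : K * #|A| + K * #|B| = K * #|V| + K * #|S| by rewrite -!mulnDr sum.
  have : K * #|S| <= K * (2 * m) by rewrite leq_mul2l (ltnW cS) orbT.
  nlia.
have V6 : 6 * m < #|V|.
  have /card_gt0P [v vV] : 0 < #|V| by move: V3'; nlia.
  have := degV v vV; have : #|nbh e0 V v| <= #|V|.
    by apply/subset_leq_card/subsetP => z; rewrite inE => /andP [].
  by move: K1; nlia.
have full X : X \subset V -> #|X| = 2 * m -> linked e0 V X.
  move=> XV cX; apply: (massed_linked m0 K1 K2) => //; split=> //; first by rewrite cX.
    have cVX : #|V :\: X| = #|V| - 2 * m by rewrite cardsDS // cX.
    split; first by rewrite cVX; move: V3'; nlia.
    have : rho e0 V V <= rho e0 V (V :\: X) + rho e0 X X.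
      apply: leq_trans (cardU_le _ _); apply/subset_leq_card/subsetP => -[x y] /touchP [xV yV xy _].
      rewrite in_setU; case xX : (x \in X); last first.
        by apply/orP; left; apply/touchP; split=> //; left; rewrite in_setD xX.
      case yX : (y \in X); last first.
        by apply/orP; left; apply/touchP; split=> //; right; rewrite in_setD yX.
      by apply/orP; right; apply/touchP; split; auto.
    have := bipartite_rho c X; rewrite -/e0 cX.
    have : K * #|V :\: X| + K * (2 * m) = K * #|V|.
      by rewrite -mulnDr cVX subnK //; move: V3'; nlia.
    move: KV; rewrite -(mulnA 2 m m) (mulnACA 2 m 2 m); clear; nlia.
  move=> W WV hW; rewrite cX leqNgt; apply/negP => lt.
  have WV' : W \subset V := subset_trans WV (subsetDl _ _).
  apply: (conn W (nb e0 V W)) => //.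
  - by apply/eqP => w0; case: hW; rewrite w0 cards0 => + _; move: m0; nlia.
  - by apply: disjointI => z zW /nbP []; rewrite zW.
  - exact: nb_sub.
  apply/negP => sub; move: lt; rewrite ltnNge => /negP; apply; rewrite -cX.
  apply/subset_leq_card/subsetP => x xX; have := subsetP sub _ (subsetP XV _ xX).
  rewrite in_setU => /orP [xW|//]; by have := subsetP WV _ xW; rewrite in_setD xX.
exists c, V; split=> // X XV cX.
have [Y [XY YV cY]] : exists Y : {set T}, [/\ X \subset Y, Y \subset V & #|Y| = 2 * m].
  have [||Y [[XY YV cY]] mY] := @ex_max {set T} (fun Y => [/\ X \subset Y, Y \subset V & #|Y| <= 2 * m]) (fun Y => #|Y|) (2 * m).
  - by exists X.
  - by move=> Y [].
  exists Y; split=> //; apply/eqP; rewrite eqn_leq cY leqNgt; apply/negP => lt.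
  have [z zV zY] : exists2 z, z \in V & z \notin Y.
    by apply/subsetPn; apply/negP => /subset_leq_card; move: lt V6; nlia.
  have h : [/\ X \subset z |: Y, z |: Y \subset V & #|z |: Y| <= 2 * m].
    by rewrite cardsU1 zY (subset_trans XY (subsetUr _ _)) subUset sub1set zV YV.
  by have := mY _ h; rewrite cardsU1 zY ltnn.
exact: linked_sub (subxx V) XY (full Y YV cY).
Qed.

End Bipartite.

(** * Matchings and the Tutte-Berge formula *)

Section Dihedral.
Variables (A : finType) (f g : A -> A) (a : A).
Hypotheses (ff : involutive f) (gg : involutive g) (ga : g a = a).
(** The dihedral picture: with the orbit of [a] indexed modulo [period], [g] is the reflection i ->
    -i and [f] is i -> -i-1. So [g] fixes index 0 and possibly half the period, and [f] fixes at
    most one index. *)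
Let h x := g (f x).

Let hI : injective h.
Proof. exact: inj_comp (inv_inj gg) (inv_inj ff). Qed.

Let iterI n : injective (iter n h).
Proof. by elim: n => [|n IH] x y //= /hI /IH. Qed.

Definition period := order h a.

Lemma period_gt0 : 0 < period. Proof. exact: order_gt0. Qed.

Let iter_period n : iter (n * period) h a = a.
Proof. by elim: n => // n IH; rewrite mulSn iterD IH /period iter_order. Qed.

Lemma iter_dvd n : iter n h a = a -> period %| n.
Proof.
rewrite {1}(divn_eq n period) addnC iterD iter_period => e.
have lt := ltn_pmod n period_gt0.
by rewrite /dvdn -(findex_iter lt) e findex0.
Qed.

Lemma iter_inj i j : i < period -> j < period -> iter i h a = iter j h a -> i = j.
Proof. by move=> li lj e; rewrite -(findex_iter li) e findex_iter. Qed.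

Let hgh x : h (g (h x)) = g x. Proof. by rewrite /h gg ff. Qed.

Let iter_g i : iter i h (g (iter i h a)) = a.
Proof.
suff H b : iter i h (g (iter i h b)) = g b by rewrite H.
by elim: i b => // i IH b; rewrite iterSr [iter i.+1 h b]iterS hgh IH.
Qed.

Let iter_f i : iter i.+1 h (f (iter i h a)) = a.
Proof.
have -> : f (iter i h a) = g (iter i.+1 h a) by rewrite iterS /h gg.
exact: iter_g.
Qed.

Lemma g_iter i j : g (iter i h a) = iter j h a -> period %| i + j.
Proof. by move=> e; apply: iter_dvd; rewrite iterD -e iter_g. Qed.

Lemma f_iter i j : f (iter i h a) = iter j h a -> period %| i + j + 1.
Proof. by move=> e; apply: iter_dvd; rewrite addn1 -addSn iterD -e iter_f. Qed.

Let back n x : iter n h x = a -> fconnect h a x.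
Proof.
move=> e; rewrite (_ : x = iter (n * period.-1) h a) ?fconnect_iter //.
apply: (iterI (n := n)); rewrite e -iterD -{1}[n]muln1 -mulnDr add1n prednK ?iter_period //.
exact: period_gt0.
Qed.

Lemma orbit_g x : fconnect h a (g x) = fconnect h a x.
Proof.
have H y : fconnect h a y -> fconnect h a (g y).
  by move/iter_findex => <-; apply: back (iter_g _).
by apply/idP/idP => /H //; rewrite gg.
Qed.

Lemma orbit_f x : fconnect h a (f x) = fconnect h a x.
Proof.
have H y : fconnect h a y -> fconnect h a (f y).
  by move/iter_findex => <-; apply: back (iter_f _).
by apply/idP/idP => /H //; rewrite ff.
Qed.

Lemma orbit_index x : fconnect h a x -> exists2 i, i < period & x = iter i h a.
Proof. by move=> ax; exists (findex h a x); rewrite ?findex_max // iter_findex. Qed.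

Lemma orbit_fixed_f x y : fconnect h a x -> fconnect h a y -> f x = x -> f y = y -> x = y.
Proof.
move=> /orbit_index [i li ->] /orbit_index [j lj ->] /f_iter di /f_iter dj.
have E k : k < period -> period %| k + k + 1 -> k + k + 1 = period.
  move=> lk /dvdnP [q e]; move: lk; rewrite e; case: q e => [|[|q]] e; rewrite ?mul1n //; first by lia.
  by move=> lk; move: e; rewrite !mulSn; lia.
by congr (iter _ _ _); have := E _ li di; have := E _ lj dj; lia.
Qed.

Lemma orbit_fixed_g i : i < period -> g (iter i h a) = iter i h a -> i = 0 \/ i + i = period.
Proof.
move=> li /g_iter /dvdnP [q e]; case: q e => [|[|q]] e; [left; lia|right; lia|].
by move: e; rewrite !mulSn; lia.
Qed.

End Dihedral.

Lemma involution_parity (A : finType) (f : A -> A) (D : {set A}) : involutive f ->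
  (forall x, x \in D -> f x \in D) -> odd #|D| = odd #|[set x in D | f x == x]|.
Proof.
move=> ff; have [n le_n] := ubnP #|D|; elim: n D le_n => // n IH D le_n fD.
have [/existsP [x /andP [xD fx]]|/existsPn no] := boolP [exists x, (x \in D) && (f x != x)]; last first.
  congr (odd _); apply: eq_card => x; rewrite inE; case xD : (x \in D) => //=.
  by have := no x; rewrite xD negbK => ->.
have fxD := fD _ xD.
pose D' := D :\ x :\ f x.
have c1 : #|D| = #|D'|.+2.
  by rewrite (cardsD1 x) xD (cardsD1 (f x) (D :\ x)) in_setD1 fx fxD.
rewrite c1 /= negbK IH; first last.
- move=> y; rewrite !in_setD1 => /and3P [yf yx yD]; rewrite fD // andbT; apply/andP; split.
    by rewrite (inj_eq (inv_inj ff)).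
  by apply: contraNneq yf => <-; rewrite ff.
- by move: le_n; rewrite c1; lia.
congr (odd _); apply: eq_card => y; rewrite !inE.
case: (y =P f x) => [->|_] /=; first by rewrite ff eq_sym (negPf fx) andbF.
by case: (y =P x) => [->|_] //=; rewrite (negPf fx) andbF.
Qed.

Section Berge.
Variables (A : finType) (e : rel A).
Hypotheses (es : symmetric e) (ei : irreflexive e).
Implicit Types (V U O : {set A}) (f g : {ffun A -> A}).

(** A matching is encoded as an involution whose fixed points are the uncovered vertices, so that
    two matchings generate alternating paths as orbits. *)
Definition matching V f := [forall x, (f (f x) == x) && ((f x != x) ==> (x \in V) && e x (f x))].
Definition missed V f := [set x in V | f x == x].

Lemma matchingP V f : reflect (involutive f /\ forall x, f x != x -> x \in V /\ e x (f x)) (matching V f).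
Proof.
apply: (iffP forallP) => [h|[h1 h2] x].
  split=> [x|x fx]; first by case/andP: (h x) => /eqP.
  by case/andP: (h x) => _; rewrite fx => /andP.
by rewrite h1 eqxx; apply/implyP => /h2 [-> ->].
Qed.

(** Stands in for the odd components: [kappa] will be constant along edges, so each class is a union
    of components. *)
Definition odd_classes V (kappa : A -> A) := [set r | odd #|[set x in V | kappa x == r]|].

Definition switch (O : {set A}) (f g : {ffun A -> A}) : {ffun A -> A} :=
  [ffun x => if x \in O then g x else f x].

Lemma switch_matching V O f g : matching V f -> matching V g ->
  (forall x, (f x \in O) = (x \in O)) -> (forall x, (g x \in O) = (x \in O)) -> matching V (switch O f g).
Proof.
move=> /matchingP [f1 f2] /matchingP [g1 g2] fO gO; apply/matchingP; split=> x; rewrite !ffunE.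
  by case xO : (x \in O); rewrite ?gO ?fO xO ?g1 ?f1.
by case: ifP => xO; [apply: g2|apply: f2].
Qed.

Lemma missed_switch V O f g : #|missed V (switch O f g)| =
  #|missed V g :&: O| + #|missed V f :\: O|.
Proof.
rewrite -(cardsID O); congr (_ + _); apply: eq_card => x; rewrite !inE ffunE;
by case: (x \in O); rewrite ?andbF.
Qed.

Section Maximum.
Variables (V : {set A}) (mu : nat).
Hypothesis mn : forall f, matching V f -> mu <= #|missed V f|.
Definition maximum f := matching V f && (#|missed V f| == mu).
Hypothesis allm : forall x, x \in V -> exists f, maximum f && (f x == x).

Let together x y := [exists f, [&& maximum f, f x == x & f y == y]].
Let sim x y := (x == y) || ~~ together x y.

Let together_sym x y : together x y = together y x.
Proof. by apply: eq_existsb => f; rewrite [X in _ && X]andbC. Qed.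

(* Switching a maximum matching [f] missing [x] and [z] along its alternating
   path with a maximum matching [g] missing [y] frees [y] and uncovers at most
   one other vertex. *)
Let gallai x y z f : y \in V -> maximum f -> f x = x -> f z = z -> x != z -> f y != y ->
  ~~ together x y -> together y z.
Proof.
move=> yV /andP [mf /eqP cf] fx fz xz fy nxy.
have [g /andP [/andP [mg /eqP cg] /eqP gy]] := allm yV.
have [f1 f2] := matchingP _ _ mf; have [g1 g2] := matchingP _ _ mg.
pose O := [set w | fconnect (fun w => g (f w)) y w].
have fO w : (f w \in O) = (w \in O) by rewrite !inE; apply: orbit_f.
have gO w : (g w \in O) = (w \in O) by rewrite !inE; apply: orbit_g.
have one u w : u \in O -> w \in O -> f u = u -> f w = w -> u = w.
  by rewrite !inE; apply: orbit_fixed_f.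
have yO : y \in O by rewrite inE connect0.
have mfg := switch_matching mf mg fO gO; have mgf := switch_matching mg mf gO fO.
have := mn mfg; have := mn mgf; rewrite !missed_switch.
have := cardsID O (missed V f); have := cardsID O (missed V g); rewrite cf cg => eg ef leg lef.
have cfg : #|missed V (switch O f g)| = mu by rewrite missed_switch; nlia.
have max : maximum (switch O f g) by rewrite /maximum mfg cfg eqxx.
have [xO|xO] := boolP (x \in O); last first.
  case/existsP: nxy; exists (switch O f g); rewrite max !ffunE (negPf xO) yO fx gy !eqxx //.
apply/existsP; exists (switch O f g); rewrite max !ffunE yO gy eqxx /=.
case: ifP => [zO|_]; last by rewrite fz.
by case/eqP: xz; apply: one.
Qed.

(** Gallai's lemma: a maximum matching missing [x] and [z] either misses [y] or can be switched to
    miss [y] with one of them. *)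
Let sim_trans x y z : y \in V -> sim x y -> sim y z -> sim x z.
Proof.
move=> yV; rewrite /sim; have [-> //|xy] := eqVneq x y; have [<-|yz] := eqVneq y z.
  by rewrite (negPf xy).
move=> /= nxy nyz; have [//|xz] := eqVneq x z; apply/negP => /existsP [f /and3P [mf /eqP fx /eqP fz]].
have [fy|fy] := eqVneq (f y) y.
  by case/negP: nxy; apply/existsP; exists f; rewrite mf fx fy !eqxx.
by case/negP: nyz; apply: gallai mf fx fz xz fy nxy.
Qed.

Let sim_sym x y : sim x y = sim y x.
Proof. by rewrite /sim eq_sym together_sym. Qed.

Let sim_edge x y : x \in V -> y \in V -> e x y -> sim x y.
Proof.
move=> xV yV xy; apply/orP; right; apply/negP => /existsP [f /and3P [/andP [mf /eqP cf] /eqP fx /eqP fy]].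
have [f1 f2] := matchingP _ _ mf.
have nxy : x != y by apply: contraTneq xy => ->; rewrite ei.
pose f' : {ffun A -> A} := [ffun z => if z == x then y else if z == y then x else f z].
have f'E z : z != x -> z != y -> f' z = f z by move=> /negPf zx /negPf zy; rewrite ffunE zx zy.
have f'x : f' x = y by rewrite ffunE eqxx.
have f'y : f' y = x by rewrite ffunE eqxx eq_sym (negPf nxy).
have mf' : matching V f'.
  apply/matchingP; split=> z.
    have [->|zx] := eqVneq z x; first by rewrite f'x f'y.
    have [->|zy] := eqVneq z y; first by rewrite f'y f'x.
    rewrite (f'E z) // f'E ?f1 //.
      by apply: contraNneq zx => h; rewrite -(f1 z) h fx.
    by apply: contraNneq zy => h; rewrite -(f1 z) h fy.
  have [->|zx] := eqVneq z x; first by rewrite f'x.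
  have [->|zy] := eqVneq z y; first by rewrite f'y es.
  by rewrite f'E //; apply: f2.
have : #|missed V f'| < #|missed V f|.
  apply: proper_card; apply/properP; split.
    apply/subsetP => z; rewrite !inE; have [->|zx] := eqVneq z x; first by rewrite f'x eq_sym (negPf nxy) andbF.
    have [->|zy] := eqVneq z y; first by rewrite f'y (negPf nxy) andbF.
    by rewrite f'E.
  by exists x; rewrite !inE xV ?fx ?eqxx // f'x eq_sym.
by have := mn mf'; rewrite cf; nlia.
Qed.

Let kappa x := odflt x [pick y in V | sim x y].

Let kappaE x y : x \in V -> y \in V -> sim x y -> kappa x = kappa y.
Proof.
move=> xV yV xy; rewrite /kappa.
have E : [pred z in V | sim x z] =1 [pred z in V | sim y z].
  move=> z /=; case zV : (z \in V) => //=; apply/idP/idP => h.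
    by apply: sim_trans h; rewrite // sim_sym.
  exact: sim_trans h.
rewrite (eq_pick E); case: pickP => // /(_ y) /=; by rewrite yV /sim eqxx.
Qed.

Let kappa_sim x : x \in V -> kappa x \in V /\ sim x (kappa x).
Proof.
move=> xV; rewrite /kappa; case: pickP => [y /andP [yV xy] //|/(_ x)].
by rewrite /= xV /sim eqxx.
Qed.

(** A class holds at most one vertex missed by [f], and [f] pairs its other vertices within the
    class. So the classes of the missed vertices are odd and distinct. *)
Lemma maximum_classes f : maximum f ->
  mu <= #|odd_classes V kappa| /\ {in V &, forall x y, e x y -> kappa x = kappa y}.
Proof.
move=> mxf; have /andP [mf /eqP cf] := mxf; have [f1 f2] := matchingP _ _ mf.
split; last by move=> x y xV yV xy; apply: kappaE => //; apply: sim_edge.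
have fV x : x \in V -> f x \in V.
  move=> xV; have [-> //|fx] := eqVneq (f x) x.
  by case: (f2 (f x)) => //; rewrite f1 eq_sym.
have km x : x \in V -> kappa (f x) = kappa x.
  move=> xV; have [-> //|fx] := eqVneq (f x) x.
  by apply/esym/kappaE => //; [apply: fV|apply: sim_edge => //; [apply: fV|case: (f2 x fx)]].
have inj : {in missed V f &, injective kappa}.
  move=> x y; rewrite !inE => /andP [xV /eqP fx] /andP [yV /eqP fy] k.
  have [kV sx] := kappa_sim xV; have [_ sy] := kappa_sim yV.
  have : sim x y by apply: sim_trans kV sx _; rewrite k sim_sym.
  by case/orP => [/eqP //|/existsP []]; exists f; rewrite mxf fx fy !eqxx.
rewrite -cf -(card_in_imset inj); apply/subset_leq_card/subsetP => _ /imsetP [x xm ->].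
rewrite inE (involution_parity f1); last first.
  by move=> y; rewrite !inE => /andP [yV /eqP <-]; rewrite fV // km ?eqxx.
rewrite (_ : [set _ in _ | _] = [set x]) ?cards1 //; apply/setP => y; rewrite !inE.
have [-> |yx] := eqVneq y x; first by move: xm; rewrite inE => /andP [-> ->]; rewrite eqxx.
apply/negP => /andP [/andP [yV /eqP k] fy]; case/eqP: yx; apply: inj => //.
by rewrite inE yV.
Qed.

End Maximum.

(** The hard direction of the Tutte-Berge formula. If every vertex is missed by some maximum
    matching, U is empty by Gallai's lemma; otherwise a vertex that is always covered goes into
    U. *)
Theorem berge V : exists U (kappa : A -> A) f, [/\ U \subset V, matching V f,
  #|U| + #|missed V f| <= #|odd_classes (V :\: U) kappa| &
  {in V :\: U &, forall x y, e x y -> kappa x = kappa y}].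
Proof.
have [n le_n] := ubnP #|V|; elim: n V le_n => // n IH V le_n.
have [|f0 [m0 mn0]] := @ex_min _ (fun f => matching V f) (fun f => #|missed V f|).
  by exists [ffun x => x]; apply/matchingP; split=> x; rewrite !ffunE ?eqxx.
pose mu := #|missed V f0|.
have [all|nall] := classic (forall x, x \in V -> exists f, maximum V mu f && (f x == x)).
  have max0 : maximum V mu f0 by rewrite /maximum m0 eqxx.
  have [h1 h2] := maximum_classes mn0 all max0.
  by exists set0; eexists; exists f0; split; rewrite ?sub0set ?cards0 ?setD0 //; eassumption.
have [v vV nv] : exists2 v, v \in V & forall f, maximum V mu f -> f v != v.
  apply: NNPP => no; apply: nall => x xV; apply: NNPP => no'; apply: no; exists x => // f mf.
  by apply/negP => fx; apply: no'; exists f; rewrite mf.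
have cV : #|V| = #|V :\ v|.+1 by rewrite (cardsD1 v) vV.
have [|U [kappa [f [UV mf cU kap]]]] := IH (V :\ v); first by move: le_n; rewrite cV; nlia.
have vf : f v = v.
  apply/eqP/negPn/negP => /(proj2 (matchingP _ _ mf)) [].
  by rewrite in_setD1 eqxx.
have mfV : matching V f.
  have [h1 h2] := matchingP _ _ mf; apply/matchingP; split=> // x /h2 [].
  by rewrite in_setD1 => /andP [_ ->].
have cm : #|missed V f| = #|missed (V :\ v) f|.+1.
  rewrite (cardsD1 v) inE vV vf eqxx add1n; congr _.+1; apply: eq_card => x.
  by rewrite !inE andbA.
have vU : v \notin U by apply/negP => /(subsetP UV); rewrite in_setD1 eqxx.
have par g W : matching W g -> odd #|W| = odd #|missed W g|.
  move=> /matchingP [h1 h2]; apply: involution_parity => // x xW.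
  by have [-> //|fx] := eqVneq (g x) x; case: (h2 (g x)) => //; rewrite h1 eq_sym.
have VU : V :\: (v |: U) = V :\ v :\: U by rewrite setDDl.
exists (v |: U), kappa, f0; rewrite VU; split=> //.
  by rewrite subUset sub1set vV (subset_trans UV (subsetDl _ _)).
apply: leq_trans cU; rewrite cardsU1 vU.
(* On [V] the matching [f] misses [v] too, so it is not maximum; parity rules out equality as well.
   The gain of one pays for [v] in the barrier. *)
suff : #|missed V f0| < #|missed (V :\ v) f| by clear; rewrite /=; lia.
have p0 := par _ _ m0; have p1 := par _ _ mf; rewrite cV /= p1 in p0.
have ne : #|missed V f0| != #|missed (V :\ v) f|.
  by apply/eqP => E; move: p0; rewrite E; case: (odd _).
have := mn0 _ mfV; rewrite leq_eqVlt cm => /predU1P [E|]; last by move: ne; clear; nlia.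
by have := nv f; rewrite /maximum mfV /mu E -cm eqxx vf eqxx => /(_ isT).
Qed.

End Berge.

(** * Disjoint parity-breaking paths *)

Lemma path_iota (T : eqType) (e : rel T) (g : nat -> T) k L :
  (forall i, k <= i < k + L -> e (g i) (g i.+1)) -> path e (g k) [seq g i | i <- iota k.+1 L].
Proof.
elim: L k => // L IH k h /=; rewrite h ?IH //; last by lia.
by move=> i hi; apply: h; lia.
Qed.

Lemma last_iota (T : eqType) (g : nat -> T) k L : last (g k) [seq g i | i <- iota k.+1 L] = g (k + L).
Proof. by elim: L k => [|L IH] k /=; rewrite ?addn0 // IH addSnnS. Qed.

Lemma card_disjU (T : finType) (B C : {set T}) : [disjoint B & C] -> #|B :|: C| = #|B| + #|C|.
Proof. by move=> d; rewrite cardsU disjoint_setI0 // cards0 subn0. Qed.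

Section OddPaths.
Variables (T : finType) (e : rel T) (c : T -> bool) (S : {set T}) (N : nat).
Hypotheses (es : symmetric e) (ei : irreflexive e).
Hypothesis conn : forall X : {set T}, #|X| < 2 * N ->
  forall x y, x \notin X -> y \notin X -> connect (del_rel e X) x y.
Hypothesis S2N : 2 * N <= #|S|.

(** [c] colours the bipartite graph on [S], in which a path from [a] to [b] is odd exactly when the
    colours differ. The required parity is the opposite one. *)
Definition breaking_path a b p := [/\ a \in S /\ b \in S, a != b, path e a p /\ last a p = b, uniq (a :: p) &
  (forall z, z \in a :: p -> z \in S -> z \in [set a; b]) /\ odd (size p) != (c a != c b)].

Definition breaking_family n (P : {set T}) (b : T -> T) (p : T -> seq T) :=
  [/\ n <= #|P|, {in P, forall a, breaking_path a (b a) (p a)} &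
      {in P &, forall a a' z, a != a' -> z \in a :: p a -> z \in a' :: p a' -> False}].

Let A : finType := (T * bool)%type.
Let V0 : {set A} := [set x | (x.1 \in S) ==> (x.2 == c x.1)].
Let aux : rel A := [rel x y | (x.2 == y.2) && e x.1 y.1 || (x.1 == y.1) && (x.2 != y.2)].
(** The only fixed points of [rung] in play are the single copies of the vertices of [S], so an
    alternating path ends there or at a vertex missed by [f]. *)
Let rung (x : A) : A := if x.1 \in S then x else (x.1, ~~ x.2).
Let cp v : A := (v, c v).

Let aux_sym : symmetric aux.
Proof. by move=> x y; rewrite /aux /= es ![x.1 == _]eq_sym ![x.2 == _]eq_sym. Qed.
Let aux_irr : irreflexive aux.
Proof. by move=> x; rewrite /aux /= ei !eqxx. Qed.
Let rungK : involutive rung.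
Proof.
by move=> [v b]; rewrite /rung /=; case vS : (v \in S); rewrite /= ?vS //= negbK.
Qed.
Let rung1 x : (rung x).1 = x.1. Proof. by rewrite /rung; case: ifP. Qed.
Let rung_S x : rung x = x -> x.1 \in S.
Proof.
case: x => v b; rewrite /rung /=; case: ifP => // _ -[]; by case: b.
Qed.
Let rung_cp v : v \in S -> rung (cp v) = cp v. Proof. by rewrite /rung /= => ->. Qed.
Let V0E v b : ((v, b) \in V0) = ((v \in S) ==> (b == c v)). Proof. by rewrite inE. Qed.
Let V0cp x : x \in V0 -> x.1 \in S -> x = cp x.1.
Proof. by case: x => v b; rewrite V0E /= => /implyP h /h /eqP ->. Qed.
Let rung_V0 x : x \in V0 -> rung x \in V0.
Proof. by rewrite /rung; case: ifP => // xS _; rewrite V0E /= xS. Qed.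
Let cpV v : cp v \in V0. Proof. by rewrite V0E eqxx implybT. Qed.

(* Alternating paths of [f] and the rungs project to walks along which the bit
   flips at each interior vertex. *)
Section Extract.
Variable f : {ffun A -> A}.
Hypothesis mf : matching aux V0 f.
Let ff : involutive f. Proof. by case/matchingP: mf. Qed.
Let fe x : f x != x -> x \in V0 /\ aux x (f x). Proof. by case/matchingP: mf => _; apply. Qed.
Let h x := rung (f x).
Let O a := fconnect h (cp a).
Let r a := period f rung (cp a).

Let fV x : x \in V0 -> f x \in V0.
Proof.
move=> xV; have [-> //|fx] := eqVneq (f x) x; case: (@fe (f x)) => //.
by rewrite ff eq_sym.
Qed.

Let iterV a i : iter i h (cp a) \in V0.
Proof. by elim: i => [|i IH]; [apply: cpV|rewrite iterS; apply/rung_V0/fV]. Qed.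

Let OV a x : O a x -> x \in V0.
Proof. by move/iter_findex => <-; apply: iterV. Qed.

Let hI : injective h.
Proof. exact: inj_comp (inv_inj rungK) (inv_inj ff). Qed.

Let O_eq a x : O a x -> O a =1 fconnect h x.
Proof. by move=> ax y; rewrite /O (same_connect (fconnect_sym hI) ax). Qed.

Let S_in_O a b : a \in S -> b \in S -> O a (cp b) -> b = a \/ exists2 i, i + i = r a & cp b = iter i h (cp a).
Proof.
move=> aS bS ab; have [i li ei'] := orbit_index ab.
have := @orbit_fixed_g _ _ _ (cp a) ff rungK (rung_cp aS) i li; rewrite -/h -ei' rung_cp // => /(_ erefl) [i0|ir].
  by left; have := ei'; rewrite i0 => -[].
by right; exists i.
Qed.

Let Sodd := [set a in S | odd (r a)].
Let Sev := [set a in S | ~~ odd (r a)].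

(** An orbit of odd size contains a fixed point of [f], and such an orbit contains only one root,
    since a second one sits at half the period. *)
Let card_odd : #|Sodd| <= #|missed V0 f|.
Proof.
have ex a : exists w, a \in Sodd -> O a w /\ f w = w.
  have [|_] := boolP (a \in Sodd); last by exists (cp a).
  rewrite inE => /andP [aS oa].
  have : odd #|[set x in [set y | O a y] | f x == x]|.
    rewrite -(involution_parity ff); last by move=> x; rewrite !inE /O /h orbit_f // rung_cp.
    by rewrite (_ : #|_| = r a) // cardsE.
  case: (set_0Vmem [set x in [set y | O a y] | f x == x]) => [->|[w]]; first by rewrite cards0.
  by rewrite !inE => /andP [aw /eqP fw] _; exists w.
have /fin_all_exists [w wP] := ex.
have inj : {in Sodd &, injective w}.
  move=> a a' aS aS' ww; have [aw _] := wP _ aS; have [aw' _] := wP _ aS'.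
  move: aS aS'; rewrite !inE => /andP [aS oa] /andP [aS' _].
  have : O a (cp a') by rewrite (O_eq aw) ww fconnect_sym.
  case/(S_in_O aS aS') => // -[i ir _]; by move: oa; rewrite -ir addnn odd_double.
rewrite -(card_in_imset inj); apply/subset_leq_card/subsetP => _ /imsetP [a aS ->].
have [aw fw] := wP _ aS; by rewrite inE (OV aw) fw eqxx.
Qed.

Let half a := (r a)./2.
Let b a := (iter (half a) h (cp a)).1.
Let g a i := (iter i h (cp a)).1.
Let p a := [seq g a i | i <- iota 1 (half a)].

Section Even.
Variable a : T.
Hypothesis aS : a \in Sev.
Let aS' : a \in S. Proof. by move: aS; rewrite inE => /andP []. Qed.
Let ra : half a + half a = r a.
Proof. by move: aS; rewrite inE => /andP [_ ev]; rewrite addnn -[RHS]odd_double_half (negPf ev). Qed.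
Let ha0 : 0 < half a.
Proof. by have := period_gt0 f rung (cp a); rewrite -/(r a) -ra; case: (half a). Qed.
Let rc := rung_cp aS'.

Let inS i : i < r a -> (g a i \in S) -> i = 0 \/ i = half a.
Proof.
move=> li gS; have := @orbit_fixed_g _ _ _ (cp a) ff rungK rc i li.
have -> : rung (iter i (fun x => rung (f x)) (cp a)) = iter i (fun x => rung (f x)) (cp a).
  by rewrite /rung; move: gS; rewrite /g /h => ->.
move=> /(_ erefl) [->|ir]; [by left|right; rewrite -/(r a) in ir; nlia].
Qed.

Let bS : iter (half a) h (cp a) = cp (b a) /\ b a \in S.
Proof.
have E : rung (iter (half a) h (cp a)) = iter (half a) h (cp a).
  have hh := orbit_g ff rungK rc (iter (half a) h (cp a)).
  rewrite fconnect_iter in hh; have [j lj ej] := orbit_index hh.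
  have dv := g_iter ff rungK rc ej; rewrite -/(r a) in dv lj.
  rewrite -/h in ej; rewrite ej; congr iter.
  have lt : half a < r a by rewrite -ra; nlia.
  by case/dvdnP: dv => -[|[|q]] E; [nlia|nlia|move: E; rewrite !mulSn; nlia].
have bS := rung_S E; split=> //; exact: V0cp (iterV _ _) bS.
Qed.

(** If [f] followed a rung at this place, [h] would fix the point although the period exceeds one.
    So [f] keeps the bit and moves along [e], and then [rung] flips the bit except at the final
    root. *)
Let step i : i < half a -> e (g a i) (g a i.+1) /\
  ((iter i.+1 h (cp a)).2 = if i.+1 == half a then (iter i h (cp a)).2 else ~~ (iter i h (cp a)).2).
Proof.
move=> li; set x := iter i h (cp a).
have fx : f x != x.
  apply/eqP => fx; have := f_iter ff rungK rc fx; rewrite -/(r a) -ra => /dvdnP [q E].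
  by move: (congr1 odd E); rewrite oddM addnn addnn oddD !odd_double andbF.
have [xV xf] := fe fx; have fxV := fV xV.
have r1 : 1 < r a by rewrite -ra; nlia.
have [e1 e2] : x.2 = (f x).2 /\ e x.1 (f x).1.
  case/orP: xf => /andP [/eqP h1 h2] //; exfalso.
  case xS : (x.1 \in S).
    have E2 := V0cp fxV; rewrite -h1 in E2.
    by move: fx; rewrite (E2 xS) -(V0cp xV xS) eqxx.
  have : h x = x.
    rewrite /h /rung -h1 xS; case: (x) (f x) h1 h2 => v bb [v' bb'] /= -> {xS}.
    by case: bb; case: bb'.
  rewrite /x -iterS -[RHS]/(iter i h (cp a)) => E.
  have li' : i < r a by rewrite -ra; nlia.
  have li1 : i.+1 < r a by rewrite -ra; nlia.
  by have := iter_inj li1 li' E; nlia.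
have hx1 : (h x).1 = (f x).1 by rewrite /h rung1.
split; first by rewrite /g iterS -/x hx1.
rewrite iterS -/x e1; case: eqP => [ih|/eqP ih].
  have [hb bbS] := bS; rewrite /h /rung; suff -> : (f x).1 \in S by [].
  by rewrite -hx1 /x -iterS ih hb.
rewrite /h /rung; case: ifP => // fS.
have li1 : i.+1 < r a by rewrite -ra; nlia.
have : g a i.+1 \in S by rewrite /g iterS -/x hx1.
by move/(inS li1) => [|ih'] //; rewrite ih' eqxx in ih.
Qed.

Let bits i : i < half a -> (iter i h (cp a)).2 = c a (+) odd i.
Proof.
elim: i => [|i IH] li; first by rewrite addbF.
have [_ ->] := step (ltnW li); rewrite (IH (ltnW li)) ltn_eqF //= addbN //.
Qed.

(** The bit equals the colour at both ends and is flipped [half a] - 1 times along [half a] edges,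
    which makes the parity wrong. *)
Lemma even_path : breaking_path a (b a) (p a).
Proof.
have [hb bbS] := bS.
have pE : a :: p a = [seq g a i | i <- iota 0 (half a).+1] by [].
have gI i j : i <= half a -> j <= half a -> g a i = g a j -> i = j.
  move=> li lj ij; have li' : i < r a by rewrite -ra; nlia.
  have lj' : j < r a by rewrite -ra; nlia.
  have [E|E] : iter i h (cp a) = iter j h (cp a) \/ rung (iter i h (cp a)) = iter j h (cp a).
    move: (iterV a i) (iterV a j) ij; rewrite /g /rung; case: (iter i h _) => v bb; case: (iter j h _) => v' bb' /=.
    rewrite !V0E => h1 h2 vv; move: h1 h2; rewrite -vv; case: (v \in S) => /=.
      by move=> /eqP -> /eqP ->; left.
    by move=> _ _; case: bb; case: bb'; auto.
  - exact: iter_inj li' lj' E.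
  - have := g_iter ff rungK rc E; rewrite -/(r a) => /dvdnP [[|[|q]] E']; [nlia|nlia|].
    by move: E'; rewrite !mulSn; nlia.
split.
- by [].
- apply/eqP => ab; have : g a 0 = g a (half a) by [].
  by move/gI => /(_ isT (leqnn _)); nlia.
- split; last by rewrite /p -[in LHS](_ : g a 0 = a) // last_iota.
  by apply: (@path_iota _ e (g a) 0) => i hi; case: (@step i).
- rewrite pE map_inj_in_uniq ?iota_uniq // => i j; rewrite !mem_iota /= add0n !ltnS; exact: gI.
split.
  move=> z; rewrite pE => /mapP [i]; rewrite mem_iota add0n ltnS /= => li ->.
  have li' : i < r a by rewrite -ra; nlia.
  by move/(inS li') => [->|->]; rewrite !inE eqxx ?orbT.
rewrite size_map size_iota.
have lt : (half a).-1 < half a by rewrite prednK.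
have [_] := step lt; rewrite prednK // eqxx hb /= (bits lt) => ->.
have -> : odd (half a) = ~~ odd (half a).-1 by rewrite -[in LHS](prednK ha0).
by case: (c a); case: (odd _).
Qed.

Lemma even_orbit z : z \in a :: p a -> exists2 x, O a x & x.1 = z.
Proof.
have pE : a :: p a = [seq g a i | i <- iota 0 (half a).+1] by [].
by rewrite pE => /mapP [i _ ->]; exists (iter i h (cp a)); rewrite // /O fconnect_iter.
Qed.

Lemma b_orbit : O a (cp (b a)).
Proof. by have [<- _] := bS; rewrite /O fconnect_iter. Qed.

End Even.

Let b_even a : a \in Sev -> b a \in Sev /\ b (b a) = a.
Proof.
move=> aE; have aS : a \in S by move: aE; rewrite inE => /andP [].
have [[_ bS] ab _ _ _] := even_path aE.
have ob := b_orbit aE.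
have rE : r (b a) = r a.
  by rewrite /r /period /order; apply: eq_card => x; rewrite !inE -(O_eq ob).
have bE : b a \in Sev by move: aE; rewrite !inE bS rE aS.
split=> //; have ob' := b_orbit bE; have [[_ bbS] bb _ _ _] := even_path bE.
have : O a (cp (b (b a))) by rewrite (O_eq ob).
case/(S_in_O aS bbS) => // -[i ir E].
have : b (b a) = b a.
  have hi : i = half a by rewrite /half -ir addnn doubleK.
  by rewrite hi in E; exact: (congr1 fst E).
by move=> E'; rewrite E' eqxx in bb.
Qed.

(** Roots of even period are paired by [b]; comparing [enum_rank] selects one root of each pair, so
    that each path is taken once. *)
Lemma breaking_paths_of_matching n : #|S| + 2 <= #|missed V0 f| + 2 * n \/
  exists P b' p', breaking_family n P b' p'.
Proof.
pose P := [set a in Sev | enum_rank a < enum_rank (b a)].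
have [le|lt] := leqP n #|P|; [right|left].
  exists P, b, p; split=> //.
    by move=> a; rewrite inE => /andP [aE _]; apply: even_path.
  move=> a a'; rewrite ![_ \in P]inE => /andP [aE ra] /andP [aE' ra'] z aa.
  move=> /even_orbit [x ax xz] /even_orbit [x' ax' xz'].
  have [aS aS'] : a \in S /\ a' \in S by move: aE aE'; rewrite !inE => /andP [-> _] /andP [-> _].
  have ax2 : O a x'.
    have [->//|<-] : x' = x \/ rung x = x'; last by rewrite /O orbit_g // rung_cp.
    move: (OV ax) (OV ax') xz xz'; rewrite /rung; case: (x) => v bb; case: (x') => v' bb' /=.
    rewrite !V0E => h1 h2 vv vv'; move: h1 h2; rewrite vv vv'; case: (z \in S) => /=.
      by move=> /eqP -> /eqP ->; left.
    by move=> _ _; case: bb; case: bb'; auto.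
  have : O a (cp a') by rewrite (O_eq ax2) fconnect_sym.
  case/(S_in_O aS aS') => [E|[i ir E]]; first by rewrite E eqxx in aa.
  have ba : b a = a'.
    by rewrite /b (_ : half a = i) -?E // /half -ir addnn doubleK.
  have [_ bb] := b_even aE; move: ra ra'; rewrite -ba bb; nlia.
have cS : #|S| = #|Sodd| + #|Sev|.
  by rewrite -(cardsID [set a | odd (r a)]); congr (_ + _); apply: eq_card => a; rewrite !inE // andbC.
have : #|Sev :\: P| <= #|P|.
  have inj : {in Sev :\: P &, injective b}.
    move=> a a' /setDP [aE _] /setDP [aE' _] bb.
    by have [_ <-] := b_even aE; have [_ <-] := b_even aE'; rewrite bb.
  rewrite -(card_in_imset inj); apply/subset_leq_card/subsetP => _ /imsetP [a /setDP [aE na] ->].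
  have [bE bb] := b_even aE; rewrite inE bE bb /=.
  move: na; rewrite inE aE /= -leqNgt leq_eqVlt => /orP [/eqP E|//].
  have [_ /eqP ab _ _ _] := even_path aE; case: ab; apply: enum_rank_inj; exact: val_inj (esym E).
have : #|Sev| = #|P| + #|Sev :\: P|.
  by rewrite -(cardsID P) (setIidPr _) //; apply/subsetP => a; rewrite inE => /andP [].
move: card_odd lt cS; nlia.
Qed.

End Extract.

(** * From a Tutte-Berge barrier to an odd cycle cover *)

Section Cover.
Variables (U : {set A}) (kappa : A -> A) (mu : nat).
Hypotheses (cU : #|U| + mu <= #|odd_classes (V0 :\: U) kappa|).
Hypothesis kap : {in V0 :\: U &, forall x y, aux x y -> kappa x = kappa y}.
Hypothesis small : #|S| + 2 <= mu + 2 * N.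

(* [reps] are the copies outside [U] of the vertices that have no other copy outside [U]. *)
Let reps := [set x in V0 :\: U | (x.1 \in S) || (rung x \in U)].
Let chosen := [set x in reps | [pick y in reps | kappa y == kappa x] == Some x].
Let US := [set v in S | cp v \in U].
Let both := [set v | [&& v \notin S, (v, true) \in U & (v, false) \in U]].
Let Z := US :|: both :|: fst @: (reps :\: chosen).

Let choose x : x \in reps -> exists2 y, y \in chosen & kappa y = kappa x.
Proof.
move=> xr; case E : [pick y in reps | kappa y == kappa x] => [y|]; last first.
  by move: E; case: pickP => // /(_ x) /=; rewrite xr eqxx.
have [yr /eqP yk] : y \in reps /\ kappa y == kappa x.
  by move: E; case: pickP => // z /andP [z1 z2] [<-].
by exists y => //; rewrite inE yr yk E /=.
Qed.

Let chosen_reps x : x \in chosen -> x \in reps. Proof. by rewrite inE => /andP []. Qed.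
Let reps_VU x : x \in reps -> x \in V0 :\: U. Proof. by rewrite [x \in reps]inE => /andP []. Qed.

Let chosen_inj : {in chosen &, injective kappa}.
Proof.
move=> x y; rewrite [x \in _]inE [y \in _]inE => /andP [_ /eqP px] /andP [_ /eqP py] k.
by apply: Some_inj; rewrite -px -py k.
Qed.

Let rung_aux x : x.1 \notin S -> aux x (rung x).
Proof. by move=> /negPf xS; rewrite /aux /rung /= xS /= eqxx; case: (x.2); rewrite orbT. Qed.

(** A class without representatives is preserved by [rung], which has no fixed point there, so its
    size is even. *)
Let card_chosen : #|odd_classes (V0 :\: U) kappa| <= #|chosen|.
Proof.
apply: leq_trans (leq_imset_card kappa chosen); apply/subset_leq_card/subsetP => k.
rewrite inE; pose D := [set x in V0 :\: U | kappa x == k]; rewrite -/D => oD.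
suff [x xr xk] : exists2 x, x \in reps & kappa x = k.
  by have [y yc yk] := choose xr; apply/imsetP; exists y; rewrite ?yk.
have [/existsP [x /andP [xr /eqP xk]]|/existsPn no] := boolP [exists x, (x \in reps) && (kappa x == k)].
  by exists x.
have DS x : x \in D -> x.1 \notin S /\ rung x \in V0 :\: U.
  rewrite inE => /andP [xVU xk]; have := no x; rewrite xk andbT [x \in reps]inE xVU /= negb_or.
  move=> /andP [xS ru]; split=> //; rewrite in_setD ru rung_V0 //.
  by move: xVU; rewrite in_setD => /andP [].
have D0 : [set x in D | rung x == x] = set0.
  apply/setP => x; rewrite in_set0 inE; apply/negP => /andP [/DS [xS _] /eqP /rung_S].
  by rewrite (negPf xS).
move: oD; rewrite (involution_parity rungK) ?D0 ?cards0 // => x xD; have [xS rV] := DS x xD.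
have := xD; rewrite [x \in D]inE [rung x \in D]inE rV => /andP [xVU /eqP <-].
by apply/eqP/esym/kap => //; apply: rung_aux.
Qed.

Let reps_fst : {in reps &, injective (fst : A -> T)}.
Proof.
move=> [v bb] [v' bb'] /= r1 r2 vv; rewrite -{}vv in r2 *.
have [VU1 VU2] := (reps_VU r1, reps_VU r2).
move: VU1 VU2; rewrite !in_setD !V0E => /andP [n1 h1] /andP [n2 h2].
case vS : (v \in S) h1 h2; first by move=> /eqP -> /eqP ->.
move=> _ _; move: r1; rewrite inE /rung /= vS /= => /andP [_ h].
congr pair; apply/eqP/negPn/negP => ne.
have E : bb' = ~~ bb by move: ne; case: (bb); case: (bb').
by rewrite E h in n2.
Qed.

(** Representatives in [S] together with [US] number at most |S|, and the others together with
    [both] at most |U|. Subtracting one chosen representative per odd class leaves |Z| <= |S| -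
    mu. *)
Let card_Z : #|Z| + 2 <= 2 * N.
Proof.
have cR : #|reps| = #|chosen| + #|reps :\: chosen|.
  by rewrite -(cardsID chosen reps) (setIidPr _) //; apply/subsetP => x /chosen_reps.
have c1 : #|US| + #|(fst @: reps) :&: S| <= #|S|.
  have <- : #|US :|: (fst @: reps) :&: S| = #|US| + #|(fst @: reps) :&: S|.
    apply: card_disjU; apply: disjointI => v.
    rewrite inE => /andP [vS vU] /setIP [/imsetP [x /reps_VU]].
    rewrite in_setD => /andP [xU xV] vx _; case/negP: xU; rewrite (V0cp xV) -?vx //.
  by apply/subset_leq_card/subsetP => v /setUP [|/setIP [_ //]]; rewrite inE => /andP [].
have c2 : #|both| + #|(fst @: reps) :\: S| <= #|U|.
  apply: leq_trans (leq_imset_card fst U).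
  have <- : #|both :|: (fst @: reps) :\: S| = #|both| + #|(fst @: reps) :\: S|.
    apply: card_disjU; apply: disjointI => v.
    rewrite inE => /and3P [vS t1 t2] /setDP [/imsetP [[v' bb] /reps_VU] + vx _].
    by rewrite in_setD /= in vx *; rewrite -vx; case: bb; rewrite ?t1 ?t2.
  apply/subset_leq_card/subsetP => v /setUP [|/setDP [/imsetP [x xr ->] xS]].
    by rewrite inE => /and3P [_ h _]; apply/imsetP; exists (v, true).
  apply/imsetP; exists (rung x); last by rewrite rung1.
  by move: xr; rewrite inE (negPf xS) /= => /andP [].
have c3 : #|reps| = #|(fst @: reps) :&: S| + #|(fst @: reps) :\: S|.
  by rewrite cardsID card_in_imset.
have cZ : #|Z| <= #|US| + #|both| + #|reps :\: chosen|.
  apply: leq_trans (cardU_le _ _) _; apply: leq_add; first exact: cardU_le.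
  exact: leq_imset_card.
move: card_chosen; move: cU small; nlia.
Qed.

Let notZ_rep v bb : v \notin Z -> (v, bb) \in V0 :\: U -> (v \in S) || ((v, ~~ bb) \in U) -> (v, bb) \in chosen.
Proof.
move=> vZ vU h; have vr : (v, bb) \in reps.
  by rewrite [_ \in reps]inE vU /= /rung /=; move: h; case: (v \in S).
apply/negPn/negP => nc; case/negP: vZ; rewrite in_setU; apply/orP; right.
by apply/imsetP; exists (v, bb); rewrite // in_setD nc.
Qed.

Let both_out v := [&& v \notin S, (v, true) \notin U & (v, false) \notin U].

Let both_out_copy v bb : both_out v -> (v, bb) \in V0 :\: U.
Proof. by case/and3P => vS h1 h2; rewrite in_setD V0E (negPf vS) andbT; case: bb. Qed.

(* The vertices with both copies in one class only see [Z], themselves and at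
   most one representative, so connectivity rules them out. *)
Let no_both v0 : ~~ both_out v0.
Proof.
apply/negP => b0; pose k := kappa (v0, true).
pose W v := both_out v && (kappa (v, true) == k).
have Wk v bb : W v -> kappa (v, bb) = k.
  case/andP => bv /eqP <-; case: bb => //; apply: kap; try exact: both_out_copy.
  by rewrite /aux /= eqxx ?orbT.
pose X := Z :|: fst @: [set x in chosen | kappa x == k].
have cX : #|X| < 2 * N.
  have le1 : #|[set x in chosen | kappa x == k]| <= 1.
    apply/card_le1_eqP => x y; rewrite [x \in _]inE [y \in _]inE.
    by move=> /andP [xc /eqP xk] /andP [yc /eqP yk]; apply: chosen_inj; rewrite ?xk ?yk.
  apply: leq_ltn_trans (cardU_le _ _) _; apply: leq_ltn_trans (leq_add (leqnn _) (leq_trans (leq_imset_card _ _) le1)) _.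
  by move: card_Z; nlia.
have inX v bb : (v, bb) \in chosen -> kappa (v, bb) = k -> v \in X.
  move=> vc vk; rewrite in_setU; apply/orP; right; apply/imsetP; exists (v, bb) => //.
  by rewrite inE vc vk eqxx.
have WX v : W v -> v \notin X.
  case/andP => bv _; have nr bb : (v, bb) \notin reps.
    case/and3P: bv => vS h1 h2; rewrite inE /rung /= (negPf vS) /=; case: bb; by rewrite ?(negPf h1) ?(negPf h2) andbF.
  have [vS h1 h2] := and3P bv.
  rewrite !in_setU !negb_or -!andbA; apply/and4P; split.
  - by rewrite inE (negPf vS).
  - by rewrite inE (negPf h1) andbF.
  - by apply/imsetP => -[[v' bb] /setDP [r _] /= vv]; have := nr bb; rewrite vv r.
  - by apply/imsetP => -[[v' bb]]; rewrite inE => /andP [/chosen_reps r _] /= vv; have := nr bb; rewrite vv r.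
have step v w : W v -> del_rel e X v w -> W w.
  move=> Wv /and3P [vw _ wX]; have wZ : w \notin Z by apply: contra wX => h; rewrite in_setU h.
  have bv : both_out v by case/andP: Wv.
  have same bb : (w, bb) \in V0 :\: U -> kappa (w, bb) = k.
    move=> wVU; rewrite -(Wk v bb Wv); apply/esym/kap => //; first exact: both_out_copy.
    by rewrite /aux /= eqxx vw.
  have out bb : (w, bb) \in V0 :\: U -> (w \in S) || ((w, ~~ bb) \in U) -> False.
    by move=> wVU h; case/negP: wX; apply: (inX w bb); [apply: notZ_rep|apply: same].
  have wS : w \notin S.
    apply/negP => wS; apply: (out (c w)); last by rewrite wS.
    rewrite in_setD cpV andbT; apply/negP => h; case/negP: wZ.
    by rewrite !in_setU; apply/orP; left; apply/orP; left; rewrite inE wS.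
  have wV bb : (w, bb) \in V0 by rewrite V0E (negPf wS).
  have nb : ~~ ((w, true) \in U) || ~~ ((w, false) \in U).
    rewrite -negb_and; apply: contra wZ => h.
    by rewrite !in_setU; apply/orP; left; apply/orP; right; rewrite inE wS.
  have [h1 h2] : (w, true) \notin U /\ (w, false) \notin U.
    case t1 : ((w, true) \in U) nb => nb; split=> //; try by apply/negP.
      by case: (out false); rewrite ?in_setD ?wV ?andbT ?t1 ?orbT.
    apply/negP => t2; case: (out true); rewrite ?in_setD ?wV ?andbT ?t1 //= t2 orbT //.
  have bw : both_out w by rewrite /both_out wS h1 h2.
  by rewrite /W bw same ?eqxx // both_out_copy.
have W0 : W v0 by rewrite /W b0 eqxx.
have [s0 s0S s0X] : exists2 s0, s0 \in S & s0 \notin X.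
  by apply/subsetPn; apply/negP => /subset_leq_card; move: cX S2N; nlia.
have /connectP [q pq lq] := conn cX (WX _ W0) s0X.
have inv : forall q v, path (del_rel e X) v q -> W v -> W (last v q).
  by elim=> // w q' IH v /= /andP [vw pq'] Wv; apply: IH pq' (step _ _ Wv vw).
have : W s0 by rewrite lq; apply: inv.
by case/andP => /and3P [sS]; rewrite s0S in sS.
Qed.

(** Off [Z] each vertex has exactly one copy outside [U], a chosen one, and its bit is the colour.
    Equal bits at adjacent vertices put their copies in one class, which has only one chosen
    representative. *)
Lemma barrier_cover : exists2 Y, odd_cycle_cover e Y & #|Y| + 2 <= 2 * N.
Proof.
exists Z; last exact: card_Z.
pose gam v := (v, true) \in V0 :\: U.
exists gam => v w vZ wZ vw.
have ch x : x \notin Z -> (x, gam x) \in chosen.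
  move=> xZ; have [xS|xS] := boolP (x \in S).
    have cpx : cp x \in V0 :\: U.
      rewrite in_setD cpV andbT; apply: contra xZ => h.
      by rewrite !in_setU; apply/orP; left; apply/orP; left; rewrite inE xS.
    have -> : gam x = c x.
      rewrite /gam; move: cpx; rewrite /cp; case E : (c x) => //.
      by move=> _; rewrite in_setD V0E xS E andbF.
    by apply: notZ_rep; rewrite ?xS.
  have xV bb : (x, bb) \in V0 by rewrite V0E (negPf xS).
  have := no_both x; rewrite /both_out xS /= negb_and !negbK => ob.
  have nb : ~~ (((x, true) \in U) && ((x, false) \in U)).
    apply: contra xZ => h.
    by rewrite !in_setU; apply/orP; left; apply/orP; right; rewrite inE xS.
  rewrite /gam in_setD xV andbT; case t1 : ((x, true) \in U) nb ob => /= nb ob.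
    by apply: notZ_rep; rewrite ?in_setD ?xV ?andbT //= t1 orbT.
  by apply: notZ_rep; rewrite ?in_setD ?xV ?andbT ?t1 //= ob orbT.
apply/eqP => gg; have cv := ch v vZ; have cw := ch w wZ.
have : (v, gam v) = (w, gam w).
  apply: chosen_inj => //; apply: kap; try exact/reps_VU/chosen_reps.
  by rewrite /aux /= gg eqxx vw.
by case=> E _; rewrite E ei in vw.
Qed.

End Cover.

Theorem odd_paths : (exists P b p, breaking_family N P b p) \/
  exists2 Y, odd_cycle_cover e Y & #|Y| + 2 <= 2 * N.
Proof.
have [U [kappa [f [UV mf cU kap]]]] := berge aux_sym aux_irr V0.
have [small|] := breaking_paths_of_matching mf N; last by left.
right; exact: barrier_cover cU kap small.
Qed.

End OddPaths.

(** * Leading the terminals in while sparing most parity pieces *)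

Section Reroute.
Variables (T : finType) (e : rel T) (T0 S P : {set T}) (p : T -> seq T) (n : nat).
Hypothesis es : symmetric e.
Hypothesis PS : P \subset S.
Hypothesis pP : {in P, forall a, path e a (p a) /\ uniq (a :: p a)}.
Hypothesis dP : {in P &, forall a a' z, a != a' -> z \in a :: p a -> z \in a' :: p a' -> False}.
Hypothesis conn : exists x q, @path_family T e T0 S n x q.

Let same y z := [exists a in P, (y \in a :: p a) && (z \in a :: p a)].

(* Rerouting along the first part of a path of the family that is hit does not
   increase the number of steps outside the family. *)
Fixpoint cost y q := if q is z :: q' then ~~ same y z + cost z q' else 0.

Let cost_cat y q1 q2 : cost y (q1 ++ q2) = cost y q1 + cost (last y q1) q2.
Proof. by elim: q1 y => [|z q1 IH] y //=; rewrite IH addnA. Qed.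

Let cost_in a y q : a \in P -> {subset y :: q <= a :: p a} -> cost y q = 0.
Proof.
move=> aP; elim: q y => [|z q IH] y // sub /=.
have yP : y \in a :: p a by apply: sub; rewrite mem_head.
have zP : z \in a :: p a by apply: sub; rewrite !inE eqxx orbT.
rewrite IH => [|w wq]; last by apply: sub; rewrite inE wq orbT.
by rewrite (_ : same y z) //; apply/existsP; exists a; rewrite aP yP zP.
Qed.

Let cost0 a y q : a \in P -> y \in a :: p a -> cost y q = 0 -> last y q \in a :: p a.
Proof.
move=> aP; elim: q y => [|z q IH] y //= yP /eqP; rewrite addn_eq0 => /andP [].
rewrite eqb0 negbK => /existsP [a' /and3P [a'P ya' za']] /eqP; apply: IH.
have [<- //|ne] := eqVneq a' a; by case: (dP a'P aP ne ya' yP).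
Qed.

Lemma reroute : exists x q (P' : {set T}), [/\ @path_family T e T0 S n x q,
  forall i z, z \in belast (x i) (q i) -> z \notin S, P' \subset P, #|P| <= #|P'| + n &
  {in P', forall a i z, z \in a :: p a -> z \in x i :: q i -> False}].
Proof.
have [|[x q] [/= F mn]] := @ex_min (('I_n -> T) * ('I_n -> seq T))
   (fun xq => @path_family T e T0 S n xq.1 xq.2) (fun xq => \sum_i cost (xq.1 i) (xq.2 i)).
  by have [x [q F]] := conn; exists (x, q).
have [xT pt lS un dj] := F.
pose P' := [set a in P | [forall i, ~~ has (mem (x i :: q i)) (a :: p a)]].
have hit a : a \in P :\: P' -> exists i, last (x i) (q i) \in a :: p a.
  rewrite in_setD [a \in P']inE => /andP [+ aP]; rewrite aP andTb => /forallPn [i0]; rewrite negbK => h0.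
  pose Q := [set z | [exists i, z \in x i :: q i]].
  have hQ : has (mem Q) (a :: p a).
    by case/hasP: h0 => z zp zi; apply/hasP; exists z => //=; rewrite inE; apply/existsP; exists i0.
  have [p1 [p2 [ep lQ nQ]]] := first_in hQ.
  move: lQ; rewrite inE => /existsP [i xi]; exists i.
  have [q1 [q2 [eq lq]]] := mem_cut xi.
  have [pa ua] := pP aP.
  have sub1 : {subset a :: p1 <= a :: p a} by move=> z; rewrite ep -cat_cons mem_cat => ->.
  have subr : {subset last a p1 :: rev (belast a p1) <= a :: p1}.
    by move=> z; rewrite inE mem_rev => h; rewrite lastI mem_rcons inE.
  pose q' j := if j == i then q1 ++ rev (belast a p1) else q j.
  have lr : last (last a p1) (rev (belast a p1)) = a.
    by case: (p1) => [|y p1'] //=; rewrite rev_cons last_rcons.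
  have mem' j z : z \in x j :: q' j -> z \in x j :: q j \/ (j = i /\ z \in belast a p1).
    rewrite /q'; case: eqP => [->|_]; last by left.
    rewrite -cat_cons mem_cat mem_rev => /orP [h|h]; [left|by right].
    by rewrite eq -cat_cons mem_cat h.
  have nb (z : T) (j : 'I_n) : z \in belast a p1 -> z \notin x j :: q j.
    by move/nQ; rewrite inE => /existsPn /(_ j).
  have F' : @path_family T e T0 S n x q'.
    split=> // [j|j|j|j k z zj zk].
    - rewrite /q'; case: eqP => // ->; rewrite cat_path lq.
      have := pt i; rewrite eq cat_path => /andP [-> _] /=.
      rewrite rev_path; move: pa; rewrite ep cat_path => /andP [p1e _].
      by apply: sub_path p1e => y z; rewrite es.
    - rewrite /q'; case: eqP => // ->; rewrite last_cat lq lr; exact: (subsetP PS).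
    - rewrite /q'; case: eqP => // ->; rewrite -cat_cons cat_uniq rev_uniq.
      have := un i; rewrite eq -cat_cons cat_uniq => /and3P [-> _ _] /=.
      apply/andP; split; last first.
        by move: ua; rewrite ep -cat_cons cat_uniq (lastI a p1) rcons_uniq => /and3P [/andP [_ ->]].
      apply/hasPn => z; rewrite mem_rev => zb; apply/negP => zq; case/negP: (nb z i zb).
      by rewrite eq -cat_cons mem_cat; apply/orP; left.
    - case: (mem' _ _ zj) (mem' _ _ zk) => [zj'|[-> zj']] [zk'|[-> zk']] //.
      + exact: dj zj' zk'.
      + by case/negP: (nb z j zk').
      + by case/negP: (nb z k zj').
  have := mn (x, q') F'; rewrite /= (bigD1 i) //= [X in _ <= X](bigD1 i) //=.
  have -> : \sum_(j < n | j != i) cost (x j) (q' j) = \sum_(j < n | j != i) cost (x j) (q j).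
    by apply: eq_bigr => j /negPf ji; rewrite /q' ji.
  (* The new tail runs along the path of [a] and costs nothing. By minimality neither did the old
     tail, which therefore never left that path and ended on it. *)
  have c1 : cost (last a p1) (rev (belast a p1)) = 0.
    by apply: (cost_in aP) => z zz; apply/sub1/subr.
  rewrite leq_add2r /q' eqxx eq !cost_cat leq_add2l lq c1.
  rewrite leqn0 => /eqP c0; rewrite last_cat lq; apply: cost0 c0 => //.
  by apply: sub1; apply: mem_last.
(* Each path that is hit contains the end of one of the [n] paths, and the paths of the family are
   disjoint. *)
have hitP : #|P :\: P'| <= n.
  have /fin_all_exists [i iP] a : exists i : option 'I_n, a \in P :\: P' ->
      exists2 j, i = Some j & last (x j) (q j) \in a :: p a.
    have [/hit [j jP]|_] := boolP (a \in P :\: P'); last by exists None.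
    by exists (Some j) => _; exists j.
  have inj : {in P :\: P' &, injective i}.
    move=> a a' aP aP' ii; have [j ij ja] := iP a aP; have [j' ij' ja'] := iP a' aP'.
    apply/eqP/negPn/negP => ne; move: ii; rewrite ij ij' => -[jj].
    rewrite -jj in ja'; apply: dP ne ja ja'; [by case/setDP: aP|by case/setDP: aP'].
  have : #|[set Some j | j in 'I_n]| = n by rewrite card_imset ?card_ord //; apply: Some_inj.
  rewrite -(card_in_imset inj) => cS.
  apply: leq_trans (_ : #|[set Some j | j in 'I_n]| <= n); last by rewrite cS.
  apply/subset_leq_card/subsetP => _ /imsetP [a aP ->]; have [j -> _] := iP a aP.
  exact: imset_f.
have [x' [q' [F' sub' _ nS]]] := trim_family F.
exists x', q', P'; split=> //.
- by apply/subsetP => a; rewrite inE => /andP [].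
- by rewrite -(cardsID P' P) leq_add ?subset_leq_card ?subsetIr.
move=> a; rewrite inE => /andP [_ /forallP h] i z za /sub' zq.
by case/hasP: (h i); exists z.
Qed.

End Reroute.

(** * Assembling the paths *)

Section UPath.
Variables (T : finType) (e : rel T).

Definition upath x p y := [/\ path e x p, last x p = y & uniq (x :: p)].

Lemma upath_cat x p y q z : upath x p y -> upath y q z ->
  (forall w, w \in x :: p -> w \in y :: q -> w = y) ->
  upath x (p ++ q) z /\ (forall w, w \in x :: p ++ q -> w \in x :: p \/ w \in y :: q).
Proof.
move=> [pp lp up] [pq lq uq] pqy; split; last first.
  by move=> w; rewrite -cat_cons mem_cat inE => /orP [->|wq]; [left|right; rewrite inE wq orbT].
split; first by rewrite cat_path pp lp.
  by rewrite last_cat lp.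
have /andP [yq uq'] : (y \notin q) && uniq q := uq.
rewrite -cat_cons cat_uniq up uq' andbT.
apply/hasPn => w wq; apply/negP => wp; case/negP: yq.
by rewrite -(pqy w) // inE wq orbT.
Qed.

Lemma upath_rev x p y : symmetric e -> upath x p y ->
  exists q, [/\ upath y q x, size q = size p & y :: q =i x :: p].
Proof.
move=> es [pp lp up]; have E : y :: rev (belast x p) = rev (x :: p).
  by rewrite -lp -rev_rcons -lastI.
exists (rev (belast x p)); split.
- split.
  + by rewrite -lp rev_path; apply: sub_path pp => u v; rewrite es.
  + by rewrite -lp; case: (p) => [|z p'] //=; rewrite rev_cons last_rcons.
  + by rewrite E rev_uniq.
- by rewrite size_rev size_belast.
- by move=> w; rewrite E mem_rev.
Qed.

Lemma upath_jn C x y : jn e C x y -> exists2 p, upath x p y & {subset x :: p <= C}.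
Proof. by case/jn_path => p [h1 h2 h3 h4]; exists p. Qed.

Lemma cut_upath (c : T -> bool) x p y : path (cut e c) x p -> last x p = y -> uniq (x :: p) ->
  upath x p y /\ odd (size p) = (c x != c y).
Proof.
move=> pp lp up; split; first by split=> //; apply: sub_path pp => u v /andP [].
rewrite -{}lp; elim: p x pp {up} => [|z p IH] x /=; first by rewrite eqxx.
case/andP=> /andP [_ xz] /IH ->; move: xz; case: (c x); case: (c z); case: (c (last z p)) => //.
Qed.

End UPath.

Section Assemble.
Variables (T : finType) (e : rel T) (k : nat) (I : {set 'I_k}) (s t : 'I_k -> T).
Variables (c : T -> bool) (V X : {set T}).
Hypotheses (es : symmetric e) (XV : X \subset V) (lk : linked (cut e c) V X).
Variables (sq tq : 'I_k -> T) (sp tp : 'I_k -> seq T).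
Hypotheses (sP : forall i, upath e (s i) (sp i) (sq i)) (tP : forall i, upath e (t i) (tp i) (tq i)).
Hypotheses (sX : forall i, sq i \in X) (tX : forall i, tq i \in X).
Hypothesis sV : forall i z, z \in s i :: sp i -> z \in V -> z = sq i.
Hypothesis tV : forall i z, z \in t i :: tp i -> z \in V -> z = tq i.
Variables (a b : 'I_k -> T) (r : 'I_k -> seq T).
Hypothesis rP : forall i, i \in I -> upath e (a i) (r i) (b i).
Hypotheses (aX : forall i, i \in I -> a i \in X) (bX : forall i, i \in I -> b i \in X).
Hypothesis ab : forall i, i \in I -> a i != b i.
Hypothesis odd_r : forall i, i \in I -> odd (size (r i)) != (c (a i) != c (b i)).
Hypothesis rV : forall i z, i \in I -> z \in a i :: r i -> z \in V -> z = a i \/ z = b i.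
Hypothesis dSS : forall i j z, i != j -> z \in s i :: sp i -> z \in s j :: sp j -> False.
Hypothesis dTT : forall i j z, i != j -> z \in t i :: tp i -> z \in t j :: tp j -> False.
Hypothesis dST : forall i j z, z \in s i :: sp i -> z \in t j :: tp j -> False.
Hypothesis dRR : forall i j z, i \in I -> j \in I -> i != j ->
  z \in a i :: r i -> z \in a j :: r j -> False.
Hypothesis dRS : forall i j z, i \in I -> z \in a i :: r i -> z \in s j :: sp j -> i = j /\ z = a i.
Hypothesis dRT : forall i j z, i \in I -> z \in a i :: r i -> z \in t j :: tp j -> i = j /\ z = b i.

Variable p : 'I_k -> bool.

Let flip i := (i \in I) &&
  (odd (size (sp i)) (+) (c (sq i) != c (tq i)) (+) odd (size (tp i)) != p i).
(** The links to be found in the bipartite graph: index (i, false) starts at [sq i]; (i, true)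
    exists only when the parity must be changed, and then leads from the far end [b i] of the piece
    to [tq i]. *)
Let J : finType := {x : 'I_k * bool | x.2 ==> flip x.1}.
Let src (x : J) := if (val x).2 then b (val x).1 else sq (val x).1.
Let dst (x : J) := if (val x).2 then tq (val x).1 else
  if flip (val x).1 then a (val x).1 else tq (val x).1.

Let sqS i : sq i \in s i :: sp i. Proof. by case: (sP i) => _ <- _; apply: mem_last. Qed.
Let tqT i : tq i \in t i :: tp i. Proof. by case: (tP i) => _ <- _; apply: mem_last. Qed.
Let aR i : a i \in a i :: r i. Proof. exact: mem_head. Qed.
Let bR i : i \in I -> b i \in a i :: r i. Proof. by case/rP => _ <- _; apply: mem_last. Qed.
Let flipI i : flip i -> i \in I. Proof. by case/andP. Qed.

Let own i z := [\/ z \in s i :: sp i, z \in t i :: tp i | flip i /\ z \in a i :: r i].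

Let own_disj i j z : own i z -> own j z -> i = j.
Proof.
move=> hi hj; apply/eqP/negPn/negP => ij.
case: hi => [hi|hi|[fi hi]]; case: hj => [hj|hj|[fj hj]].
- exact: dSS ij hi hj.
- exact: dST hi hj.
- by have [E _] := dRS (flipI fj) hj hi; rewrite E eqxx in ij.
- exact: dST hj hi.
- exact: dTT ij hi hj.
- by have [E _] := dRT (flipI fj) hj hi; rewrite E eqxx in ij.
- by have [E _] := dRS (flipI fi) hi hj; rewrite E eqxx in ij.
- by have [E _] := dRT (flipI fi) hi hj; rewrite E eqxx in ij.
- exact: dRR (flipI fi) (flipI fj) ij hi hj.
Qed.

Let srcX x : src x \in X.
Proof.
rewrite /src; case: x => -[i bb] /= h; case: bb h => //= fi; exact/bX/flipI.
Qed.
Let dstX x : dst x \in X.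
Proof. by rewrite /dst; case: ifP => // _; case: ifP => // /flipI; apply: aX. Qed.

Let src_own x : own (val x).1 (src x).
Proof.
rewrite /src; case: x => -[i bb] /= h; case: bb h => /= fi; last by apply: Or31.
by apply: Or33; split=> //; apply/bR/flipI.
Qed.
Let dst_own x : own (val x).1 (dst x).
Proof.
rewrite /dst; case: ifP => _; first by apply: Or32.
by case: ifP => fi; [apply: Or33|apply: Or32].
Qed.

Let sq_b i : i \in I -> sq i != b i.
Proof.
move=> iI; apply/eqP => E; have := sqS i; rewrite E => h.
by have [_ ba] := dRS iI (bR iI) h; have := ab iI; rewrite ba eqxx.
Qed.
Let sq_tq i : sq i != tq i.
Proof. by apply/eqP => E; apply: dST (sqS i) _; rewrite E; apply: tqT. Qed.
Let a_tq i : i \in I -> a i != tq i.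
Proof.
move=> iI; apply/eqP => E; have := tqT i; rewrite -E => h.
by have [_ aB] := dRT iI (aR i) h; have := ab iI; rewrite aB eqxx.
Qed.

Let pairs x y : x != y -> [disjoint [set src x; dst x] & [set src y; dst y]].
Proof.
move=> xy; apply: disjointI => z zx zy.
have E : (val x).1 = (val y).1.
  apply: (@own_disj _ _ z).
    by case/set2P: zx => ->; [apply: src_own|apply: dst_own].
  by case/set2P: zy => ->; [apply: src_own|apply: dst_own].
case: x y xy E zx zy => -[i bx] hx [[j by'] hy] xy /= E; rewrite -{j}E in hy xy *.
have ne : bx != by' by apply: contraNneq xy => E; apply/eqP/val_inj; rewrite /= E.
have fi : flip i by move: (hx) (hy) ne; rewrite /=; case: (bx); case: (by').
have iI := flipI fi; have := sq_b iI; have := sq_tq i; have := ab iI; have := a_tq iI.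
rewrite !inE /src /dst /= fi; move: ne; case: (bx); case: (by') => //= _ n1 n2 n3 n4.
  case/orP => /eqP -> /orP [] /eqP E; by [rewrite E eqxx in n4|rewrite E eqxx in n2|rewrite E eqxx in n3|rewrite E eqxx in n1].
case/orP => /eqP -> /orP [] /eqP E; by [rewrite E eqxx in n4|rewrite E eqxx in n2|rewrite E eqxx in n3|rewrite E eqxx in n1].
Qed.

Theorem assemble_paths : exists P : 'I_k -> seq T,
    (forall i, [/\ path e (s i) (P i), last (s i) (P i) = t i, uniq (s i :: P i) &
                   (i \in I -> odd (size (P i)) = p i)]) /\
    (forall i j, i != j -> [disjoint (s i :: P i) & (s j :: P j)]).
Proof.
have [C [CV dC jC CX]] := lk srcX dstX pairs.
have /fin_all_exists [w wP] x : exists w, [/\ upath e (src x) w (dst x),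
    odd (size w) = (c (src x) != c (dst x)) & {subset src x :: w <= C x}].
  have [w [w1 w2 w3] w4] := upath_jn (jC x); exists w.
  by have [h1 h2] := cut_upath w1 w2 w3.
have rootC x z : z \in C x -> z \in X -> z = src x \/ z = dst x.
  by move=> zC zX; apply/set2P/(subsetP (CX x)); rewrite inE zC.
have inV x z : z \in C x -> z \in V by apply: (subsetP (CV x)).
(* The outer pieces meet [V] only in roots, and a link contains no roots but its own, so it touches
   no piece of another pair. *)
have Cown x j z : z \in C x -> own j z -> (val x).1 = j.
  move=> zC oz; have zV := inV _ _ zC.
  have zX : z \in X.
    case: oz => [h|h|[fj h]]; [by rewrite (sV h zV)|by rewrite (tV h zV)|].
    by case: (rV (flipI fj) h zV) => ->; [apply/aX/flipI|apply/bX/flipI].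
  apply: own_disj oz; case: (rootC _ _ zC zX) => ->; [exact: src_own|exact: dst_own].
pose U i z := own i z \/ exists2 x, (val x).1 = i & z \in C x.
have dU i j z : U i z -> U j z -> i = j.
  case=> [h|[x xi zx]]; case=> [h'|[y yj zy]].
  - exact: own_disj h h'.
  - by rewrite -yj; apply: esym; exact: Cown zy h.
  - by rewrite -xi; exact: Cown zx h'.
  - rewrite -xi -yj; have [-> //|xy] := eqVneq x y; case: (disj_eq (dC _ _ xy) zx zy).
suff /fin_all_exists [P PP] i : exists q, [/\ upath e (s i) q (t i), i \in I -> odd (size q) = p i &
    forall z, z \in s i :: q -> U i z].
  exists P; split=> [i|i j ij]; first by have [[h1 h2 h3] h4 _] := PP i.
  rewrite disjoint_has; apply/hasPn => z zi; apply/negP => zj; case/eqP: ij.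
  by have [_ _ hi] := PP i; have [_ _ hj] := PP j; apply: dU (hi z zi) (hj z zj).
have [tr [trP trs trm]] := upath_rev es (tP i).
have h0 : (i, false).2 ==> flip (i, false).1 by [].
pose x0 : J := Sub (i, false) h0.
have [wp0 wo0 wC0] := wP x0.
have src0 : src x0 = sq i by [].
rewrite src0 in wp0 wo0 wC0.
have U0 z : z \in sq i :: w x0 -> U i z by move=> /wC0 zC; right; exists x0.
have [u1 m1] : upath e (s i) (sp i ++ w x0) (dst x0) /\
    (forall z, z \in s i :: sp i ++ w x0 -> z \in s i :: sp i \/ z \in sq i :: w x0).
  by apply: upath_cat (sP i) wp0 _ => z zs /wC0 /inV; apply: sV.
have sizes : odd (size tr) = odd (size (tp i)) by rewrite trs.
case fi : (flip i); last first.
  have d0 : dst x0 = tq i by rewrite /dst /= fi.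
  rewrite d0 in wp0 wo0 u1.
  have [|u2 m2] := upath_cat u1 trP.
    move=> z /m1 [zs|/wC0 zC]; rewrite trm => zt; first by case: (dST zs zt).
    by apply: tV zt (inV _ _ zC).
  exists ((sp i ++ w x0) ++ tr); split=> //.
    move=> iI; rewrite !size_cat !oddD sizes wo0; move: fi; rewrite /flip iI /=.
    by move/negbFE/eqP.
  move=> z /m2 [/m1 [zs|/U0 //]|]; first by left; apply: Or31.
  by rewrite trm => zt; left; apply: Or32.
have iI := flipI fi.
have h1 : (i, true).2 ==> flip (i, true).1 by rewrite /= fi.
pose x1 : J := Sub (i, true) h1.
have [wp1 wo1 wC1] := wP x1.
have src1 : src x1 = b i by [].
have dst1 : dst x1 = tq i by [].
have dst0 : dst x0 = a i by rewrite /dst /= fi.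
rewrite src1 dst1 in wp1 wo1 wC1; rewrite dst0 in wp0 wo0 u1.
have x01 : x0 != x1 by apply/eqP => /(congr1 val).
have b0 z : z \in C x0 -> z = b i -> False.
  move=> zC zb; rewrite zb in zC; have [E|E] := rootC _ _ zC (bX iI).
    by have := sq_b iI; rewrite E src0 eqxx.
  by have := ab iI; rewrite E dst0 eqxx.
have tq0 z : z \in C x0 -> z = tq i -> False.
  move=> zC zb; rewrite zb in zC; have [E|E] := rootC _ _ zC (tX i).
    by have := sq_tq i; rewrite E src0 eqxx.
  by have := a_tq iI; rewrite E dst0 eqxx.
have sq1 z : z \in C x1 -> z = sq i -> False.
  move=> zC zb; rewrite zb in zC; have [E|E] := rootC _ _ zC (sX i).
    by have := sq_b iI; rewrite E src1 eqxx.
  by have := sq_tq i; rewrite E dst1 eqxx.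
have a1 z : z \in C x1 -> z = a i -> False.
  move=> zC zb; rewrite zb in zC; have [E|E] := rootC _ _ zC (aX iI).
    by have := ab iI; rewrite E src1 eqxx.
  by have := a_tq iI; rewrite E dst1 eqxx.
have [|u2 m2] := upath_cat u1 (rP iI).
  move=> z /m1 [zs|/wC0 zC] zr; first by case: (dRS iI zr zs).
  by case: (rV iI zr (inV _ _ zC)) => // /(b0 _ zC).
have [|u3 m3] := upath_cat u2 wp1.
  move=> z /m2 [/m1 [zs|/wC0 zC]|zr] /wC1 zC1.
  - by case: (sq1 _ zC1); apply: sV zs (inV _ _ zC1).
  - by case: (disj_eq (dC _ _ x01) zC zC1).
  - by case: (rV iI zr (inV _ _ zC1)) => // /(a1 _ zC1).
have [|u4 m4] := upath_cat u3 trP.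
  move=> z zz; rewrite trm => zt; case: (m3 _ zz) => [/m2 [/m1 [zs|/wC0 zC]|zr]|/wC1 zC1].
  - by case: (dST zs zt).
  - by case: (tq0 _ zC); apply: tV zt (inV _ _ zC).
  - have [_ E] := dRT iI zr zt; apply: tV zt _; rewrite E; exact: (subsetP XV _ (bX iI)).
  - exact: tV zt (inV _ _ zC1).
exists ((((sp i ++ w x0) ++ r i) ++ w x1) ++ tr); split=> //.
  move=> _; rewrite !size_cat !oddD sizes wo0 wo1; move: fi (odd_r iI); rewrite /flip iI /=.
  case: (odd (size (sp i))); case: (odd (size (tp i))); case: (odd (size (r i))); case: (p i);
  by case: (c (sq i)); case: (c (tq i)); case: (c (a i)); case: (c (b i)).
move=> z /m4 [/m3 [/m2 [/m1 [zs|/U0 //]|zr]|/wC1 zC]|].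
- by left; apply: Or31.
- by left; apply: Or33.
- by right; exists x1.
- by rewrite trm => zt; left; apply: Or32.
Qed.

End Assemble.

Lemma path_closed (T : eqType) (e : rel T) (W : pred T) x p :
  (forall y z, W y -> e y z -> W z) -> W x -> path e x p -> W (last x p).
Proof. by move=> cl; elim: p x => // y p IH x Wx /= /andP [xy]; apply: IH; apply: cl xy. Qed.

Section Connected.
Variables (T : finType) (e : rel T) (d : nat).
Hypotheses (es : symmetric e) (conn : k_connected e d).

Lemma min_degree v : irreflexive e -> d <= #|nbh e setT v|.
Proof.
move=> ei; have [dT cn] := conn; rewrite leqNgt; apply/negP => lt.
have vN : v \notin nbh e setT v by rewrite inE ei andbF.
have [y yn] : exists y, y \notin v |: nbh e setT v.
  apply/existsP; rewrite -negb_forall; apply/negP => /forallP h.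
  have : #|[set: T]| <= #|v |: nbh e setT v| by apply/subset_leq_card/subsetP => z _.
  by rewrite cardsT cardsU1 vN; nlia.
move: yn; rewrite in_setU1 negb_or => /andP [yv yN].
have /connectP [[|z p] /= pp ly] := cn _ lt _ _ vN yN; first by rewrite ly eqxx in yv.
by move: pp => /andP [/and3P [vz _]]; rewrite inE in_setT vz.
Qed.

Lemma many_paths (A B : {set T}) n : n <= #|A| -> n <= #|B| -> n <= d ->
  exists x q, @path_family T e A B n x q.
Proof.
move=> nA nB nd; apply: menger => S sep; rewrite leqNgt; apply/negP => lt.
have pick (D : {set T}) : n <= #|D| -> exists2 x, x \in D & x \notin S.
  by move=> nD; apply/subsetPn; apply/negP => /subset_leq_card; move: lt nD; nlia.
have [x xA xS] := pick A nA; have [y yB yS] := pick B nB.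
have [_ cn] := conn; have /connectP [p pp ly] := cn S (leq_trans lt nd) x y xS yS.
have pe : path e x p by apply: sub_path pp => a b /and3P [].
rewrite ly in yB; have /hasP [z zp zS] := sep x p xA pe yB.
have cl (a b : T) : a \notin S -> del_rel e S a b -> b \notin S by move=> _ /and3P [].
case/mem_cut: zp => p1 [p2 [ep lz]]; move: pp; rewrite ep cat_path => /andP [pp _].
by have := path_closed cl xS pp; rewrite lz [z \in S]zS.
Qed.

End Connected.

(** * The two cases: many parity-breaking paths, or a small odd cycle cover *)

Section Cases.
Variables (T : finType) (e : rel T) (k : nat) (I : {set 'I_k}) (s t : 'I_k -> T).
Hypotheses (es : symmetric e) (ei : irreflexive e) (k0 : 0 < k).
Hypothesis conn : k_connected e (26 * k + 24 * #|I|).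
Hypotheses (sI : injective s) (tI : injective t) (st : forall i j, s i != t j).
Variable p : 'I_k -> bool.

Definition solution := exists P : 'I_k -> seq T,
  (forall i, [/\ path e (s i) (P i), last (s i) (P i) = t i, uniq (s i :: P i) &
                 (i \in I -> odd (size (P i)) = p i)]) /\
  (forall i j, i != j -> [disjoint (s i :: P i) & (s j :: P j)]).

Let m := k + #|I|.
Let K := 12 * m + k.
Let N := 2 * k + #|I|.
Let Ik : #|I| <= k. Proof. by rewrite -[k in _ <= k]card_ord max_card. Qed.
Let T0 := [set s i | i in 'I_k] :|: [set t i | i in 'I_k].
Let cT0 : #|T0| = 2 * k.
Proof.
rewrite card_disjU ?card_imset ?card_ord //; first by nlia.
by apply: disjointI => z /imsetP [i _ ->] /imsetP [j _ /eqP]; rewrite (negPf (st i j)).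
Qed.
Let sT0 i : s i \in T0. Proof. by rewrite in_setU imset_f. Qed.
Let tT0 i : t i \in T0. Proof. by rewrite in_setU imset_f ?orbT. Qed.

Lemma far_case c (V P : {set T}) b r :
  (forall X : {set T}, X \subset V -> #|X| <= 2 * m -> linked (cut e c) V X) ->
  2 * k <= #|V| -> breaking_family e c V N P b r -> solution.
Proof.
move=> lk cV [cP bP dP].
have PV : P \subset V by apply/subsetP => a /bP [[]].
have [||x [q [P' [F nV P'P cP' un]]]] := @reroute T e T0 V P r (2 * k) es PV _ dP.
- by move=> a /bP [_ _ [h _] h' _].
- by apply: (many_paths conn) => //; [rewrite cT0|nlia].
have [xT pt lV up dj] := F.
have xI : injective x by move=> i j ij; apply: (dj i j (x i)); rewrite ?mem_head // ij mem_head.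
have sur z : z \in T0 -> exists i, x i = z.
  move=> zT; have : z \in [set x i | i in 'I_(2 * k)].
    suff -> : [set x i | i in 'I_(2 * k)] = T0 by [].
    apply/eqP; rewrite eqEcard card_imset // card_ord cT0 leqnn andbT.
    by apply/subsetP => w /imsetP [j _ ->].
  by case/imsetP => i _ ->; exists i.
have /fin_all_exists [si siP] i := sur _ (sT0 i).
have /fin_all_exists [ti tiP] i := sur _ (tT0 i).
have cI : #|I| <= #|P'| by move: cP cP'; rewrite /N; nlia.
(* The members of [I] receive distinct surviving pieces by position; the default [s i] is never
   taken for [i] in [I], because |I| <= |P'|. *)
pose a (i : 'I_k) := nth (s i) (enum P') (index i (enum I)).
have aI i : i \in I -> index i (enum I) < size (enum P').
  by move=> iI; rewrite -cardE; apply: leq_trans cI; rewrite cardE index_mem mem_enum.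
have aP i : i \in I -> a i \in P' by move=> iI; rewrite -mem_enum mem_nth // aI.
have aP0 i : i \in I -> a i \in P by move/aP; apply: (subsetP P'P).
have ainj i j : i \in I -> j \in I -> a i = a j -> i = j.
  move=> iI jI; rewrite /a (set_nth_default (s j)) ?aI // => /eqP.
  rewrite nth_uniq ?aI ?enum_uniq // => /eqP E.
  by apply: (@index_inj _ i (enum I)); rewrite ?mem_enum.
pose sq i := last (x (si i)) (q (si i)); pose tq i := last (x (ti i)) (q (ti i)).
pose X := ([set sq i | i in 'I_k] :|: [set tq i | i in 'I_k]) :|: ([set a i | i in I] :|: [set b (a i) | i in I]).
have XV : X \subset V.
  apply/subsetP => z; rewrite !in_setU -!orbA => /or4P [] /imsetP [i iI ->]; rewrite ?lV //.
    exact: (subsetP PV _ (aP0 _ iI)).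
  by case: (bP _ (aP0 _ iI)) => [[]].
have cX : #|X| <= 2 * m.
  apply: leq_trans (cardU_le _ _) _.
  have h1 := cardU_le [set sq i | i in 'I_k] [set tq i | i in 'I_k].
  have h2 := cardU_le [set a i | i in I] [set b (a i) | i in I].
  apply: leq_trans (leq_add h1 h2) _.
  have -> : 2 * m = (k + k) + (#|I| + #|I|) by rewrite /m; nlia.
  by apply: leq_add; apply: leq_add; apply: leq_trans (leq_imset_card _ _) _; rewrite ?card_ord.
have tails i z : z \in x i :: q i -> z \in V -> z = last (x i) (q i).
  move=> zi zV; apply/eqP/negPn/negP => /(last_mem_belast zi) /nV; by rewrite zV.
apply: (@assemble_paths T e k I s t c V X es XV (lk X XV cX) sq tq (q \o si) (q \o ti) _ _ _ _ _ _ a (b \o a) (r \o a)).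
- by move=> i; rewrite -siP.
- by move=> i; rewrite -tiP.
- by move=> i; rewrite !in_setU imset_f.
- by move=> i; rewrite !in_setU; apply/orP; left; apply/orP; right; apply: imset_f.
- by move=> i z; rewrite -{1}siP; apply: tails.
- by move=> i z; rewrite -{1}tiP; apply: tails.
- by move=> i /aP0 /bP [_ _ [h1 h2] h3 _].
- by move=> i iI; rewrite !in_setU; apply/orP; right; apply/orP; left; apply: imset_f.
- by move=> i iI; rewrite !in_setU; apply/orP; right; apply/orP; right; apply/imsetP; exists i.
- by move=> i /aP0 /bP [].
- by move=> i /aP0 /bP [_ _ _ _ []].
- by move=> i z /aP0 /bP [_ _ _ _ [h _]] z1 z2; apply/set2P/h.
- move=> i j z ij; rewrite -{1}siP -{1}siP => zi zj; case/eqP: ij; apply: sI.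
  by rewrite -siP -[RHS]siP (dj _ _ _ zi zj).
- move=> i j z ij; rewrite -{1}tiP -{1}tiP => zi zj; case/eqP: ij; apply: tI.
  by rewrite -tiP -[RHS]tiP (dj _ _ _ zi zj).
- move=> i j z; rewrite -{1}siP -{1}tiP => zi zj; have := st i j.
  by rewrite -siP -tiP (dj _ _ _ zi zj) eqxx.
- move=> i j z iI jI ij zi zj; apply: (dP (a i) (a j)) zi zj; rewrite ?aP0 //.
  by apply: contraNneq ij => /(ainj _ _ iI jI) ->.
- by move=> i j z iI zi; rewrite -{1}siP => zj; case: (un _ (aP _ iI) _ _ zi zj).
- by move=> i j z iI zi; rewrite -{1}tiP => zj; case: (un _ (aP _ iI) _ _ zi zj).
Qed.

Section Near.
Variables (A Xc : {set T}) (u v : 'I_k -> T).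
Hypotheses (cXc : #|Xc| + 2 <= 2 * N).
Hypotheses (indA : independent e (A :\: Xc)) (indB : independent e (~: A :\: Xc)).
Hypothesis niceA : forall v, v \in Xc ->
  nbrs_in e v (A :\: Xc) < nbrs_in e v (~: A :\: Xc) -> v \in A.
Hypothesis niceB : forall v, v \in Xc ->
  nbrs_in e v (~: A :\: Xc) < nbrs_in e v (A :\: Xc) -> v \in ~: A.
Hypothesis pbm : parity_breaking_matching e s t I A u v.

Let c (x : T) := x \in A.
Let eH := cut e c.

Let cross x y : x \notin Xc -> y \notin Xc -> e x y -> eH x y.
Proof.
move=> xX yX xy; rewrite /eH /cut /= xy /=; apply/eqP => E.
have [xA|xA] := boolP (x \in A).
  by have := @indA x y; rewrite !in_setD xX yX xA -[y \in A]E [c x]xA xy => /(_ isT isT).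
have := @indB x y; rewrite !in_setD !in_setC xX yX xA -[y \in A]E [c x](negPf xA) xy.
by move=> /(_ isT isT).
Qed.

(** Of at least 26k + 24|I| neighbours, at most 2N - 2 = 4k + 2|I| - 2 lie in [Xc], and all others
    are across. *)
Let degX x : x \notin Xc -> 22 * m + 2 <= #|nbh eH setT x|.
Proof.
move=> xX; have : #|nbh e setT x| <= #|nbh eH setT x :|: Xc|.
  apply/subset_leq_card/subsetP => z; rewrite inE in_setT in_setU => xz.
  by case zX : (z \in Xc); rewrite ?orbT // orbF inE in_setT cross ?zX.
have := cardU_le (nbh eH setT x) Xc; have := min_degree conn x ei.
by move: cXc; rewrite /N /m; nlia.
Qed.

(** For a vertex of [Xc], niceness puts at least half of its neighbours outside [Xc] across the
    partition. *)
Let degc x : 22 * m + 2 <= 2 * #|nbh eH setT x|.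
Proof.
have [xX|/degX] := boolP (x \in Xc); last by nlia.
have nE (Z : {set T}) : nbrs_in e x Z = #|nbh e Z x| by [].
have : #|nbh e setT x| <= #|(nbh e (A :\: Xc) x :|: nbh e (~: A :\: Xc) x) :|: Xc|.
  apply/subset_leq_card/subsetP => z; rewrite inE in_setT andTb !in_setU => xz.
  rewrite ![_ \in nbh _ _ _]inE xz !in_setD in_setC !andbT.
  by case: (z \in Xc); case: (z \in A).
have := cardU_le (nbh e (A :\: Xc) x :|: nbh e (~: A :\: Xc) x) Xc.
have := cardU_le (nbh e (A :\: Xc) x) (nbh e (~: A :\: Xc) x).
have := min_degree conn x ei; have := niceA xX; have := niceB xX; rewrite !nE in_setC.
case xA : (x \in A) => nB nA.
  have le : #|nbh e (A :\: Xc) x| <= #|nbh e (~: A :\: Xc) x|.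
    by rewrite leqNgt; apply/negP => /nB.
  have : #|nbh e (~: A :\: Xc) x| <= #|nbh eH setT x|.
    apply/subset_leq_card/subsetP => z; rewrite !inE => /andP [/andP [zX zA] xz].
    by rewrite /eH /cut /= xz /c xA (negPf zA).
  by move: le cXc; rewrite /N /m; nlia.
have le : #|nbh e (~: A :\: Xc) x| <= #|nbh e (A :\: Xc) x|.
  by rewrite leqNgt; apply/negP => /nA.
have : #|nbh e (A :\: Xc) x| <= #|nbh eH setT x|.
  apply/subset_leq_card/subsetP => z; rewrite !inE => /andP [/andP [zX zA] xz].
  by rewrite /eH /cut /= xz /c xA zA.
by move: le cXc; rewrite /N /m; nlia.
Qed.

(** Inside [Xc] the set would offer fewer than 6m neighbours, counting [S], while each vertex has at
    least 11m + 1. *)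
Let escape (W S : {set T}) w : w \in W -> (forall x y, x \in W -> eH x y -> y \in W \/ y \in S) ->
  #|S| < 2 * m -> exists2 x, x \in W & x \notin Xc.
Proof.
move=> wW cl cS; apply/subsetPn; apply/negP => WX.
have : #|nbh eH setT w| <= #|Xc :|: S|.
  apply/subset_leq_card/subsetP => z; rewrite inE in_setT in_setU => wz.
  by case: (cl _ _ wW wz) => [/(subsetP WX) ->|->]; rewrite ?orbT.
have := cardU_le Xc S; have := degc w; move: cXc cS; rewrite /N /m; nlia.
Qed.

Let eHs : symmetric eH. Proof. exact: cut_sym. Qed.

Let near_massed (X : {set T}) : #|X| <= 2 * m -> massed m K eH setT X.
Proof.
move=> cX; have [dT cn] := conn; split=> //.
  have cj : #|[set: T] :\: X| + #|X| = #|T|.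
    by rewrite cardsDS ?subsetT // cardsT subnK // max_card.
  split; first by move: cj cX dT; rewrite /m; nlia.
  set j := #|_| in cj *.
  (* Doubled degrees: 22m + 2 for every vertex by [degc], and 22m more off [Xc] by [degX]. This
     exceeds 2Kj <= 26mj comfortably, since |Xc| <= 4m and j >= 22m. *)
  have h0 : j * (22 * m + 2) + (j - #|Xc|) * (22 * m) <= 2 * rho eH setT (setT :\: X).
    have : \sum_(x in setT :\: X) 2 * #|nbh eH setT x| <= 2 * rho eH setT (setT :\: X).
      rewrite -big_distrr leq_mul2l /=.
      under eq_bigr => x _ do rewrite -sum1_card.
      rewrite pair_big_dep /= sum1dep_card; apply/subset_leq_card/subsetP => -[x y].
      by rewrite inE /= => /andP [xV]; rewrite inE => /andP [yV xy]; apply/touchP; rewrite !in_setT; split; auto.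
    apply: leq_trans.
    apply: leq_trans (_ : \sum_(x in setT :\: X) ((22 * m + 2) + (x \notin Xc) * (22 * m)) <= _).
      rewrite big_split /= sum_nat_const leq_add2l -big_distrl /= leq_mul2r; apply/orP; right.
      have -> : \sum_(x in setT :\: X) (x \notin Xc) = #|(setT :\: X) :\: Xc|.
        rewrite -sum1_card big_mkcond [RHS]big_mkcond; apply: eq_bigr => x _.
        by rewrite !inE; case: (x \in X); case: (x \in Xc).
      rewrite cardsD leq_sub2l // subset_leq_card ?subsetIr //.
    apply: leq_sum => x _; case xX : (x \in Xc) => /=; first by rewrite mul0n addn0 degc.
    by have := @degX x; rewrite xX => /(_ isT); rewrite mul1n; nlia.
  have h1 : #|Xc| <= 4 * m by move: cXc; rewrite /N /m; nlia.
  have h2 : 22 * m <= j by move: cj cX dT; rewrite /m; nlia.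
  have h3 : (j - 4 * m) * (22 * m) <= (j - #|Xc|) * (22 * m).
    by rewrite leq_mul2r leq_sub2l ?orbT.
  have h4 : 2 * K * j <= 26 * m * j.
    by rewrite leq_mul2r; apply/orP; right; rewrite /K /m; nlia.
  have h5 : 18 * m * (22 * m) <= 18 * m * j by rewrite leq_mul2l h2 orbT.
  have [w jw] : exists w, j = w + 4 * m by exists (j - 4 * m); rewrite subnK //; nlia.
  have h6 : j - 4 * m = w by rewrite jw addnK.
  rewrite {}h6 in h3; move: h0 h3 h4 h5; move: ((j - #|Xc|) * (22 * m)) (rho _ _ _) => D r.
  by rewrite jw; clear; nlia.
move=> W WX [mW _]; rewrite leqNgt; apply/negP => lt; set S := nb eH setT W in lt.
have cS : #|S| < 2 * m by apply: leq_trans lt cX.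
have [w wW] : exists w, w \in W by apply/card_gt0P; move: mW k0; rewrite /m; nlia.
have [x xX xS] : exists2 x, x \in X & x \notin S.
  by apply/subsetPn; apply/negP => /subset_leq_card; move: lt; nlia.
have xW : x \notin W by apply/negP => /(subsetP WX); rewrite in_setD xX.
have clW y z : y \in W -> eH y z -> z \in W \/ z \in S.
  move=> yW yz; case zW : (z \in W); [by left|right]; apply/nbP; rewrite in_setT zW; split=> //.
  by exists y.
have [w1 w1W w1X] := escape wW clW cS.
pose R := ~: (W :|: S).
have RP y : (y \in R) = (y \notin W) && (y \notin S) by rewrite in_setC in_setU negb_or.
have clR y z : y \in R -> eH y z -> z \in R \/ z \in S.
  rewrite !RP => /andP [yW yS] yz; case zS : (z \in S); [by right|left]; rewrite andbT.
  by apply/negP => zW; rewrite eHs in yz; case: (clW _ _ zW yz) => h; [rewrite h in yW|rewrite h in yS].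
have xR : x \in R by rewrite RP xW.
have [r1 r1R r1X] := escape xR clR cS.
have wS : w1 \notin S by apply/negP => /nbP []; rewrite w1W.
have cZ : #|Xc :|: S| < 26 * k + 24 * #|I|.
  by apply: leq_ltn_trans (cardU_le _ _) _; move: cXc cS; rewrite /N /m; nlia.
have w1Z : w1 \notin Xc :|: S by rewrite in_setU negb_or w1X.
have r1Z : r1 \notin Xc :|: S by move: r1R; rewrite RP in_setU negb_or r1X => /andP [].
(* Deleting [Xc] and [S] leaves G connected, and all remaining edges cross the partition. So a path
   from [w1] cannot leave [W], although [r1] is outside. *)
have /connectP [q pq lq] := cn _ cZ _ _ w1Z r1Z.
have cl (y z : T) : y \in W -> del_rel e (Xc :|: S) y z -> z \in W.
  move=> yW /and3P [yz]; rewrite !in_setU !negb_or => /andP [yX yS] /andP [zX zS].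
  by case: (clW _ _ yW (cross yX zX yz)) => // h; rewrite h in zS.
have := path_closed (W := [in W]) cl w1W pq; rewrite -lq => rW.
by move: r1R; rewrite RP [r1 \in W]rW.
Qed.

Lemma near_case : solution.
Proof.
have [mat dm dmt] := pbm.
(* A matching edge may contain terminals of its own pair. It is oriented so that the path from [s i]
   can only touch it at [a i], and the path to [t i] only at [b i]. *)
pose sw i := (u i == t i) || (v i == s i).
pose a i := if sw i then v i else u i; pose b i := if sw i then u i else v i.
have abE i : [set a i; b i] = [set u i; v i] by rewrite /a /b; case: ifP => // _; rewrite setUC.
have abP i : i \in I -> e (a i) (b i) /\ c (a i) = c (b i).
  by case/mat => h1 h2; rewrite /a /b /c; case: ifP => _; rewrite ?h2 // es.
have uv i : i \in I -> u i != v i by case/mat => h _; apply: contraTneq h => ->; rewrite ei.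
have bs i : i \in I -> b i != s i.
  move=> iI; rewrite /b /sw; case: (u i =P t i) => [-> /=|_ /=]; first by rewrite eq_sym st.
  by case: (v i =P s i) => [<-|/eqP //]; apply: uv.
have at' i : i \in I -> a i != t i.
  move=> iI; rewrite /a /sw; case: (u i =P t i) => [<- /=|/eqP ut /=]; first by rewrite eq_sym uv.
  by case: (v i =P s i) => [->|] //; rewrite st.
have mt i j z : i \in I -> z \in [set a i; b i] -> z \in [set s j; t j] -> i = j.
  move=> iI; rewrite abE => z1 z2; apply/eqP/negPn/negP => ij; exact: disj_eq (dmt _ _ iI ij) z1 z2.
pose X := T0 :|: ([set a i | i in I] :|: [set b i | i in I]).
have cX : #|X| <= 2 * m.
  apply: leq_trans (cardU_le _ _) _; rewrite cT0.
  have h2 := cardU_le [set a i | i in I] [set b i | i in I].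
  have -> : 2 * m = 2 * k + (#|I| + #|I|) by rewrite /m; nlia.
  rewrite leq_add2l; apply: leq_trans h2 _.
  by apply: leq_add; apply: leq_trans (leq_imset_card _ _) _.
have lkX : linked eH setT X.
  apply: (@massed_linked T m K); rewrite ?/K; try (rewrite /m; nlia).
  - exact: eHs.
  - exact: cut_irr.
  - exact: near_massed.
have inr i z : (z \in a i :: [:: b i]) = (z \in [set a i; b i]) by rewrite !inE.
apply: (@assemble_paths T e k I s t c setT X es (subsetT X) lkX s t (fun=> [::]) (fun=> [::]) _ _ _ _ _ _ a b (fun i => [:: b i])).
- by [].
- by [].
- by move=> i; rewrite in_setU sT0.
- by move=> i; rewrite in_setU tT0.
- by move=> i z; rewrite inE => /eqP.
- by move=> i z; rewrite inE => /eqP.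
- move=> i iI; have [h _] := abP i iI; split=> //=; first by rewrite h.
  by rewrite inE andbT; apply: contraTneq h => ->; rewrite ei.
- by move=> i iI; rewrite !in_setU; apply/orP; right; apply/orP; left; apply: imset_f.
- by move=> i iI; rewrite !in_setU; apply/orP; right; apply/orP; right; apply: imset_f.
- by move=> i iI; have [h _] := abP i iI; apply: contraTneq h => ->; rewrite ei.
- by move=> i iI; have [_ ->] := abP i iI; rewrite eqxx.
- by move=> i z _; rewrite inr => /set2P.
- by move=> i j z ij; rewrite !inE => /eqP -> /eqP /sI E; rewrite E eqxx in ij.
- by move=> i j z ij; rewrite !inE => /eqP -> /eqP /tI E; rewrite E eqxx in ij.
- by move=> i j z; rewrite !inE => /eqP -> /eqP E; have := st i j; rewrite E eqxx.
- by move=> i j z iI jI ij; rewrite !inr !abE; apply: disj_eq (dm _ _ iI jI ij).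
- move=> i j z iI; rewrite inr mem_seq1 => zab /eqP zs.
  have ij : i = j by apply: (mt i j z iI zab); rewrite zs !inE eqxx.
  split=> //; case/set2P: zab => // zb; have := bs i iI; by rewrite -zb zs ij eqxx.
- move=> i j z iI; rewrite inr mem_seq1 => zab /eqP zs.
  have ij : i = j by apply: (mt i j z iI zab); rewrite zs !inE eqxx orbT.
  split=> //; case/set2P: zab => // zb; have := at' i iI; by rewrite -zb zs ij eqxx.
Qed.

End Near.

Lemma nice_partition_solution (A : {set T}) u v : nice_partition e A -> parity_breaking_matching e s t I A u v -> solution.
Proof.
move=> [Xc [[ocX minX] iA iB nA nB]] pbm.
have K1 : 12 * m < K by rewrite /K; nlia.
have K2 : 25 * m <= 2 * K by rewrite /K /m; nlia.
have m0 : 0 < m by rewrite /m; nlia.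
have deg x : 2 * K <= #|nbh e setT x|.
  by have := min_degree conn x ei; rewrite /K /m; nlia.
have [dT cn] := conn.
have [c [V [V6 lk]]] := dense_bipartite es ei m0 K1 K2 deg (leq_ltn_trans (leq0n _) dT).
have conn' : forall X : {set T}, #|X| < 2 * N -> forall x y, x \notin X -> y \notin X -> connect (del_rel e X) x y.
  by move=> X cX; apply: cn; apply: leq_trans cX _; rewrite /N; nlia.
have VN : 2 * N <= #|V| by move: V6; rewrite /N /m; nlia.
have [[P [b [r fam]]]|[Y ocY cY]] := odd_paths c es ei conn' VN.
  by apply: far_case lk _ fam; move: V6; rewrite /m; nlia.
apply: (near_case _ iA iB nA nB pbm).
by apply: leq_trans cY; rewrite leq_add2r minX.
Qed.

End Cases.

(* Parity p i = true means "odd". The path P_i is s i :: P i (vertex sequence);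
   its length is size (P i). *)
Theorem theorem4 (T : finType) (e : rel T) (k : nat) (I : {set 'I_k})
    (s t : 'I_k -> T) :
  simple_graph e ->
  0 < k ->
  k_connected e (26 * k + 24 * #|I|) ->
  injective s -> injective t -> (forall i j, s i != t j) ->
  (exists A : {set T}, nice_partition e A /\ has_parity_breaking_matching e s t I A) ->
  forall p : 'I_k -> bool,
  exists P : 'I_k -> seq T,
    (forall i, [/\ path e (s i) (P i), last (s i) (P i) = t i, uniq (s i :: P i) &
                   (i \in I -> odd (size (P i)) = p i)]) /\
    (forall i j, i != j -> [disjoint (s i :: P i) & (s j :: P j)]).
Proof.
move=> [es ei] k0 conn sI tI st [A [nice [u [v pbm]]]] p.
by have [P [h1 h2]] := nice_partition_solution es ei k0 conn sI tI st p nice pbm; exists P.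
Qed.
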